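(* For every $\beta\ge0$, the finite Hilbert transform $T$ maps $L(\log L)^{1+\beta}$ boundedly into $L(\log L)^{\beta}$.
   Context: All functions are complex-valued, Lebesgue measurable on $(-1,1)$, identified when equal a.e.; $L^1=L^1(-1,1)$. The decreasing rearrangement of $f$ is $f^*(t)=\inf\{\lambda\ge 0: |\{x\in(-1,1):|f(x)|>\lambda\}|\le t\}$, $0<t<2$. For $\alpha\ge0$, $L(\log L)^\alpha=L(\log L)^\alpha(-1,1)$ is the space of all measurable $f$ with $\|f\|_{L(\log L)^\alpha}:=\int_0^2 f^*(t)\log^\alpha\big(\tfrac{2e}{t}\big)\,dt<\infty$, with this norm; in particular $L(\log L)^0=L^1$ and $L(\log L)^1=L\log L$. All these spaces are contained in $L^1$. For $f\in L^1$ the finite Hilbert transform is $$T(f)(t)=\lim_{\varepsilon\to0^+}\frac1\pi\Big(\int_{-1}^{t-\varepsilon}+\int_{t+\varepsilon}^1\Big)\frac{f(x)}{x-t}\,dx ,$$ which exists for a.e. $t\in(-1,1)$ and is measurable. *)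

(* Defs.v *)
From HB Require Import structures.
From mathcomp Require Import all_boot all_order all_algebra.
From mathcomp Require Import complex.
From mathcomp Require Import all_classical all_reals all_analysis.

Set Implicit Arguments.
Unset Strict Implicit.
Unset Printing Implicit Defensive.

Import Order.TTheory GRing.Theory Num.Theory.
Import numFieldNormedType.Exports.

Local Open Scope classical_set_scope.
Local Open Scope ring_scope.
Local Open Scope complex_scope.

(* The real line with the sigma-algebra of Lebesgue-measurable (not only Borel)
   sets, i.e. the domain of completed_lebesgue_measure. *)
Notation lebesgueR R := (caratheodory_type ((@wlength R idfun)^*)%mu).

Section Defs.
Context {R : realType}.

Local Notation mu := (@completed_lebesgue_measure R).

(* Functions on (-1, 1) are represented by total functions on R, of which only
   the values on this interval matter. *)
Definition I11 : set (lebesgueR R) := `]-1, 1[%classic.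

Definition cmeasurable_fun (D : set (lebesgueR R)) (f : lebesgueR R -> R[i]) :=
  measurable_fun D (fun x => complex.Re (f x)) /\
  measurable_fun D (fun x => complex.Im (f x)).

Definition cintegral (D : set (lebesgueR R)) (f : lebesgueR R -> R[i]) : R[i] :=
  (\int[mu]_(x in D) complex.Re (f x)) +i* (\int[mu]_(x in D) complex.Im (f x)).

(* Extended-real-valued: the infimum of the empty set is +oo, not the value 0
   of inf in R. *)
Definition rearrangement (f : lebesgueR R -> R[i]) (t : R) : \bar R :=
  ereal_inf [set l%:E | l in [set l : R | 0 <= l /\
    (mu (I11 `&` [set x | (l < Normc.normc (f x))%R]) <= t%:E)%E]].

Definition LlogL_norm (alpha : R) (f : lebesgueR R -> R[i]) : \bar R :=
  (\int[mu]_(t in `]0%R, 2%R[)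
     (rearrangement f t * (ln (2 * expR 1 / t) `^ alpha)%:E))%E.

Definition LlogL (alpha : R) : set (lebesgueR R -> R[i]) :=
  [set f | cmeasurable_fun I11 f /\ (LlogL_norm alpha f < +oo)%E].

Definition truncated_hilbert (f : lebesgueR R -> R[i]) (t eps : R) : R[i] :=
  (pi^-1)%:C *
  (cintegral `]-1, t - eps[ (fun x => f x / (x - t)%:C) +
   cintegral `]t + eps, 1[ (fun x => f x / (x - t)%:C)).

(* R[i]^o carries the topology of the complex plane; lim is 0 where the
   limit does not exist. *)
Definition finite_hilbert (f : lebesgueR R -> R[i]) : lebesgueR R -> R[i] :=
  fun t => lim ((truncated_hilbert f t eps : R[i]^o) @[eps --> (0 : R)^'+]).

End Defs.

(* Main.v *)
(* Proof. For y > 0 replace 1 / (x - t) by the conjugate Poisson kernel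
   (x - t) / (y ^ 2 + (x - t) ^ 2), which gives the smooth transform Q_y. For the
   indicator of E, let P_y be the Poisson integral, v = P_y - i Q_y and l > 0.
   Moving the contour to infinity, the integral over t of the real part of
   v ^ 2 / (l + v) vanishes; compared with the integral pi |E| of P_y, this gives
   |{|Q_y| > l}| <= C |E| / l, and also C |E| / l ^ 2 for l >= 2 pi since
   P_y <= pi. These two bounds control the L(log L)^b norm of Q_y by
   the integral of log^(1+b)(2e/t) over (0, |E|), and summing over the level sets
   of f (the norm is subadditive because the weight is nonincreasing) gives the
   inequality for Q_y f uniformly in y. Finally Q_y f is an average of the
   truncated transforms at the scales y s, s >= 0, so it converges to the
   principal value wherever the latter exists, and Fatou's lemma for
   rearrangements concludes; elsewhere the transform is 0. *)
Require Import Defs.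
From mathcomp Require Import all_boot all_order all_algebra.
From mathcomp Require Import complex.
From mathcomp Require Import all_classical all_reals all_analysis.
From mathcomp Require Import measurable_realfun ring lra.

Import Order.TTheory GRing.Theory Num.Theory.
Import numFieldNormedType.Exports.
Local Open Scope classical_set_scope.
Local Open Scope ring_scope.
Set Implicit Arguments.
Unset Strict Implicit.
Unset Printing Implicit Defensive.

(** * Poisson integrals *)

(** With z = t + iy, v is -i times the integral of 1 / (x - z) over E. It is holomorphic for y > 0
    and its real part P is nonnegative, so l + v never vanishes. The square matters: v^2 / (l + v)
    decays like 1 / |z|^2 at infinity, one order better than v, and so the far sides of a large box
    contribute nothing in the limit. This single function yields both weak bounds. First, v - v^2 /
    (l + v) = l v / (l + v) has nonnegative real part, at least l / 2 where |Q| > l. Second, once l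
    dominates the bound pi of P, adding 2 pi P / l to - Re (v^2 / (l + v)) makes it nonnegative, and
    at least l / 8 where |Q| > l; the integral of the added term carries the extra factor 1 / l. The
    bound in 1 / l^2 is what tames small t: the rearrangement bound |E| / t is not integrable at 0,
    whereas (|E| / t)^(1/2) is, with room left for powers of the logarithm. The contour shift is
    carried out with real functions, as the y-derivative of an integral over a segment. *)

Section PoissonKernels.
Variable R : realType.
Implicit Types y w t : R.

Definition pker y w := y / (y ^+ 2 + w ^+ 2).
Definition qker y w := w / (y ^+ 2 + w ^+ 2).
(** [qker] and [pker] are the real and imaginary parts of 1 / (w - iy); [pker'] and [qker'] are the
    imaginary part and minus the real part of 1 / (w - iy)^2. Up to sign they give all the partial
    derivatives in w and in y: Cauchy-Riemann at the level of kernels. *)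
Definition pker' y w := 2 * y * w / (y ^+ 2 + w ^+ 2) ^+ 2.
Definition qker' y w := (y ^+ 2 - w ^+ 2) / (y ^+ 2 + w ^+ 2) ^+ 2.

Lemma ker_den_gt0 y w : 0 < y -> 0 < y ^+ 2 + w ^+ 2.
Proof. by move=> y0; rewrite ltr_wpDr ?sqr_ge0 ?exprn_gt0. Qed.

Lemma ker_den_ge y w : 0 < y -> y ^+ 2 <= y ^+ 2 + w ^+ 2.
Proof. by move=> y0; rewrite lerDl sqr_ge0. Qed.

Lemma pker_ge0 y w : 0 < y -> 0 <= pker y w.
Proof. by move=> y0; rewrite divr_ge0 ?ltW ?ker_den_gt0. Qed.

Lemma pker_le y w : 0 < y -> pker y w <= y^-1.
Proof.
move=> y0; rewrite ler_pdivrMr ?ker_den_gt0// mulrC ler_pdivlMr//.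
by rewrite -expr2 ker_den_ge.
Qed.

Lemma qker_le y w : 0 < y -> `|qker y w| <= y^-1.
Proof.
move=> y0; rewrite /qker normrM normfV (ger0_norm (ltW (ker_den_gt0 w y0))).
rewrite ler_pdivrMr ?ker_den_gt0// mulrC ler_pdivlMr//.
have := sqr_ge0 (y - `|w|); have := real_normK (num_real w); nra.
Qed.

(** Unlike [pker_le], this does not degenerate as y tends to 0: it serves the lateral sides of the
    box, at any height. *)
Lemma pker_far y w d : 0 < y -> 0 < d -> d <= `|w| -> pker y w <= d^-1.
Proof.
move=> y0 d0 dw; rewrite ler_pdivrMr ?ker_den_gt0// mulrC ler_pdivlMr//.
have := sqr_ge0 (y - `|w|); have := real_normK (num_real w); nra.
Qed.

Lemma qker_far y w d : 0 < y -> 0 < d -> d <= `|w| -> `|qker y w| <= d^-1.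
Proof.
move=> y0 d0 dw; rewrite /qker normrM normfV.
rewrite (ger0_norm (ltW (ker_den_gt0 w y0))).
rewrite ler_pdivrMr ?ker_den_gt0// mulrC ler_pdivlMr//.
have := sqr_ge0 y; have := real_normK (num_real w); nra.
Qed.

Lemma pker'_le y w : 0 < y -> `|pker' y w| <= (y ^+ 2)^-1.
Proof.
move=> y0; have D0 := ker_den_gt0 w y0.
rewrite /pker' normrM normfV (ger0_norm (sqr_ge0 (_ + _))).
rewrite ler_pdivrMr ?exprn_gt0// [leRHS]mulrC ler_pdivlMr ?exprn_gt0//.
rewrite !normrM (gtr0_norm y0) ger0_norm//.
have yw : 2 * y * `|w| <= y ^+ 2 + w ^+ 2.
  by have := sqr_ge0 (y - `|w|); have := real_normK (num_real w); nra.
rewrite [leRHS]expr2; apply: ler_pM => //; last exact: ker_den_ge.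
  by rewrite !mulr_ge0// ltW.
exact: sqr_ge0.
Qed.

Lemma qker'_le y w : 0 < y -> `|qker' y w| <= (y ^+ 2)^-1.
Proof.
move=> y0; have D0 := ker_den_gt0 w y0.
rewrite /qker' normrM normfV (ger0_norm (sqr_ge0 (_ + _))).
rewrite ler_pdivrMr ?exprn_gt0// [leRHS]mulrC ler_pdivlMr ?exprn_gt0//.
rewrite [leRHS]expr2; apply: ler_pM => //; last exact: ker_den_ge.
  exact: sqr_ge0.
by rewrite ler_norml; have := sqr_ge0 y; have := sqr_ge0 w; lra.
Qed.

Lemma is_derive_quot (f g : R -> R) x df dg : g x != 0 ->
  is_derive x 1 f df -> is_derive x 1 g dg ->
  is_derive x 1 (fun z => f z / g z) ((df * g x - f x * dg) / g x ^+ 2).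
Proof.
move=> gx0 fd gd.
have h := @is_deriveM _ _ f (fun z => (g z)^-1) x 1 _ _ fd (is_deriveV gx0 gd).
apply: (is_derive_eq h); rewrite /GRing.scale /=.
by field.
Qed.

Lemma is_derive_pker_w y w : 0 < y -> is_derive w 1 (pker y) (- pker' y w).
Proof.
move=> y0; have D0 : y ^+ 2 + w ^+ 2 != 0 by rewrite gt_eqF ?ker_den_gt0.
have h : is_derive w 1 (fun w => y ^+ 2 + w ^+ 2) (2 * w).
  by apply: is_derive_eq; rewrite /GRing.scale/=; ring.
apply: (is_derive_eq (@is_derive_quot (cst y) (fun w => y ^+ 2 + w ^+ 2) w _ _ D0 (is_derive_cst y w 1) h)).
by rewrite /pker'/=; field.
Qed.

Lemma is_derive_qker_w y w : 0 < y -> is_derive w 1 (qker y) (qker' y w).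
Proof.
move=> y0; have D0 : y ^+ 2 + w ^+ 2 != 0 by rewrite gt_eqF ?ker_den_gt0.
have h : is_derive w 1 (fun w => y ^+ 2 + w ^+ 2) (2 * w).
  by apply: is_derive_eq; rewrite /GRing.scale/=; ring.
apply: (is_derive_eq (@is_derive_quot id (fun w => y ^+ 2 + w ^+ 2) w _ _ D0 (is_derive_id w 1) h)).
by rewrite /qker'/=; field.
Qed.

Lemma is_derive_pker_y y w : 0 < y ->
  is_derive y 1 (pker ^~ w) (- qker' y w).
Proof.
move=> y0; have D0 : y ^+ 2 + w ^+ 2 != 0 by rewrite gt_eqF ?ker_den_gt0.
have h : is_derive y 1 (fun y => y ^+ 2 + w ^+ 2) (2 * y).
  by apply: is_derive_eq; rewrite /GRing.scale/=; ring.
apply: (is_derive_eq (@is_derive_quot id (fun y => y ^+ 2 + w ^+ 2) y _ _ D0 (is_derive_id y 1) h)).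
by rewrite /qker'/=; field.
Qed.

Lemma is_derive_qker_y y w : 0 < y ->
  is_derive y 1 (qker ^~ w) (- pker' y w).
Proof.
move=> y0; have D0 : y ^+ 2 + w ^+ 2 != 0 by rewrite gt_eqF ?ker_den_gt0.
have h : is_derive y 1 (fun y => y ^+ 2 + w ^+ 2) (2 * y).
  by apply: is_derive_eq; rewrite /GRing.scale/=; ring.
apply: (is_derive_eq (@is_derive_quot (cst w) (fun y => y ^+ 2 + w ^+ 2) y _ _ D0 (is_derive_cst w y 1) h)).
by rewrite /pker'/=; field.
Qed.

Lemma is_derive_reflect (f : R -> R) (x t : R) df :
  is_derive (x - t) 1 f df -> is_derive t 1 (fun s => f (x - s)) (- df).
Proof.
move=> fd; have h : is_derive t 1 (fun s : R => x - s) (-1).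
  by apply: is_derive_eq; rewrite add0r mul1r.
apply: (is_derive_eq (@is_derive1_comp _ f (fun s => x - s) t _ _ fd h)).
by rewrite /GRing.scale/= ; ring.
Qed.

Lemma continuous_pker' y : 0 < y -> continuous (pker' y).
Proof.
move=> y0 w; rewrite /pker'.
apply: cvgM; first by apply: cvgM; [exact: cvg_cst|exact: cvg_id].
apply: cvgV; first by rewrite sqrf_eq0 gt_eqF ?ker_den_gt0.
apply: (continuous_comp (f := fun w => y ^+ 2 + w ^+ 2) (g := fun z => z ^+ 2)).
  by apply: cvgD; [exact: cvg_cst|exact: exprn_continuous].
exact: exprn_continuous.
Qed.

Lemma continuous_qker' y : 0 < y -> continuous (qker' y).
Proof.
move=> y0 w; rewrite /qker'.
apply: cvgM.
  by apply: cvgB; [exact: cvg_cst|exact: exprn_continuous].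
apply: cvgV; first by rewrite sqrf_eq0 gt_eqF ?ker_den_gt0.
apply: (continuous_comp (f := fun w => y ^+ 2 + w ^+ 2) (g := fun z => z ^+ 2)).
  by apply: cvgD; [exact: cvg_cst|exact: exprn_continuous].
exact: exprn_continuous.
Qed.

Lemma continuous_pker y : 0 < y -> continuous (pker y).
Proof.
move=> y0 w; apply/differentiable_continuous/derivable1_diffP.
exact: (@ex_derive _ _ _ _ _ _ _ (is_derive_pker_w w y0)).
Qed.

Lemma continuous_qker y : 0 < y -> continuous (qker y).
Proof.
move=> y0 w; apply/differentiable_continuous/derivable1_diffP.
exact: (@ex_derive _ _ _ _ _ _ _ (is_derive_qker_w w y0)).
Qed.

End PoissonKernels.

(** * Differentiation and continuity under the integral sign *)

Section IntegralBounds.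
Context d (X : measurableType d) (R : realType) (mu : {measure set X -> \bar R}).
Variables (E : set X) (mE : measurable E) (Efin : (mu E < +oo)%E).

Lemma integrable_le_cst (f : X -> R) (M : R) : measurable_fun E f ->
  (forall x, E x -> `|f x| <= M) -> mu.-integrable E (EFin \o f).
Proof.
move=> mf fM; apply: measurable_bounded_integrable => //.
exists M; split; first exact: num_real.
by move=> x Mx y Ey /=; exact: le_trans (fM _ Ey) (ltW Mx).
Qed.

Lemma integrable_cst_on (k : R) : mu.-integrable E (EFin \o cst k).
Proof. by apply: (integrable_le_cst (M := `|k|)) => //; exact: measurable_cst. Qed.

Lemma normr_Rintegral_le_cst (f : X -> R) (M : R) : measurable_fun E f ->
  (forall x, E x -> `|f x| <= M) ->
  `|\int[mu]_(x in E) f x| <= M * fine (mu E).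
Proof.
move=> mf fM; have fi := integrable_le_cst mf fM.
apply: (le_trans (le_normr_Rintegral mE fi)).
rewrite -Rintegral_cst//; apply: le_Rintegral => //.
  exact: integrable_norm.
exact: integrable_cst_on.
Qed.

(** The bounds are local in [s] because the kernels blow up as the height tends to 0. One constant
    dominates both the integrand and its derivative, which suffices on a set of finite measure. *)
Lemma is_derive_under_integral (K K' : R -> X -> R) (M a e : R) : 0 < e ->
  (forall s, `|s - a| < e -> measurable_fun E (K s)) ->
  (forall s x, `|s - a| < e -> E x -> `|K s x| <= M) ->
  (forall s x, `|s - a| < e -> E x -> `|K' s x| <= M) ->
  (forall s x, `|s - a| < e -> E x -> is_derive s 1 (K ^~ x) (K' s x)) ->
  is_derive a 1 (fun s => \int[mu]_(x in E) K s x) (\int[mu]_(x in E) K' a x).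
Proof.
move=> e0 mK KM K'M dK.
have Iae s : `]a - e, a + e[%classic s -> `|s - a| < e.
  by rewrite /= in_itv/= ltr_norml => /andP[? ?]; lra.
have Ia : `]a - e, a + e[%classic a by rewrite /= in_itv/=; lra.
have d1 s x : `|s - a| < e -> E x -> derive1 (K ^~ x) s = K' s x.
  by move=> sa Ex; rewrite derive1E; have [_ ->] := dK s x sa Ex.
have iK s : `]a - e, a + e[%classic s -> mu.-integrable E (EFin \o K s).
  by move=> /Iae sa; apply: integrable_le_cst (mK _ sa) _ => x; exact: KM.
have dK1 s x : `]a - e, a + e[%classic s -> E x -> derivable (K ^~ x) s 1.
  by move=> /Iae sa Ex; have [] := dK s x sa Ex.
have iM : mu.-integrable E (EFin \o cst `|M|) by exact: integrable_cst_on.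
have bd s x : `]a - e, a + e[%classic s -> E x ->
    `|partial1of2 K s x| <= cst `|M| x.
  move=> /Iae sa Ex; rewrite /partial1of2 d1//=.
  by rewrite (le_trans (K'M _ _ sa Ex))// ler_norm.
have -> : \int[mu]_(x in E) K' a x = \int[mu]_(x in E) partial1of2 K a x.
  by apply: eq_Rintegral => x /[!inE] Ex; rewrite /partial1of2 d1// subrr normr0.
have M0 (x : X) : 0 <= cst `|M| x :> R by exact: normr_ge0.
split.
  exact: (derivable_under_integral mE Ia iK dK1 M0 iM bd).
rewrite -derive1E.
exact: (differentiation_under_integral mE Ia iK dK1 M0 iM bd).
Qed.

Lemma continuous_under_integral (K : R -> X -> R) (M : R) :
  (forall s, measurable_fun E (K s)) ->
  (forall s x, E x -> `|K s x| <= M) ->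
  (forall x, continuous (K ^~ x)) ->
  continuous (fun s => \int[mu]_(x in E) K s x).
Proof.
move=> mK KM cK a.
have aI : a \in (`]a - 1, a + 1[%classic : set R).
  by rewrite inE /= in_itv/=; lra.
have M0 (x : X) : 0 <= cst `|M| x :> R by exact: normr_ge0.
apply: (@continuity_under_integral _ _ _ mu K E mE (a - 1) (a + 1) _ _ (cst M)) aI.
- by move=> s _; apply: integrable_le_cst => //; exact: KM.
- by apply: aeW => x _ s _; exact: cK.
- exact: integrable_cst_on.
- by move=> s _; apply: aeW => x Ex; exact: KM.
Qed.

End IntegralBounds.

(** * Poisson and conjugate Poisson integrals of a set of finite measure *)

Section PoissonIntegrals.
Context d (X : measurableType d) (R : realType) (mu : {measure set X -> \bar R}).
Variables (E : set X) (mE : measurable E) (Efin : (mu E < +oo)%E).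
Variables (u : X -> R) (mu_ : measurable_fun E u).

Let m := fine (mu E).

(** E lives in an abstract measure space with a coordinate map [u]. Later this space is the line
    with the completed sigma-algebra and [u] is the identity, whereas [t] runs over the Borel
    line. *)
Definition conv (k : R -> R) (t : R) := \int[mu]_(x in E) k (u x - t).

Lemma measurable_conv_ker (k : R -> R) t : continuous k ->
  measurable_fun E (fun x => k (u x - t)).
Proof.
move=> ck; apply: (measurableT_comp (f := k) (g := fun x => u x - t)).
  exact: continuous_measurable_fun.
by apply: measurable_funB.
Qed.

Lemma conv_le (k : R -> R) (M t : R) : continuous k ->
  (forall x, E x -> `|k (u x - t)| <= M) -> `|conv k t| <= M * m.
Proof.
by move=> ck kM; apply: normr_Rintegral_le_cst => //; exact: measurable_conv_ker.
Qed.

Lemma conv_ge0 (k : R -> R) (t : R) : (forall w, 0 <= k w) -> 0 <= conv k t.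
Proof. by move=> k0; apply: Rintegral_ge0. Qed.

Lemma continuous_conv (k : R -> R) (M : R) : continuous k ->
  (forall w, `|k w| <= M) -> continuous (conv k).
Proof.
move=> ck kM; apply: (@continuous_under_integral _ _ _ _ _ _ _ _ M) => //.
- by move=> s; exact: measurable_conv_ker.
- move=> x t; apply: (continuous_comp (f := fun t => u x - t) (g := k)).
    by apply: cvgB; [exact: cvg_cst|exact: cvg_id].
  exact: ck.
Qed.

Lemma conv_opp (k : R -> R) t : continuous k -> forall M, (forall w, `|k w| <= M) ->
  conv (fun w => - k w) t = - conv k t.
Proof.
move=> ck M kM; rewrite /conv -[RHS]mulN1r -RintegralZl//.
  by apply: eq_Rintegral => x _; rewrite mulN1r.
apply: (@integrable_le_cst _ _ _ _ _ mE Efin _ M) => //.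
exact: measurable_conv_ker.
Qed.

Lemma is_derive_conv_t (k k' : R -> R) (M t : R) : continuous k ->
  (forall w, `|k w| <= M) -> (forall w, `|k' w| <= M) ->
  (forall w : R, is_derive w 1 k (k' w)) -> continuous k' ->
  is_derive t 1 (conv k) (- conv k' t).
Proof.
move=> ck kM k'M dk ck'; rewrite -(conv_opp _ ck' k'M).
apply: (@is_derive_under_integral _ _ _ _ _ mE Efin (fun s x => k (u x - s))
   (fun s x => - k' (u x - s)) M t 1) => //.
- by move=> s _; exact: measurable_conv_ker.
- by move=> s x _ _; rewrite normrN.
- by move=> s x _ _; exact: is_derive_reflect.
Qed.

(** The minus sign in the hypothesis fits both kernels, whose y-derivatives are - [qker'] and -
    [pker']. Staying above y / 2 provides bounds uniform in [z]. *)
Lemma is_derive_conv_y (k k' : R -> R -> R) (M y t : R) : 0 < y ->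
  (forall z, y / 2 < z -> continuous (k z)) ->
  (forall z w, y / 2 < z -> `|k z w| <= M) ->
  (forall z w, y / 2 < z -> `|k' z w| <= M) ->
  (forall z w : R, y / 2 < z -> is_derive z 1 (k ^~ w) (- k' z w)) ->
  continuous (k' y) ->
  is_derive y 1 (fun z => conv (k z) t) (- conv (k' y) t).
Proof.
move=> y0 ck kM k'M dk ck'.
have zy z : `|z - y| < y / 2 -> y / 2 < z by rewrite ltr_norml; lra.
have yy : y / 2 < y by lra.
rewrite -(conv_opp _ ck' (k'M y ^~ yy)).
apply: (@is_derive_under_integral _ _ _ _ _ mE Efin (fun s x => k s (u x - t))
   (fun s x => - k' s (u x - t)) M y (y / 2)) => //.
- by rewrite divr_gt0.
- by move=> s /zy ?; apply: measurable_conv_ker; exact: ck.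
- by move=> s x /zy ? _; exact: kM.
- by move=> s x /zy ? _; rewrite normrN; exact: k'M.
- by move=> s x /zy ? _; exact: dk.
Qed.

Definition poisson y := conv (pker y).
Definition conjp y := conv (qker y).
Definition poisson' y := conv (pker' y).
Definition conjp' y := conv (qker' y).

Lemma is_derive_poisson_t (y t : R) : 0 < y ->
  is_derive t 1 (poisson y) (poisson' y t).
Proof.
move=> y0; pose M := y^-1 + (y ^+ 2)^-1.
have yi : 0 <= y^-1 by rewrite invr_ge0 ltW.
have y2i : 0 <= (y ^+ 2)^-1 by rewrite invr_ge0 sqr_ge0.
have kM w : `|pker y w| <= M.
  by rewrite ger0_norm ?pker_ge0// (le_trans (pker_le w y0))// lerDl.
have k'M w : `|- pker' y w| <= M.
  by rewrite normrN (le_trans (pker'_le w y0))// lerDr.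
have c' : continuous (fun w => - pker' y w).
  by move=> w; apply: cvgN; exact: continuous_pker'.
have k'M2 w : `|pker' y w| <= M by rewrite (le_trans (pker'_le w y0))// lerDr.
apply: is_derive_eq.
  apply: (is_derive_conv_t t _ kM k'M _ c').
    exact: continuous_pker.
  by move=> w; exact: is_derive_pker_w.
by rewrite (conv_opp _ (continuous_pker' y0) k'M2) opprK.
Qed.

Lemma is_derive_conjp_t (y t : R) : 0 < y ->
  is_derive t 1 (conjp y) (- conjp' y t).
Proof.
move=> y0; pose M := y^-1 + (y ^+ 2)^-1.
have yi : 0 <= y^-1 by rewrite invr_ge0 ltW.
have y2i : 0 <= (y ^+ 2)^-1 by rewrite invr_ge0 sqr_ge0.
have kM w : `|qker y w| <= M.
  by rewrite (le_trans (qker_le w y0))// lerDl.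
have k'M w : `|qker' y w| <= M by rewrite (le_trans (qker'_le w y0))// lerDr.
apply: (is_derive_conv_t t _ kM k'M _ (continuous_qker' y0)).
  exact: continuous_qker.
by move=> w; exact: is_derive_qker_w.
Qed.

Lemma ker_y_bounds (y z w : R) : 0 < y -> y / 2 < z ->
  [/\ 0 < z, `|pker z w| <= (y / 2)^-1 + ((y / 2) ^+ 2)^-1,
      `|qker z w| <= (y / 2)^-1 + ((y / 2) ^+ 2)^-1,
      `|pker' z w| <= (y / 2)^-1 + ((y / 2) ^+ 2)^-1 &
      `|qker' z w| <= (y / 2)^-1 + ((y / 2) ^+ 2)^-1].
Proof.
move=> y0 yz; have y20 : 0 < y / 2 by lra.
have z0 : 0 < z by lra.
have h1 : z^-1 <= (y / 2)^-1 by rewrite lef_pV2 ?posrE// ltW.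
have h2 : (z ^+ 2)^-1 <= ((y / 2) ^+ 2)^-1.
  by rewrite lef_pV2 ?posrE ?exprn_gt0// ler_sqr ?nnegrE ltW.
have h3 : 0 <= (y / 2)^-1 by rewrite invr_ge0 ltW.
have h4 : 0 <= ((y / 2) ^+ 2)^-1 by rewrite invr_ge0 sqr_ge0.
split => //.
- by rewrite ger0_norm ?pker_ge0//; have := pker_le w z0; lra.
- by have := qker_le w z0; lra.
- by have := pker'_le w z0; lra.
- by have := qker'_le w z0; lra.
Qed.

Lemma is_derive_poisson_y (y t : R) : 0 < y ->
  is_derive y 1 (poisson ^~ t) (- conjp' y t).
Proof.
move=> y0.
apply: (@is_derive_conv_y _ _ ((y / 2)^-1 + ((y / 2) ^+ 2)^-1) y t y0).
- by move=> z /(ker_y_bounds 0 y0)[z0 _ _ _ _]; exact: continuous_pker.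
- by move=> z w /(ker_y_bounds w y0)[].
- by move=> z w /(ker_y_bounds w y0)[].
- by move=> z w /(ker_y_bounds w y0)[z0 _ _ _ _]; exact: is_derive_pker_y.
- exact: continuous_qker'.
Qed.

Lemma is_derive_conjp_y (y t : R) : 0 < y ->
  is_derive y 1 (conjp ^~ t) (- poisson' y t).
Proof.
move=> y0.
apply: (@is_derive_conv_y _ _ ((y / 2)^-1 + ((y / 2) ^+ 2)^-1) y t y0).
- by move=> z /(ker_y_bounds 0 y0)[z0 _ _ _ _]; exact: continuous_qker.
- by move=> z w /(ker_y_bounds w y0)[].
- by move=> z w /(ker_y_bounds w y0)[].
- by move=> z w /(ker_y_bounds w y0)[z0 _ _ _ _]; exact: is_derive_qker_y.
- exact: continuous_pker'.
Qed.

Lemma continuous_poisson y : 0 < y -> continuous (poisson y).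
Proof.
move=> y0 t; apply/differentiable_continuous/derivable1_diffP.
exact: (@ex_derive _ _ _ _ _ _ _ (is_derive_poisson_t t y0)).
Qed.

Lemma continuous_conjp y : 0 < y -> continuous (conjp y).
Proof.
move=> y0 t; apply/differentiable_continuous/derivable1_diffP.
exact: (@ex_derive _ _ _ _ _ _ _ (is_derive_conjp_t t y0)).
Qed.

Lemma continuous_poisson' y : 0 < y -> continuous (poisson' y).
Proof.
move=> y0; apply: (continuous_conv (M := (y ^+ 2)^-1)) => [|w].
  exact: continuous_pker'.
exact: pker'_le.
Qed.

Lemma continuous_conjp' y : 0 < y -> continuous (conjp' y).
Proof.
move=> y0; apply: (continuous_conv (M := (y ^+ 2)^-1)) => [|w].
  exact: continuous_qker'.
exact: qker'_le.
Qed.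

Lemma poisson_ge0 y t : 0 < y -> 0 <= poisson y t.
Proof. by move=> y0; apply: conv_ge0 => w; exact: pker_ge0. Qed.

Lemma poisson'_le y t : 0 < y -> `|poisson' y t| <= (y ^+ 2)^-1 * m.
Proof.
move=> y0; apply: conv_le => [|x _]; first exact: continuous_pker'.
exact: pker'_le.
Qed.

Lemma conjp'_le y t : 0 < y -> `|conjp' y t| <= (y ^+ 2)^-1 * m.
Proof.
move=> y0; apply: conv_le => [|x _]; first exact: continuous_qker'.
exact: qker'_le.
Qed.

Lemma poisson_le_y y t : 0 < y -> poisson y t <= y^-1 * m.
Proof.
move=> y0; apply: (le_trans (ler_norm _)).
apply: conv_le => [|x _]; first exact: continuous_pker.
by rewrite ger0_norm ?pker_ge0// pker_le.
Qed.

Lemma conjp_le_y y t : 0 < y -> `|conjp y t| <= y^-1 * m.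
Proof.
move=> y0; apply: conv_le => [|x _]; first exact: continuous_qker.
exact: qker_le.
Qed.

Lemma poisson_far y t e : 0 < y -> 0 < e -> (forall x, E x -> e <= `|u x - t|) ->
  poisson y t <= e^-1 * m.
Proof.
move=> y0 e0 far; apply: (le_trans (ler_norm _)).
apply: conv_le => [|x Ex]; first exact: continuous_pker.
by rewrite ger0_norm ?pker_ge0// (pker_far y0 e0)// far.
Qed.

Lemma conjp_far y t e : 0 < y -> 0 < e -> (forall x, E x -> e <= `|u x - t|) ->
  `|conjp y t| <= e^-1 * m.
Proof.
move=> y0 e0 far.
apply: conv_le => [|x Ex]; first exact: continuous_qker.
by rewrite (qker_far y0 e0)// far.
Qed.

End PoissonIntegrals.

(** * The contour argument *)

Section HolomorphicPart.
Variable R : realType.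
Implicit Types l P Q a b : R.

(* Real part and opposite of the imaginary part of v^2 / (l + v) at
   v = P - iQ, rewritten through v^2 / (l + v) = v - l + l^2 / (l + v). *)
Definition hol_re l P Q := P - l + l ^+ 2 * (l + P) / ((l + P) ^+ 2 + Q ^+ 2).
Definition hol_im l P Q := Q - l ^+ 2 * Q / ((l + P) ^+ 2 + Q ^+ 2).

(** With P_t = a = - Q_y and P_y = - b = Q_t, this is at once the y-derivative of [hol_re] and the
    t-derivative of [hol_im]. *)
Definition hol_d l P Q a b :=
  - b + l ^+ 2 * (b * ((l + P) ^+ 2 + Q ^+ 2) + 2 * Q * ((l + P) * a - Q * b)) /
    ((l + P) ^+ 2 + Q ^+ 2) ^+ 2.

Lemma hol_den l P Q : 0 < l -> 0 <= P -> l ^+ 2 <= (l + P) ^+ 2 + Q ^+ 2.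
Proof. by move=> l0 P0; have := sqr_ge0 Q; nra. Qed.

Lemma hol_den_gt0 l P Q : 0 < l -> 0 <= P -> 0 < (l + P) ^+ 2 + Q ^+ 2.
Proof.
by move=> l0 P0; rewrite (lt_le_trans _ (hol_den Q l0 P0))// exprn_gt0.
Qed.

(** |v|^2 <= 2 B^2, and |l + v| >= l because P >= 0. The bound has to be quadratic in [B]: on the
    far sides of a box of size A, [B] is of order 1 / A while the length is of order A. *)
Lemma hol_re_le l P Q B : 0 < l -> 0 <= P -> P <= B -> `|Q| <= B ->
  `|hol_re l P Q| <= 4 * B ^+ 2 / l.
Proof.
move=> l0 P0 PB QB; have D0 := hol_den_gt0 Q l0 P0.
have Ql : Q ^+ 2 <= B ^+ 2 by rewrite -real_normK ?num_real// ler_sqr ?nnegrE//; lra.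
have Pl : P ^+ 2 <= B ^+ 2 by rewrite ler_sqr ?nnegrE//; lra.
(* This is Re (v^2 (l + conj v)) / |l + v|^2. *)
have -> : hol_re l P Q = (2 * l * P ^+ 2 - (l - P) * (P ^+ 2 + Q ^+ 2)) /
    ((l + P) ^+ 2 + Q ^+ 2).
  by rewrite /hol_re; field; rewrite gt_eqF.
rewrite normrM normfV (gtr0_norm D0) ler_pdivrMr// [leRHS]mulrAC ler_pdivlMr//.
rewrite -[X in _ * X <= _](gtr0_norm l0) -normrM.
have QQ := sqr_ge0 Q; have PP := sqr_ge0 P.
have B0 : 0 <= B ^+ 2 by exact: sqr_ge0.
have lP : 0 <= l * P by rewrite mulr_ge0// ltW.
have ll : 0 <= l ^+ 2 by exact: sqr_ge0.
have h1 : 0 <= l ^+ 2 * (B ^+ 2 - P ^+ 2) by rewrite mulr_ge0// subr_ge0.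
have h2 : 0 <= l ^+ 2 * (B ^+ 2 - Q ^+ 2) by rewrite mulr_ge0// subr_ge0.
have h3 : 0 <= l * P * (B ^+ 2 - P ^+ 2) by rewrite mulr_ge0// subr_ge0.
have h4 : 0 <= l * P * (B ^+ 2 - Q ^+ 2) by rewrite mulr_ge0// subr_ge0.
have h5 : 0 <= l * P * P ^+ 2 by rewrite mulr_ge0.
have h6 : 0 <= l * P * Q ^+ 2 by rewrite mulr_ge0.
have h7 : 0 <= l * P * B ^+ 2 by rewrite mulr_ge0.
have h8 : 0 <= l ^+ 2 * P ^+ 2 by rewrite mulr_ge0.
have h9 : 0 <= l ^+ 2 * Q ^+ 2 by rewrite mulr_ge0.
have h10 : 0 <= P ^+ 2 * B ^+ 2 by rewrite mulr_ge0.
have h11 : 0 <= Q ^+ 2 * B ^+ 2 by rewrite mulr_ge0.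
by rewrite ler_norml; apply/andP; split; lra.
Qed.

Lemma hol_im_le l P Q B : 0 < l -> 0 <= P -> P <= B -> `|Q| <= B ->
  `|hol_im l P Q| <= 4 * B ^+ 2 / l.
Proof.
move=> l0 P0 PB QB; have D0 := hol_den_gt0 Q l0 P0.
have -> : hol_im l P Q = Q * (2 * l * P + P ^+ 2 + Q ^+ 2) /
    ((l + P) ^+ 2 + Q ^+ 2).
  by rewrite /hol_im; field; rewrite gt_eqF.
rewrite normrM normfV (gtr0_norm D0) normrM.
have B0 : 0 <= B by lra.
have lP : 0 <= l * P by rewrite mulr_ge0// ltW.
rewrite (ger0_norm (_ : 0 <= 2 * l * P + P ^+ 2 + Q ^+ 2)); last first.
  by have := sqr_ge0 P; have := sqr_ge0 Q; lra.
rewrite ler_pdivrMr// [leRHS]mulrAC ler_pdivlMr// -(real_normK (num_real Q)).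
set q := `|Q| in QB *; have q0 : 0 <= q by exact: normr_ge0.
have BB : q * P <= B ^+ 2 by rewrite expr2 ler_pM.
have BQ : q * q <= B ^+ 2 by rewrite expr2 ler_pM.
have BP : P * P <= B ^+ 2 by rewrite expr2 ler_pM.
have l2 : 0 <= l ^+ 2 by exact: sqr_ge0.
have h1 : 0 <= l ^+ 2 * (B ^+ 2 - q * P) by rewrite mulr_ge0// subr_ge0.
have h2 : 0 <= (l * P) * (B ^+ 2 - q * P) by rewrite mulr_ge0// subr_ge0.
have h3 : 0 <= B ^+ 2 * P ^+ 2 by rewrite mulr_ge0// sqr_ge0.
have h4 : 0 <= B ^+ 2 * (q - l) ^+ 2 by rewrite mulr_ge0// sqr_ge0.
have lq : 0 <= l * q by rewrite mulr_ge0// ltW.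
have h5 : 0 <= (l * q) * (B ^+ 2 - q * q) by rewrite mulr_ge0// subr_ge0.
have h6 : 0 <= (l * P) * B ^+ 2 by rewrite mulr_ge0// sqr_ge0.
have h7 : 0 <= l ^+ 2 * B ^+ 2 by rewrite mulr_ge0// sqr_ge0.
have h8 : 0 <= q ^+ 2 * B ^+ 2 by rewrite mulr_ge0// sqr_ge0.
by lra.
Qed.

(** The derivative of v^2 / (l + v) is v' (1 - l^2 / (l + v)^2) and |l / (l + v)| <= 1, so it is
    controlled by v' alone. *)
Lemma hol_d_le l P Q a b M : 0 < l -> 0 <= P -> `|a| <= M -> `|b| <= M ->
  `|hol_d l P Q a b| <= 5 * M.
Proof.
move=> l0 P0 aM bM; have D0 := hol_den_gt0 Q l0 P0; have lD := hol_den Q l0 P0.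
rewrite /hol_d; set D := (l + P) ^+ 2 + Q ^+ 2 in D0 lD *.
have M0 : 0 <= M by rewrite (le_trans _ aM).
suff : `|l ^+ 2 * (b * D + 2 * Q * ((l + P) * a - Q * b)) / D ^+ 2| <= 4 * M.
  move=> h; rewrite (le_trans (ler_normD _ _))// normrN.
  have -> : 5 * M = M + 4 * M by ring.
  by rewrite lerD.
rewrite normrM normfV (ger0_norm (sqr_ge0 D)) ler_pdivrMr ?exprn_gt0//.
rewrite normrM (ger0_norm (sqr_ge0 l)).
have -> : 4 * M * D ^+ 2 = D * (4 * M * D) by ring.
apply: ler_pM => //; first exact: sqr_ge0.
have QlP : `|Q * (l + P)| <= D / 2.
  rewrite ler_norml /D; have := sqr_ge0 (Q - (l + P)).
  by have := sqr_ge0 (Q + (l + P)); have := sqr_ge0 Q;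
    have := sqr_ge0 (l + P); lra.
have QQ : `|Q ^+ 2| <= D.
  by rewrite ger0_norm ?sqr_ge0// /D lerDr sqr_ge0.
have -> : b * D + 2 * Q * ((l + P) * a - Q * b) =
  b * D + 2 * (Q * (l + P) * a - Q ^+ 2 * b) by ring.
rewrite (le_trans (ler_normD _ _))//.
have -> : 4 * M * D = M * D + 3 * (D * M) by ring.
rewrite lerD//.
  by rewrite normrM (gtr0_norm D0) ler_pM// ltW.
rewrite normrM ger0_norm//.
have -> : 3 * (D * M) = 2 * (D / 2 * M + D * M) by field.
rewrite ler_pM2l// (le_trans (ler_normB _ _))// !normrM.
by rewrite lerD// ler_pM// -normrM.
Qed.


End HolomorphicPart.

Section HolDerive.
Variable R : realType.
Implicit Types l a b : R.

Lemma is_derive_hol_den (P Q : R -> R) (x l p q : R) :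
  is_derive x 1 P p -> is_derive x 1 Q q ->
  is_derive x 1 (fun z => (l + P z) ^+ 2 + Q z ^+ 2)
    (2 * (l + P x) * p + 2 * Q x * q).
Proof.
move=> dP dQ.
have dlP : is_derive x 1 (fun z => l + P z) p.
  by apply: (is_derive_eq (@is_deriveD _ _ _ (cst l) P x 1 _ _ _ _)); rewrite add0r.
have -> : (fun z => (l + P z) ^+ 2 + Q z ^+ 2) =
    (fun z => (l + P z) * (l + P z) + Q z * Q z).
  by apply/funext => z; rewrite !expr2.
have d2 := @is_deriveM _ _ (fun z => l + P z) (fun z => l + P z) x 1 _ _ dlP dlP.
have e2 := @is_deriveM _ _ Q Q x 1 _ _ dQ dQ.
apply: (is_derive_eq (is_deriveD d2 e2)).
by rewrite /GRing.scale/=; ring.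
Qed.

Lemma is_derive_hol_re (P Q : R -> R) (y l a b : R) : 0 < l -> 0 <= P y ->
  is_derive y 1 P (- b) -> is_derive y 1 Q (- a) ->
  is_derive y 1 (fun z => hol_re l (P z) (Q z)) (hol_d l (P y) (Q y) a b).
Proof.
move=> l0 P0 dP dQ; have D0 := hol_den_gt0 (Q y) l0 P0.
have dD := is_derive_hol_den l dP dQ.
have dN : is_derive y 1 (fun z => l ^+ 2 * (l + P z)) (- (l ^+ 2 * b)).
  have dlP : is_derive y 1 (fun z => l + P z) (- b).
    by apply: (is_derive_eq (@is_deriveD _ _ _ (cst l) P y 1 _ _ _ _)); rewrite add0r.
  apply: (is_derive_eq (@is_deriveZ _ _ _ (fun z => l + P z) (l ^+ 2) y 1 _ dlP)).
  by rewrite /GRing.scale/=; ring.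
have dquot := @is_derive_quot _ (fun z => l ^+ 2 * (l + P z))
  (fun z => (l + P z) ^+ 2 + Q z ^+ 2) y _ _ (lt0r_neq0 D0) dN dD.
have dPl : is_derive y 1 (fun z => P z - l) (- b).
  by apply: (is_derive_eq (@is_deriveB _ _ _ P (cst l) y 1 _ _ _ _)); rewrite subr0.
apply: (is_derive_eq (@is_deriveD _ _ _ (fun z => P z - l) _ y 1 _ _ dPl dquot)).
by rewrite /hol_d; field; rewrite gt_eqF.
Qed.

Lemma is_derive_hol_im (P Q : R -> R) (t l a b : R) : 0 < l -> 0 <= P t ->
  is_derive t 1 P a -> is_derive t 1 Q (- b) ->
  is_derive t 1 (fun z => hol_im l (P z) (Q z)) (hol_d l (P t) (Q t) a b).
Proof.
move=> l0 P0 dP dQ; have D0 := hol_den_gt0 (Q t) l0 P0.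
have dD := is_derive_hol_den l dP dQ.
have dN : is_derive t 1 (fun z => l ^+ 2 * Q z) (- (l ^+ 2 * b)).
  apply: (is_derive_eq (@is_deriveZ _ _ _ Q (l ^+ 2) t 1 _ dQ)).
  by rewrite /GRing.scale/=; ring.
have dquot := @is_derive_quot _ (fun z => l ^+ 2 * Q z)
  (fun z => (l + P z) ^+ 2 + Q z ^+ 2) t _ _ (lt0r_neq0 D0) dN dD.
apply: (is_derive_eq (@is_deriveB _ _ _ Q _ t 1 _ _ dQ dquot)).
by rewrite /hol_d; field; rewrite gt_eqF.
Qed.

End HolDerive.

Section BoxArgument.
Context d (X : measurableType d) (R : realType) (mu : {measure set X -> \bar R}).
Variables (E : set X) (mE : measurable E) (Efin : (mu E < +oo)%E).
Variables (u : X -> R) (mu_ : measurable_fun E u).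
Hypothesis u1 : forall x, E x -> `|u x| <= 1.
Variables (l : R) (l0 : 0 < l).

Let m := fine (mu E).
Let P := poisson mu E u.
Let Q := conjp mu E u.
Let a := poisson' mu E u.
Let b := conjp' mu E u.
Local Notation leb := (@lebesgue_measure R).

Let G y t := hol_re l (P y t) (Q y t).
Let H y t := hol_im l (P y t) (Q y t).
Let G' y t := hol_d l (P y t) (Q y t) (a y t) (b y t).

(* Cauchy-Riemann: the y-derivative of the real part is the t-derivative of
   the (opposite) imaginary part. *)
Lemma poisson_hol_re_y (y t : R) : 0 < y -> is_derive y 1 (G ^~ t) (G' y t).
Proof.
move=> y0; apply: is_derive_hol_re => //; first exact: poisson_ge0.
- exact: is_derive_poisson_y.
- exact: is_derive_conjp_y.
Qed.

Lemma poisson_hol_im_t (y t : R) : 0 < y -> is_derive t 1 (H y) (G' y t).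
Proof.
move=> y0; apply: is_derive_hol_im => //; first exact: poisson_ge0.
- exact: is_derive_poisson_t.
- exact: is_derive_conjp_t.
Qed.

Lemma continuous_hol_den y : 0 < y ->
  continuous (fun t => (l + P y t) ^+ 2 + Q y t ^+ 2).
Proof.
move=> y0 t; have cP := @continuous_poisson _ _ _ mu _ mE Efin _ mu_ y y0.
have cQ := @continuous_conjp _ _ _ mu _ mE Efin _ mu_ y y0.
apply: cvgD.
  apply: (continuous_comp (f := fun t => l + P y t) (g := fun z => z ^+ 2)).
    by apply: cvgD; [exact: cvg_cst|exact: cP].
  exact: exprn_continuous.
apply: (continuous_comp (f := fun t => Q y t) (g := fun z => z ^+ 2)).
  exact: cQ.
exact: exprn_continuous.
Qed.

Lemma hol_den_neq0 y t : 0 < y -> (l + P y t) ^+ 2 + Q y t ^+ 2 != 0.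
Proof. by move=> y0; rewrite gt_eqF// hol_den_gt0// poisson_ge0. Qed.

Lemma continuous_poisson_hol_re y : 0 < y -> continuous (G y).
Proof.
move=> y0 t; have cP := @continuous_poisson _ _ _ mu _ mE Efin _ mu_ y y0.
rewrite /G /hol_re; apply: cvgD.
  by apply: cvgB; [exact: cP|exact: cvg_cst].
apply: cvgM.
  apply: cvgM; first exact: cvg_cst.
  by apply: cvgD; [exact: cvg_cst|exact: cP].
apply: cvgV; first exact: hol_den_neq0.
exact: continuous_hol_den.
Qed.

Lemma continuous_poisson_hol_im y : 0 < y -> continuous (H y).
Proof.
move=> y0 t; apply/differentiable_continuous/derivable1_diffP.
exact: (@ex_derive _ _ _ _ _ _ _ (poisson_hol_im_t t y0)).
Qed.

Lemma continuous_poisson_hol_d y : 0 < y -> continuous (G' y).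
Proof.
move=> y0 t; have cP := @continuous_poisson _ _ _ mu _ mE Efin _ mu_ y y0.
have cQ := @continuous_conjp _ _ _ mu _ mE Efin _ mu_ y y0.
have ca := @continuous_poisson' _ _ _ mu _ mE Efin _ mu_ y y0.
have cb := @continuous_conjp' _ _ _ mu _ mE Efin _ mu_ y y0.
have cD := continuous_hol_den y0.
rewrite /G' /hol_d; apply: cvgD; first by apply: cvgN; exact: cb.
apply: cvgM.
  apply: cvgM; first exact: cvg_cst.
  apply: cvgD; first by apply: cvgM; [exact: cb|exact: cD].
  apply: cvgM; first by apply: cvgM; [exact: cvg_cst|exact: cQ].
  apply: cvgB; last by apply: cvgM; [exact: cQ|exact: cb].
  by apply: cvgM; [apply: cvgD; [exact: cvg_cst|exact: cP]|exact: ca].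
apply: cvgV; first by rewrite expf_neq0// hol_den_neq0.
apply: (continuous_comp (f := fun t => (l + P y t) ^+ 2 + Q y t ^+ 2)
  (g := fun z => z ^+ 2)); [exact: cD|exact: exprn_continuous].
Qed.

Lemma poisson_hol_d_le y t : 0 < y -> `|G' y t| <= 5 * ((y ^+ 2)^-1 * m).
Proof.
move=> y0; apply: hol_d_le => //; first exact: poisson_ge0.
- exact: poisson'_le.
- exact: conjp'_le.
Qed.

(** The values of [u] lie in [-1, 1], so a point with |t| >= A is at distance at least A - 1 from
    them; at heights y >= A the kernels are at most 1 / A. One bound thus covers the top and the
    lateral sides of the box. *)
Lemma poisson_boundary_le (A y t : R) : 1 < A -> 0 < y -> A <= y \/ A <= `|t| ->
  [/\ 0 <= P y t, P y t <= m / (A - 1) & `|Q y t| <= m / (A - 1)].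
Proof.
move=> A1 y0; have m0 : 0 <= m by exact: fine_ge0.
have A10 : 0 < A - 1 by lra.
move=> Ayt; split; first exact: poisson_ge0.
  case: Ayt => [Ay|At].
    apply: (le_trans (@poisson_le_y _ _ _ mu _ mE Efin _ mu_ y t y0)).
    by rewrite mulrC ler_wpM2l// lef_pV2 ?posrE//; lra.
  rewrite mulrC; apply: poisson_far => // x Ex.
  have := ler_normB (u x) (u x - t).
  by have -> : u x - (u x - t) = t; [ring|have := u1 Ex; lra].
case: Ayt => [Ay|At].
  apply: (le_trans (@conjp_le_y _ _ _ mu _ mE Efin _ mu_ y t y0)).
  by rewrite mulrC ler_wpM2l// lef_pV2 ?posrE//; lra.
rewrite mulrC; apply: conjp_far => // x Ex.
have := ler_normB (u x) (u x - t).
by have -> : u x - (u x - t) = t; [ring|have := u1 Ex; lra].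
Qed.

Lemma hol_boundary_le (A y t : R) : 1 < A -> 0 < y -> A <= y \/ A <= `|t| ->
  `|G y t| <= 4 * (m / (A - 1)) ^+ 2 / l /\
  `|H y t| <= 4 * (m / (A - 1)) ^+ 2 / l.
Proof.
move=> A1 y0 /(poisson_boundary_le A1 y0)[h1 h2 h3].
by split; [exact: hol_re_le|exact: hol_im_le].
Qed.

Let J (A y : R) := \int[leb]_(t in `[- A, A]) G y t.

Lemma segment_lty (A : R) : (leb `[(- A)%R, A]%classic < +oo)%E.
Proof. by rewrite lebesgue_measure_itv/=; case: ifP => // _; rewrite ltry. Qed.

(** Differentiating under the integral and replacing the y-derivative by the t-derivative of the
    conjugate part leaves an exact integral: only the two lateral values survive. *)
Lemma is_derive_integral_hol_re (A y : R) : 0 < A -> 0 < y ->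
  is_derive y 1 (J A) (H y A - H y (- A)).
Proof.
move=> A0 y0.
have -> : H y A - H y (- A) = \int[leb]_(t in `[- A, A]) G' y t.
  rewrite /Rintegral (@continuous_FTC2 _ (G' y) (H y)) ?fineB//; first lra.
  - by apply: continuous_subspaceT; exact: continuous_poisson_hol_d.
  - split.
    + by move=> t _; exact: (@ex_derive _ _ _ _ _ _ _ (poisson_hol_im_t t y0)).
    + by apply: cvg_at_right_filter; exact: continuous_poisson_hol_im.
    + by apply: cvg_at_left_filter; exact: continuous_poisson_hol_im.
  - by move=> t _; rewrite derive1E; have [_ ->] := poisson_hol_im_t t y0.
have mA : measurable (`[- A, A]%classic : set R) by exact: measurable_itv.
have near_y s : `|s - y| < y / 2 -> y / 2 < s by rewrite ltr_norml; lra.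
have y2 : 0 < y / 2 by lra.
have m0 : 0 <= m by exact: fine_ge0.
(* For s > y / 2, [B] bounds P and |Q|; [M] is made to dominate both [G] and [G']. *)
pose B := (y / 2)^-1 * m.
have B0 : 0 <= B by rewrite mulr_ge0// invr_ge0 ltW.
pose M := (3 * B ^+ 2 + B ^+ 2) / l + 4 * B ^+ 2 / l + 5 * (((y / 2) ^+ 2)^-1 * m).
apply: (@is_derive_under_integral _ _ _ leb _ mA (segment_lty A) G G' M y (y / 2)) => //.
- move=> s /near_y ys; apply: measurable_funTS.
  by apply: continuous_measurable_fun; apply: continuous_poisson_hol_re; lra.
- move=> s t /near_y ys _; have s0 : 0 < s by lra.
  have sB : s^-1 * m <= B by rewrite ler_wpM2r// lef_pV2 ?posrE// ltW.
  have : `|G s t| <= 4 * B ^+ 2 / l.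
    apply: hol_re_le => //; first exact: poisson_ge0.
      exact: le_trans (@poisson_le_y _ _ _ mu _ mE Efin _ mu_ s t s0) _.
    exact: le_trans (@conjp_le_y _ _ _ mu _ mE Efin _ mu_ s t s0) _.
  have : 0 <= (3 * B ^+ 2 + B ^+ 2) / l.
    by rewrite divr_ge0 ?(ltW l0)//; have := sqr_ge0 B; lra.
  have : 0 <= 5 * (((y / 2) ^+ 2)^-1 * m) by rewrite !mulr_ge0// invr_ge0 sqr_ge0.
  by rewrite /M; lra.
- move=> s t /near_y ys _; have s0 : 0 < s by lra.
  have : (s ^+ 2)^-1 * m <= ((y / 2) ^+ 2)^-1 * m.
    by rewrite ler_wpM2r// lef_pV2 ?posrE ?exprn_gt0// ler_sqr ?nnegrE ltW.
  have := @poisson_hol_d_le s t s0.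
  have : 0 <= (3 * B ^+ 2 + B ^+ 2) / l + 4 * B ^+ 2 / l.
    by rewrite addr_ge0// divr_ge0 ?(ltW l0)//; have := sqr_ge0 B; lra.
  by rewrite /M; lra.
- by move=> s t /near_y ys _; apply: poisson_hol_re_y; lra.
Qed.

(** At height A the integral is at most 2 A times the boundary bound B, and between the heights e
    and A it changes by at most 2 B A. As B is of order 1 / A^2, the total 4 B A is of order 1 / A;
    the factor 64 comes from A - 1 >= A / 2. *)
Lemma integral_hol_small (A e : R) : 2 <= A -> 0 < e -> e < A ->
  `|\int[leb]_(t in `[- A, A]) hol_re l (P e t) (Q e t)| <= 64 * m ^+ 2 / (l * A).
Proof.
move=> A2 e0 eA; have A0 : 0 < A by lra.
rewrite -/(J A e).
have A1 : 1 < A by lra.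
pose B := 4 * (m / (A - 1)) ^+ 2 / l.
have B0 : 0 <= B by rewrite divr_ge0 ?(ltW l0)// mulr_ge0// sqr_ge0.
have JA : `|J A A| <= B * (2 * A).
  have -> : 2 * A = fine (leb `[(- A)%R, A]%classic).
    rewrite lebesgue_measure_itv/= lte_fin ifT; last lra.
    by rewrite -EFinD/=; ring.
  apply: (@normr_Rintegral_le_cst _ _ _ leb _ _ (segment_lty A)) => //.
  - apply: measurable_funTS.
    by apply: continuous_measurable_fun; exact: continuous_poisson_hol_re.
  - by move=> t _; have [] := @hol_boundary_le A A t A1 A0 (or_introl (lexx _)).
have : `|J A A - J A e| <= (B + B) * A.
  (* The mean value theorem in y stands in for integrating the lateral terms over the heights. *)
  have [||c ceA ->] := @MVT R (J A) (fun y => H y A - H y (- A)) e A eA.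
  - move=> y; rewrite in_itv/= => /andP[ey _].
    by apply: is_derive_integral_hol_re => //; lra.
  - apply: derivable_within_continuous => y; rewrite in_itv/= => /andP[ey _].
    by apply: (@ex_derive _ _ _ _ _ _ _ (is_derive_integral_hol_re A0 _)); lra.
  move: ceA; rewrite in_itv/= => /andP[ec cA].
  have c0 : 0 < c by lra.
  rewrite normrM ler_pM//.
    rewrite (le_trans (ler_normB _ _))// lerD//.
      by have [] := @hol_boundary_le A c A A1 c0 (or_intror (ler_norm _)).
    have [] // := @hol_boundary_le A c (- A) A1 c0; right.
    by rewrite normrN ler_norm.
  by rewrite gtr0_norm; lra.
move=> JAe.
have : `|J A e| <= 4 * (B * A).
  rewrite -[J A e](subKr (J A A)).
  by rewrite (le_trans (ler_normB _ _))//; lra.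
move=> /le_trans; apply; rewrite /B.
have m2 : 0 <= m ^+ 2 by exact: sqr_ge0.
have A10 : A - 1 != 0 by rewrite gt_eqF//; lra.
have -> : 4 * (4 * (m / (A - 1)) ^+ 2 / l * A) =
  16 * m ^+ 2 / l * (A / (A - 1) ^+ 2).
  by field; rewrite A10/= gt_eqF.
have -> : 64 * m ^+ 2 / (l * A) = 16 * m ^+ 2 / l * (4 / A).
  by field; rewrite !gt_eqF.
apply: ler_wpM2l; first by rewrite divr_ge0 ?(ltW l0)// mulr_ge0.
rewrite ler_pdivrMr; last by rewrite exprn_gt0//; lra.
rewrite mulrAC ler_pdivlMr//; nra.
Qed.

End BoxArgument.

(** * Tonelli and Fubini on a product of two subsets *)

Section FubiniOn.
Local Open Scope ereal_scope.
Context d1 d2 (T1 : measurableType d1) (T2 : measurableType d2) (R : realType).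
Variables (m1 : {sigma_finite_measure set T1 -> \bar R})
          (m2 : {sigma_finite_measure set T2 -> \bar R}).
Variables (A : set T1) (B : set T2) (mA : measurable A) (mB : measurable B).
Variable (f : T1 * T2 -> \bar R).
Hypothesis mf : measurable_fun (A `*` B) f.

Let fAB := f \_ (A `*` B).

Let mfAB : measurable_fun setT fAB.
Proof. by apply/(measurable_restrictT f) => //; exact: measurableX. Qed.

Lemma patchX_l x : A x -> \int[m2]_(y in B) f (x, y) = \int[m2]_y fAB (x, y).
Proof.
move=> Ax; rewrite integral_mkcond; apply: eq_integral => y _.
rewrite /fAB !patchE; case: ifPn => yB.
  by rewrite ifT//; apply/mem_set; split => //; exact/set_mem.
by rewrite ifF//; apply/negbTE; apply: contra yB => /set_mem[_ ?]; exact/mem_set.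
Qed.

Lemma patchX_r y : B y -> \int[m1]_(x in A) f (x, y) = \int[m1]_x fAB (x, y).
Proof.
move=> By; rewrite integral_mkcond; apply: eq_integral => x _.
rewrite /fAB !patchE; case: ifPn => yB.
  by rewrite ifT//; apply/mem_set; split => //; exact/set_mem.
by rewrite ifF//; apply/negbTE; apply: contra yB => /set_mem[? _]; exact/mem_set.
Qed.

Lemma fubini_iterated_l : \int[m1]_(x in A) \int[m2]_(y in B) f (x, y) =
  \int[m1]_x \int[m2]_y fAB (x, y).
Proof.
rewrite integral_mkcond; apply: eq_integral => x _; rewrite patchE.
case: ifPn => xA; first by rewrite patchX_l//; exact: set_mem.
rewrite integral0_eq// => y _; rewrite /fAB patchE ifF//.
by apply/negbTE; apply: contra xA => /set_mem[? _]; exact/mem_set.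
Qed.

Lemma fubini_iterated_r : \int[m2]_(y in B) \int[m1]_(x in A) f (x, y) =
  \int[m2]_y \int[m1]_x fAB (x, y).
Proof.
rewrite integral_mkcond; apply: eq_integral => y _; rewrite patchE.
case: ifPn => yB; first by rewrite patchX_r//; exact: set_mem.
rewrite integral0_eq// => x _; rewrite /fAB patchE ifF//.
by apply/negbTE; apply: contra yB => /set_mem[_ ?]; exact/mem_set.
Qed.

Section nonneg.
Hypothesis f0 : forall x y, A x -> B y -> 0 <= f (x, y).

Let fAB0 z : 0 <= fAB z.
Proof.
by rewrite /fAB patchE; case: ifPn => // /set_mem; case: z => x y [? ?]; exact: f0.
Qed.

Lemma fubini_tonelli_on :
  \int[m1]_(x in A) \int[m2]_(y in B) f (x, y) =
  \int[m2]_(y in B) \int[m1]_(x in A) f (x, y).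
Proof.
rewrite fubini_iterated_l fubini_iterated_r.
exact: (@fubini_tonelli _ _ _ _ _ m1 m2 _ mfAB fAB0).
Qed.

Lemma measurable_fun_tonelli_l :
  measurable_fun A (fun x => \int[m2]_(y in B) f (x, y)).
Proof.
apply: (@eq_measurable_fun _ _ _ _ _ (fun x => \int[m2]_y fAB (x, y))).
  by move=> x /set_mem xA; rewrite patchX_l.
apply: measurable_funTS.
exact: (@measurable_fun_fubini_tonelli_F _ _ _ _ _ m2 _ mfAB fAB0).
Qed.

Lemma measurable_fun_tonelli_r :
  measurable_fun B (fun y => \int[m1]_(x in A) f (x, y)).
Proof.
apply: (@eq_measurable_fun _ _ _ _ _ (fun y => \int[m1]_x fAB (x, y))).
  by move=> y /set_mem yB; rewrite patchX_r.
apply: measurable_funTS.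
exact: (@measurable_fun_fubini_tonelli_G _ _ _ _ _ m1 _ mfAB fAB0).
Qed.

End nonneg.

End FubiniOn.

Section FubiniOnSigned.
Local Open Scope ereal_scope.
Context d1 d2 (T1 : measurableType d1) (T2 : measurableType d2) (R : realType).
Variables (m1 : {sigma_finite_measure set T1 -> \bar R})
          (m2 : {sigma_finite_measure set T2 -> \bar R}).
Variables (A : set T1) (B : set T2) (mA : measurable A) (mB : measurable B).
Variable (f : T1 * T2 -> \bar R).
Hypothesis mf : measurable_fun (A `*` B) f.

(** The extended integral is the difference of the integrals of the positive and negative parts, and
    Tonelli handles each of them. *)
Lemma measurable_integral_r :
  measurable_fun B (fun y => \int[m1]_(x in A) f (x, y)).
Proof.
have mp := @measurable_fun_tonelli_r _ _ _ _ _ m1 _ _ mA mB (f^\+)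
  (measurable_funepos mf) (fun _ _ _ _ => funepos_ge0 _ _).
have mn := @measurable_fun_tonelli_r _ _ _ _ _ m1 _ _ mA mB (f^\-)
  (measurable_funeneg mf) (fun _ _ _ _ => funeneg_ge0 _ _).
apply: eq_measurable_fun (emeasurable_funB mp mn) => x _.
by rewrite [RHS]integralE; congr (_ - _); apply: eq_integral => z _; rewrite ?funeposE ?funenegE.
Qed.

Hypothesis fint : \int[m1]_(x in A) \int[m2]_(y in B) `|f (x, y)| < +oo.

Lemma fubini_on :
  \int[m1]_(x in A) \int[m2]_(y in B) f (x, y) =
  \int[m2]_(y in B) \int[m1]_(x in A) f (x, y).
Proof.
rewrite fubini_iterated_l fubini_iterated_r; apply: Fubini.
apply/integrable12ltyP.
  by apply/(measurable_restrictT f) => //; exact: measurableX.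
apply: le_lt_trans fint; rewrite (fubini_iterated_l m1 m2 A B (fun z => `|f z|)).
rewrite le_eqVlt; apply/orP; left; apply/eqP.
apply: eq_integral => x _; apply: eq_integral => y _.
by rewrite !patchE; case: ifPn => // _; rewrite abse0.
Qed.

End FubiniOnSigned.

Section PoissonMass.
Variable R : realType.
Local Notation leb := (@lebesgue_measure R).

Lemma is_derive_atan_shift (y x t : R) : 0 < y ->
  is_derive t 1 (fun s => - atan ((x - s) / y)) (pker y (x - t)).
Proof.
move=> y0.
have dl : is_derive t 1 (fun s : R => (x - s) / y) (- y^-1).
  have d1 : is_derive t 1 (fun s : R => x - s) (-1).
    by apply: is_derive_eq; rewrite add0r mul1r.
  have := @is_deriveZ _ _ _ (fun s : R => x - s) y^-1 t 1 _ d1.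
  move=> h; have -> : (fun s : R => (x - s) / y) = y^-1 \*: (fun s : R => x - s).
    by apply/funext => s; rewrite /= mulrC.
  by apply: (is_derive_eq h); rewrite /GRing.scale/= mulrN1.
have da : is_derive ((x - t) / y) 1 (@atan R) ((1 + ((x - t) / y) ^+ 2)^-1).
  by split; [exact: derivable_atan|rewrite -derive1E derive1_atan].
have h := @is_derive1_comp _ (@atan R) (fun s => (x - s) / y) t _ _ da dl.
apply: (is_derive_eq (is_deriveN h)).
have D0 := ker_den_gt0 (x - t) y0.
rewrite /pker /GRing.scale/=.
have -> : 1 + ((x - t) / y) ^+ 2 = (y ^+ 2 + (x - t) ^+ 2) / y ^+ 2.
  by field; rewrite gt_eqF.
by field; rewrite !gt_eqF.
Qed.

(** The antiderivative - atan ((x - t) / y) varies by at most pi, whatever the segment. *)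
Lemma integral_pker_le (y x c e : R) : 0 < y -> c < e ->
  (\int[leb]_(t in `[c, e]) (pker y (x - t))%:E <= (@pi R)%:E)%E.
Proof.
move=> y0 ce.
rewrite (@continuous_FTC2 _ (fun t => pker y (x - t))
  (fun s => - atan ((x - s) / y)))//.
- rewrite -EFinB lee_fin.
  have := atan_ltpi2 ((x - c) / y); have := atan_gtNpi2 ((x - e) / y); lra.
- apply: continuous_subspaceT => t.
  apply: (continuous_comp (f := fun t => x - t) (g := pker y)).
    by apply: cvgB; [exact: cvg_cst|exact: cvg_id].
  exact: continuous_pker.
- have cont t : {for t, continuous (fun s => - atan ((x - s) / y))}.
    apply/differentiable_continuous/derivable1_diffP.
    exact: (@ex_derive _ _ _ _ _ _ _ (is_derive_atan_shift x t y0)).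
  split.
  + by move=> t _; exact: (@ex_derive _ _ _ _ _ _ _ (is_derive_atan_shift x t y0)).
  + by apply: cvg_at_right_filter; exact: cont.
  + by apply: cvg_at_left_filter; exact: cont.
- by move=> t _; rewrite derive1E; have [_ ->] := is_derive_atan_shift x t y0.
Qed.

End PoissonMass.

(** * Weak-type bounds *)

Section WeakType.
Variable R : realType.
Implicit Types l P Q : R.

(** P - Re (v^2 / (l + v)) = l Re (v / (l + v)), and 2 Re (v (l + conj v)) >= |l + v|^2 exactly when
    |v| >= l, which |Q| > l ensures. *)
Lemma sub_hol_re l P Q : 0 < l -> 0 <= P ->
  0 <= P - hol_re l P Q /\ (l < `|Q| -> l / 2 <= P - hol_re l P Q).
Proof.
move=> l0 P0; have D0 := hol_den_gt0 Q l0 P0.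
have -> : P - hol_re l P Q =
    l * (P * (l + P) + Q ^+ 2) / ((l + P) ^+ 2 + Q ^+ 2).
  by rewrite /hol_re; field; rewrite gt_eqF.
have Q2 := sqr_ge0 Q; have lP : 0 <= l * P by rewrite mulr_ge0// ltW.
have PP : 0 <= P * P by rewrite mulr_ge0.
split; first by rewrite divr_ge0 ?(ltW D0)// mulr_ge0 ?(ltW l0)//; lra.
move=> lQ; rewrite ler_pdivlMr// -mulrA ler_pM2l//.
have : l ^+ 2 <= Q ^+ 2 by rewrite -(real_normK (num_real Q)) ler_sqr ?nnegrE// ltW.
lra.
Qed.

(** The numerator of - Re (v^2 / (l + v)) is (l - P) |v|^2 - 2 l P^2. As P <= B <= l / 2, the first
    term keeps half of l |v|^2, and the second is absorbed by 2 B P / l since |l + v|^2 >= l^2.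
    Where |Q| > l, the inequality |l + v|^2 <= 4 |v|^2 yields l / 8. *)
Lemma opp_hol_re l P Q B : 0 < l -> 0 <= P -> P <= B -> 2 * B <= l ->
  0 <= 2 * B / l * P - hol_re l P Q /\
  (l < `|Q| -> l / 8 <= 2 * B / l * P - hol_re l P Q).
Proof.
move=> l0 P0 PB Bl; have D0 := hol_den_gt0 Q l0 P0; have lD := hol_den Q l0 P0.
have Q2 := sqr_ge0 Q; have P2 := sqr_ge0 P.
have h : l / 2 * (P ^+ 2 + Q ^+ 2) / ((l + P) ^+ 2 + Q ^+ 2) <=
    2 * B / l * P - hol_re l P Q.
  rewrite -subr_ge0.
  have -> : 2 * B / l * P - hol_re l P Q -
      l / 2 * (P ^+ 2 + Q ^+ 2) / ((l + P) ^+ 2 + Q ^+ 2) =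
      ((l / 2 - P) * (P ^+ 2 + Q ^+ 2) / ((l + P) ^+ 2 + Q ^+ 2)) +
      2 * P * ((B * ((l + P) ^+ 2 + Q ^+ 2) - l ^+ 2 * P) /
        (l * ((l + P) ^+ 2 + Q ^+ 2))).
    by rewrite /hol_re; field; rewrite !gt_eqF.
  rewrite addr_ge0//.
    by rewrite divr_ge0 ?(ltW D0)// mulr_ge0//; lra.
  rewrite mulr_ge0//; first lra.
  rewrite divr_ge0//; last by rewrite ltW// mulr_gt0.
  rewrite subr_ge0 mulrC ler_pM// ?sqr_ge0//.
split; first by apply: le_trans h; rewrite divr_ge0 ?(ltW D0)// mulr_ge0//; lra.
move=> lQ; apply: le_trans h; rewrite ler_pdivlMr//.
have -> : l / 8 * ((l + P) ^+ 2 + Q ^+ 2) =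
  l / 2 * (((l + P) ^+ 2 + Q ^+ 2) / 4) by field.
rewrite ler_pM2l; last by lra.
have : l ^+ 2 <= Q ^+ 2 by rewrite -(real_normK (num_real Q)) ler_sqr ?nnegrE// ltW.
by have := sqr_ge0 (l - P); lra.
Qed.

Local Notation leb := (@lebesgue_measure R).

Lemma chebyshev_segment (W : R -> R) (c A : R) (S : set R) : 0 <= c -> continuous W ->
  (forall t, 0 <= W t) -> measurable S -> S `<=` `[- A, A]%classic ->
  (forall t, S t -> c <= W t) ->
  (c%:E * leb S <= (\int[leb]_(t in `[- A, A]) W t)%:E)%E.
Proof.
move=> c0 cW W0 mS SA cS.
have iW : leb.-integrable `[- A, A] (EFin \o W).
  apply: continuous_compact_integrable; first exact: segment_compact.
  exact: continuous_subspaceT.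
rewrite fineK; last exact: integrable_fin_num.
rewrite -integral_cst//.
have mW D : measurable_fun D (fun t => (W t)%:E).
  apply/measurable_EFinP; apply: measurable_funTS.
  exact: continuous_measurable_fun.
apply: (@le_trans _ _ (\int[leb]_(t in S) (W t)%:E)%E).
  by apply: ge0_le_integral => //=; exact: mW.
apply: ge0_subset_integral => //=; first exact: mW.
by move=> t _; rewrite lee_fin.
Qed.

(** Lets the size A of the box tend to infinity. *)
Lemma le_addr_inv (c x K e : R) : 0 <= K ->
  (forall A, 2 <= A -> e < A -> c <= x + K / A) -> c <= x.
Proof.
move=> K0 h; apply/ler_addgt0Pr => r r0.
pose A := 2 + `|e| + K / r.
have Kr : 0 <= K / r by rewrite divr_ge0// ltW.
have e0 := normr_ge0 e; have e1 := ler_norm e.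
have A0 : 0 < A by rewrite /A; lra.
apply: (le_trans (h A _ _)); [by rewrite /A; lra..|].
rewrite lerD2l ler_pdivrMr//.
have : r * (K / r) = K by field; rewrite gt_eqF.
have : 0 <= r * (2 + `|e|) by rewrite mulr_ge0 ?(ltW r0)//; lra.
by rewrite /A mulrDr; lra.
Qed.

End WeakType.

Section WeakTypeConj.
Context d (X : measurableType d) (R : realType).
Variable mu : {sigma_finite_measure set X -> \bar R}.
Variables (E : set X) (mE : measurable E) (Efin : (mu E < +oo)%E).
Variables (u : X -> R) (mu_ : measurable_fun E u).
Hypothesis u1 : forall x, E x -> `|u x| <= 1.
Local Notation leb := (@lebesgue_measure R).

Let m := fine (mu E).
Let P := poisson mu E u.
Let Q := conjp mu E u.

Lemma measurable_kernel_pair (k : R -> R) (B : set R) : continuous k ->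
  measurable B ->
  measurable_fun (E `*` B) (fun z : X * measurableTypeR R => k (u z.1 - z.2)).
Proof.
move=> ck mB.
have m1 : measurable_fun (E `*` B) (fun z : X * measurableTypeR R => u z.1).
  apply: (measurable_comp (F := E)) => //.
    by move=> _ [z [Ez _] <-].
  by apply: measurable_funTS; exact: measurable_fst.
have m2 : measurable_fun (E `*` B) (fun z : X * measurableTypeR R => (z.2 : R)).
  by apply: measurable_funTS; exact: measurable_snd.
exact: measurableT_comp (continuous_measurable_fun ck) (measurable_funB m1 m2).
Qed.

Lemma poissonE y t : 0 < y ->
  (P y t)%:E = (\int[mu]_(x in E) (pker y (u x - t))%:E)%E.
Proof.
move=> y0; rewrite /P /poisson /conv /Rintegral fineK//.
apply: integrable_fin_num => //.
apply: (@integrable_le_cst _ _ _ mu _ mE Efin _ y^-1).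
  by apply: measurable_conv_ker => //; exact: continuous_pker.
by move=> x _; rewrite ger0_norm ?pker_ge0// pker_le.
Qed.

(** By Tonelli, each point of E contributes at most the mass pi of its kernel. *)
Lemma integral_poisson_le (y A : R) : 0 < y -> 0 < A ->
  \int[leb]_(t in `[- A, A]) P y t <= pi * m.
Proof.
move=> y0 A0.
have mA : measurable (`[- A, A]%classic : set R) by exact: measurable_itv.
have cP := @continuous_poisson _ _ _ mu _ mE Efin _ mu_ y y0.
have iP : leb.-integrable `[- A, A] (EFin \o P y).
  apply: continuous_compact_integrable; first exact: segment_compact.
  exact: continuous_subspaceT.
have AA : - A < A by lra.
rewrite -lee_fin fineK; last exact: integrable_fin_num.
under eq_integral do rewrite /= poissonE//.
have mk := measurable_kernel_pair (continuous_pker y0) mA.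
rewrite -(@fubini_tonelli_on _ _ _ _ _ mu leb E `[- A, A]%classic mE mA
  (fun z => (pker y (u z.1 - z.2))%:E)); last 2 first.
- exact/measurable_EFinP.
- by move=> x t _ _; rewrite lee_fin pker_ge0.
apply: (@le_trans _ _ (\int[mu]_(x in E) (pi%:E : \bar R))%E).
  apply: ge0_le_integral => //.
  - by move=> x _; apply: integral_ge0 => t _; rewrite lee_fin pker_ge0.
  - apply: (@measurable_fun_tonelli_l _ _ _ _ _ leb _ _ mE mA
      (fun z => (pker y (u z.1 - z.2))%:E)).
      exact/measurable_EFinP.
    by move=> x t _ _; rewrite lee_fin pker_ge0.
  - by move=> x _; exact: (@integral_pker_le R y (u x) (- A) A y0 AA).
rewrite integral_cst// EFinM fineK//.
by rewrite ge0_fin_numE.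
Qed.

Let S (y l : R) : set R := `]-1, 1[%classic `&` [set t | l < `|Q y t|].

Lemma measurable_conj_level y l : 0 < y -> measurable (S y l).
Proof.
move=> y0; have cQ := @continuous_conjp _ _ _ mu _ mE Efin _ mu_ y y0.
have mQ : measurable_fun setT (fun t => `|Q y t|).
  by apply: measurableT_comp => //; exact: continuous_measurable_fun.
apply: measurableI; first exact: measurable_itv.
rewrite (_ : [set t | _] = (fun t => `|Q y t|) @^-1` `]l, +oo[%classic); last first.
  by apply/seteqP; split => t /=; rewrite in_itv/= andbT.
by rewrite -[X in measurable X]setTI; apply: mQ => //; exact: measurable_itv.
Qed.

Lemma conj_level_sub y l A : 2 <= A -> S y l `<=` `[- A, A]%classic.
Proof. by move=> A2 t [] /=; rewrite !in_itv/= => /andP[? ?] _; lra. Qed.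

Lemma hol_re_integrable (l y A : R) : 0 < l -> 0 < y ->
  leb.-integrable `[- A, A] (EFin \o (fun t => hol_re l (P y t) (Q y t))).
Proof.
move=> l0 y0; apply: continuous_compact_integrable; first exact: segment_compact.
by apply: continuous_subspaceT; exact: continuous_poisson_hol_re.
Qed.

(** Chebyshev's inequality for B P - Re (v^2 / (l + v)), whose integral over [-A, A] is at most B pi
    |E| + O(1 / A). The two weak bounds are the choices B = 1, c = l / 2 and B = 2 pi / l, c = l /
    8. *)
Lemma weak_type_scaled (y l B c : R) : 0 < y -> 0 < l -> 0 <= B -> 0 < c ->
  (forall t, 0 <= B * P y t - hol_re l (P y t) (Q y t) /\
     (l < `|Q y t| -> c <= B * P y t - hol_re l (P y t) (Q y t))) ->
  (leb (S y l) <= (B * pi * m / c)%:E)%E.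
Proof.
move=> y0 l0 B0 c0 h; have mS := measurable_conj_level l y0.
have Sfin : leb (S y l) \is a fin_num.
  rewrite ge0_fin_numE//; apply: (@le_lt_trans _ _ (leb `[(-2)%R, 2%R]%classic)).
    by apply: le_measure; rewrite ?inE//; exact: conj_level_sub.
  by rewrite lebesgue_measure_itv/=; case: ifP => // _; rewrite ltry.
have m0 : 0 <= m by exact: fine_ge0.
rewrite -(fineK Sfin) lee_fin ler_pdivlMr// mulrC.
apply: (@le_addr_inv _ _ _ (64 * m ^+ 2 / l) y).
  by rewrite divr_ge0 ?(ltW l0)// mulr_ge0// sqr_ge0.
move=> A A2 yA.
have A0 : 0 < A by lra.
have cP := @continuous_poisson _ _ _ mu _ mE Efin _ mu_ y y0.
have cG := @continuous_poisson_hol_re _ _ _ mu _ mE Efin _ mu_ l l0 y y0.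
have iP : leb.-integrable `[- A, A] (EFin \o P y).
  apply: continuous_compact_integrable; first exact: segment_compact.
  exact: continuous_subspaceT.
have iBP : leb.-integrable `[- A, A] (EFin \o (fun t => B * P y t)).
  apply: continuous_compact_integrable; first exact: segment_compact.
  by apply: continuous_subspaceT => t; apply: cvgM; [exact: cvg_cst|exact: cP].
have iG := @hol_re_integrable l y A l0 y0.
rewrite -lee_fin EFinM fineK//.
apply: (le_trans (@chebyshev_segment _
  (fun t => B * P y t - hol_re l (P y t) (Q y t)) c A (S y l) (ltW c0) _ _ mS _ _)).
- by move=> t; apply: cvgB; [apply: cvgM; [exact: cvg_cst|exact: cP]|exact: cG].
- by move=> t; have [] := h t.
- exact: conj_level_sub.
- by move=> t [_ lQ]; have [_] := h t; apply.
rewrite lee_fin RintegralB//.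
rewrite lerD//.
  rewrite RintegralZl// -?mulrA ?ler_wpM2l//.
  exact: integral_poisson_le.
have := @integral_hol_small _ _ _ mu _ mE Efin _ mu_ u1 l l0 A y A2 y0 yA.
rewrite -/m -/P -/Q ler_norml => /andP[+ _].
have -> : 64 * m ^+ 2 / l / A = 64 * m ^+ 2 / (l * A).
  by field; rewrite !gt_eqF.
lra.
Qed.

Lemma conj_weak11 (y l : R) : 0 < y -> 0 < l ->
  (leb (S y l) <= (2 * pi * m / l)%:E)%E.
Proof.
move=> y0 l0.
have -> : 2 * pi * m / l = 1 * pi * m / (l / 2) by field; rewrite gt_eqF.
apply: weak_type_scaled => //; first lra.
by move=> t; rewrite mul1r; apply: sub_hol_re => //; exact: poisson_ge0.
Qed.

Lemma conj_weak22 (y l : R) : 0 < y -> 2 * pi <= l -> (forall t, P y t <= pi) ->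
  (leb (S y l) <= (16 * pi ^+ 2 * m / l ^+ 2)%:E)%E.
Proof.
move=> y0 pil Ppi; have p0 : 0 < (pi : R) := pi_gt0 R.
have l0 : 0 < l by lra.
have -> : 16 * pi ^+ 2 * m / l ^+ 2 = 2 * pi / l * pi * m / (l / 8).
  by field; rewrite gt_eqF.
apply: weak_type_scaled => //; [|lra|].
  by rewrite divr_ge0 ?(ltW l0)//; lra.
by move=> t; apply: opp_hol_re => //; exact: poisson_ge0.
Qed.

End WeakTypeConj.

(** * Rearrangements and weighted norms *)

Section LayerCake.
Variable R : realType.
Local Notation leb := (@lebesgue_measure R).
Local Open Scope ereal_scope.
Implicit Types (c : R) (r : \bar R).

(** Layer-cake formulas are cut at an arbitrary height [c], and not only at 0, for the sake of the
    variational formula for the integral of a rearrangement over an initial segment. *)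
Definition excess c r : \bar R := maxe (r - c%:E) 0.

Lemma excess_ge0 c r : 0 <= excess c r.
Proof. by rewrite /excess le_max lexx orbT. Qed.

Lemma excess_le c r : r <= c%:E + excess c r.
Proof.
rewrite /excess; case: r => [x| |]; rewrite ?leNye//.
rewrite -EFinB -[0]/(0%:E) -EFin_max -EFinD lee_fin.
by rewrite addrC -lerBlDr le_max lexx.
Qed.

Lemma excess_eq0 c r : r <= c%:E -> excess c r = 0.
Proof. by move=> rc; rewrite /excess max_r// sube_le0. Qed.

Lemma excess_eq c r : c%:E <= r -> r = c%:E + excess c r.
Proof.
move=> cr; rewrite /excess max_l ?sube_ge0//.
by rewrite addeC subeK.
Qed.

Lemma excess0 r : 0 <= r -> excess 0 r = r.
Proof. by move=> r0; rewrite [RHS](excess_eq r0) add0e. Qed.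

Lemma excess_measure c r :
  leb (`[c, +oo[%classic `&` [set l | l%:E < r]) = excess c r.
Proof.
case: r => [x| |].
- have -> : `[c, +oo[%classic `&` [set l | l%:E < x%:E] = `[c, x[%classic.
    apply/seteqP; split => l /=; rewrite !in_itv/= andbT lte_fin.
      by move=> [-> ->].
    by move=> /andP[].
  rewrite lebesgue_measure_itv/= lte_fin; case: ltP => cx.
    by rewrite /excess -EFinB max_l// lee_fin subr_ge0 ltW.
  by rewrite excess_eq0// lee_fin.
- have -> : `[c, +oo[%classic `&` [set l | l%:E < +oo] = `[c, +oo[%classic.
    by apply/setIidPl => l _ /=; rewrite ltry.
  by rewrite lebesgue_measure_itv/= ltry /excess addye// max_l ?leey.
- rewrite (_ : _ `&` _ = set0); last by apply/seteqP; split => // l [].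
  by rewrite measure0 excess_eq0// leNye.
Qed.

Context d (T : measurableType d) (nu : {sigma_finite_measure set T -> \bar R}).
Variables (A : set T) (mA : measurable A) (phi : T -> \bar R).
Hypothesis mphi : measurable_fun A phi.

Let B c : set (measurableTypeR R) := `[c, +oo[%classic.
Let mB c : measurable (B c). Proof. exact: measurable_itv. Qed.
Let S c : set (T * measurableTypeR R) :=
  (A `*` B c) `&` [set z | z.2%:E < phi z.1].

Let mS c : measurable (S c).
Proof.
apply: measurable_lte.
- exact: measurableX.
- apply: measurable_funTS; apply/measurable_EFinP.
  exact: measurable_snd.
- apply: (measurable_comp (F := A)) => //.
    by move=> _ [z [Az _] <-].
  by apply: measurable_funTS; exact: measurable_fst.
Qed.

Section weighted.
Variables (c : R) (w : T -> \bar R).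
Hypotheses (mw : measurable_fun A w) (w0 : forall t, A t -> 0 <= w t).

Let f (z : T * measurableTypeR R) := w z.1 * (\1_(S c) z)%:E.

Let mf : measurable_fun (A `*` B c) f.
Proof.
apply: emeasurable_funM.
  apply: (measurable_comp (F := A)) => //.
    by move=> _ [z [Az _] <-].
  by apply: measurable_funTS; exact: measurable_fst.
by apply/measurable_EFinP; exact: measurable_indic.
Qed.

Let f0 x y : A x -> B c y -> 0 <= f (x, y).
Proof. by move=> Ax _; rewrite mule_ge0// ?w0// lee_fin. Qed.

Let section_l t : A t -> \int[leb]_(l in B c) f (t, l) = excess c (phi t) * w t.
Proof.
move=> At; transitivity (\int[leb]_(l in B c) (w t * (\1_(S c) (t, l))%:E)) => //.
rewrite ge0_integralZl ?w0//; last first.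
  apply/measurable_EFinP; apply: measurable_funTS.
  have m1 := @measurable_indic _ _ R setT _ (mS c).
  by apply: (measurableT_comp m1); exact: measurable_pair1.
rewrite muleC; congr (_ * _).
rewrite -excess_measure setIC -integral_indic//; last first.
  case: (phi t) => [x| |].
  - rewrite (_ : [set l | _] = `]-oo, x[%classic); first exact: measurable_itv.
    by apply/seteqP; split => l /=; rewrite in_itv/= lte_fin.
  - rewrite (_ : [set l | _] = setT)//.
    by apply/seteqP; split => // l _ /=; rewrite ltry.
  - by rewrite (_ : [set l | _] = set0)//; apply/seteqP; split.
apply: eq_integral => l /set_mem Bl; congr (_ %:E).
by rewrite !indicE; congr ((nat_of_bool _)%:R)%R; apply/idP/idP => /set_mem;
  [move=> [_ ?]; exact/mem_set|move=> lp; apply/mem_set; split].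
Qed.

Let section_r l : B c l -> \int[nu]_(t in A) f (t, l) =
  \int[nu]_(t in A `&` [set t | l%:E < phi t]) w t.
Proof.
move=> Bl; rewrite [RHS]integral_mkcondr; apply: eq_integral => t /set_mem At /=.
rewrite patchE /f indicE; case: ifPn => tl.
  rewrite mem_set ?mule1//; split => //; exact/set_mem.
rewrite memNset ?mule0//; move=> [_ lt]; move/negP: tl; apply.
exact/mem_set.
Qed.

(** Tonelli for [w] times the indicator of the region under the graph of [phi] and above height [c].
    It serves twice: to slice a rearrangement against a fixed weight, and to slice the weight with
    the rearrangement in the role of [w]. *)
Lemma layer_cake_weighted :
  \int[nu]_(t in A) (excess c (phi t) * w t) =
  \int[leb]_(l in `[c, +oo[) \int[nu]_(t in A `&` [set t | l%:E < phi t]) w t.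
Proof.
transitivity (\int[nu]_(t in A) \int[leb]_(l in B c) f (t, l)).
  by apply: eq_integral => t /set_mem At; rewrite section_l.
rewrite (fubini_tonelli_on nu leb mA (mB c) mf f0).
by apply: eq_integral => l /set_mem Bl; rewrite section_r.
Qed.

Lemma measurable_layer : measurable_fun (B c)
  (fun l : R => \int[nu]_(t in A `&` [set t | l%:E < phi t]) w t).
Proof.
apply: (@eq_measurable_fun _ _ _ _ _ (fun l => \int[nu]_(t in A) f (t, l))).
  by move=> l /set_mem Bl; rewrite section_r.
exact: measurable_fun_tonelli_r.
Qed.

End weighted.

Lemma layer_cake c :
  \int[nu]_(t in A) excess c (phi t) =
  \int[leb]_(l in `[c, +oo[) nu (A `&` [set t | l%:E < phi t]).
Proof.
transitivity (\int[nu]_(t in A) (excess c (phi t) * cst 1 t)).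
  by apply: eq_integral => t _; rewrite mule1.
rewrite layer_cake_weighted//; apply: eq_integral => l _.
rewrite integral_cst ?mul1e//.
by apply: measurable_lte => //; exact: measurable_cst.
Qed.

Lemma measurable_excess c : measurable_fun A (fun t => excess c (phi t)).
Proof.
apply: measurable_maxe; last exact: measurable_cst.
by apply: emeasurable_funB => //; exact: measurable_cst.
Qed.

End LayerCake.

Section Rearrangement.
Variable R : realType.
Local Notation mu := (@completed_lebesgue_measure R).
Local Notation leb := (@lebesgue_measure R).
Implicit Types (g h : lebesgueR R -> R) (l t : R).
Local Open Scope ereal_scope.

Definition distr g l : \bar R := mu (I11 `&` [set x | (l < g x)%R]).

Definition rearr g t : \bar R :=
  ereal_inf [set l%:E | l in [set l : R | (0 <= l)%R /\ distr g l <= t%:E]].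

Definition I02 : set (lebesgueR R) := `]0%R, 2%R[%classic.

Lemma measurable_id_lebesgueR :
  measurable_fun setT (fun x : lebesgueR R => x : measurableTypeR R).
Proof. by move=> _ A mA; rewrite setTI; exact: sub_caratheodory. Qed.

Lemma measurable_lebesgueR (A : set R) : measurable (A : set (measurableTypeR R)) ->
  measurable (A : set (lebesgueR R)).
Proof. by move=> mA; exact: sub_caratheodory. Qed.

Lemma measurable_I11 : measurable (I11 : set (lebesgueR R)).
Proof. by apply: measurable_lebesgueR; exact: measurable_itv. Qed.

Lemma measurable_I02 : measurable I02.
Proof. by apply: measurable_lebesgueR; exact: measurable_itv. Qed.

Lemma measure_I11 : mu I11 = 2%:E.
Proof.
rewrite (_ : mu I11 = leb `](-1)%R, 1%R[%classic)//.
rewrite lebesgue_measure_itv/= lte_fin ifT; last by lra.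
by rewrite -EFinB opprK.
Qed.

Lemma measurable_level g l : measurable_fun I11 g ->
  measurable (I11 `&` [set x | (l < g x)%R]).
Proof.
move=> mg.
have -> : [set x | (l < g x)%R] = g @^-1` `]l, +oo[%classic.
  by apply/seteqP; split => x /=; rewrite in_itv/= andbT.
by apply: mg; [exact: measurable_I11|exact: measurable_itv].
Qed.

Lemma distr_ge0 g l : 0 <= distr g l.
Proof. exact: measure_ge0. Qed.

Lemma distr_le2 g l : measurable_fun I11 g -> distr g l <= 2%:E.
Proof.
move=> mg; rewrite -measure_I11; apply: le_measure; rewrite ?inE.
- exact: measurable_level.
- exact: measurable_I11.
- exact: subIsetl.
Qed.

Lemma le_distr g h l l' : measurable_fun I11 g -> measurable_fun I11 h ->
  (forall x, I11 x -> (l' < h x)%R -> (l < g x)%R) -> distr h l' <= distr g l.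
Proof.
move=> mg mh hg; apply: le_measure; rewrite ?inE; try exact: measurable_level.
by move=> x [Ix hx]; split => //; exact: hg.
Qed.

Lemma lt_measure_bigcup d (T : measurableType d) (nu : {measure set T -> \bar R})
    (F : (set T)^nat) (a : \bar R) :
  (forall i, measurable (F i)) -> nondecreasing_seq F ->
  a < nu (\bigcup_n F n) -> exists n, a < nu (F n).
Proof.
move=> mF ndF aF; apply: contrapT => /forallNP h.
have h2 : (nu \o F) n @[n --> \oo] --> nu (\bigcup_n F n).
  by apply: nondecreasing_cvg_mu => //; exact: bigcupT_measurable.
have : nu (\bigcup_n F n) <= a.
  rewrite -(cvg_lim _ h2)//; apply: lime_le; first by apply/cvg_ex; eexists; exact: h2.
  by apply: nearW => n /=; rewrite leNgt; exact/negP/h.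
by rewrite leNgt aF.
Qed.

(** Right-continuity of the distribution function: {g > l} is the increasing union of the sets {g >
    l + 1 / (n + 1)}. *)
Lemma distr_rcont g l (t : \bar R) : measurable_fun I11 g -> t < distr g l ->
  exists2 l', (l < l')%R & t < distr g l'.
Proof.
move=> mg; rewrite /distr.
pose F n : set (lebesgueR R) := I11 `&` [set x | (l + n.+1%:R^-1 < g x)%R].
have -> : I11 `&` [set x | (l < g x)%R] = \bigcup_n F n.
  apply/seteqP; split => [x [Ix lx]|x [n _ [Ix lx]]].
    have [n hn] : exists n : nat, (n.+1%:R^-1 < g x - l)%R.
      have /ltr_add_invr[n hn] : (0 < g x - l)%R by rewrite subr_gt0.
      by exists n; rewrite add0r in hn.
    exists n => //; split => //=; by rewrite addrC -ltrBrDr.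
  split => //=; apply: lt_trans lx.
  by rewrite ltrDl invr_gt0.
move=> /lt_measure_bigcup h.
have [n hn] : exists n, t < mu (F n).
  apply: h => [i|]; first exact: measurable_level.
  move=> n m nm; apply/subsetPset => x [Ix lx]; split => //=.
  apply: le_lt_trans lx; rewrite lerD2l lef_pV2 ?posrE//.
  by rewrite ler_nat ltnS.
by exists (l + n.+1%:R^-1)%R => //; rewrite ltrDl invr_gt0.
Qed.

(** The Galois connection between rearrangement and distribution function, in its strict form; right
    to left rests on right-continuity. Measurability, equimeasurability and the layer formula of the
    weighted norm are read off from it. *)
Lemma rearr_gtP g l t : measurable_fun I11 g -> (0 <= l)%R ->
  (l%:E < rearr g t) = (t%:E < distr g l).
Proof.
move=> mg l0; apply/idP/idP.
  move=> lt; rewrite ltNge; apply/negP => dt.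
  have : rearr g t <= l%:E by apply: ereal_inf_lbound; exists l.
  by rewrite leNgt lt.
move=> /(distr_rcont mg)[l' ll' tl'].
apply: (@lt_le_trans _ _ l'%:E); first by rewrite lte_fin.
apply: le_ereal_inf_tmp => _ [k [k0 kt] <-]; rewrite lee_fin leNgt.
apply/negP => kl'.
have : distr g l' <= t%:E.
  apply: le_trans kt; apply: le_distr => // x _ /=.
  exact: lt_trans.
by rewrite leNgt tl'.
Qed.

Lemma rearr_ge0 g t : 0 <= rearr g t.
Proof. by apply: le_ereal_inf_tmp => _ [k [k0 kt] <-]; rewrite lee_fin. Qed.

Lemma rearr_le g t l : (0 <= l)%R -> distr g l <= t%:E -> rearr g t <= l%:E.
Proof. by move=> l0 lt; apply: ereal_inf_lbound; exists l. Qed.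

Lemma rearr_anti g t t' : (t <= t')%R -> rearr g t' <= rearr g t.
Proof.
move=> tt'; apply: le_ereal_inf => _ [k [k0 kt] <-]; exists k => //; split => //.
by rewrite (le_trans kt)// lee_fin.
Qed.

Lemma le_rearr g h t : measurable_fun I11 g -> measurable_fun I11 h ->
  (forall x, I11 x -> (h x <= g x)%R) -> rearr h t <= rearr g t.
Proof.
move=> mg mh hg; apply: le_ereal_inf => _ [k [k0 kt] <-]; exists k => //; split => //.
apply: le_trans kt; apply: le_distr => // x Ix /lt_le_trans; apply; exact: hg.
Qed.

Lemma measurable_ray (a : \bar R) : measurable [set t : lebesgueR R | t%:E < a].
Proof.
apply: measurable_lebesgueR; case: a => [x| |].
- rewrite (_ : [set t | _] = `]-oo, x[%classic); first exact: measurable_itv.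
  by apply/seteqP; split => l /=; rewrite in_itv/= lte_fin.
- rewrite (_ : [set l | _] = setT)//.
  by apply/seteqP; split => // l _ /=; rewrite ltry.
- by rewrite (_ : [set l | _] = set0)//; apply/seteqP; split.
Qed.

Lemma measurable_rearr g : measurable_fun I11 g -> measurable_fun I02 (rearr g).
Proof.
move=> mg.
suff h : measurable_fun (setT : set (lebesgueR R)) (rearr g).
  exact: measurable_funTS.
apply: (measurability _ (ErealGenOInfty.measurableE R)).
move=> _ [_ [a ->] <-]; rewrite setTI.
have [a0|a0] := leP 0%R a.
  rewrite (_ : _ @^-1` _ = [set t : lebesgueR R | t%:E < distr g a]).
    exact: measurable_ray.
  by apply/seteqP; split => t /=; rewrite in_itv/= andbT rearr_gtP.
rewrite (_ : _ @^-1` _ = setT)//; apply/seteqP; split => // t _ /=.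
by rewrite in_itv/= andbT (lt_le_trans _ (rearr_ge0 g t))// lte_fin.
Qed.

Lemma measure_I02_ray (a : \bar R) : 0 <= a -> a <= 2%:E ->
  mu (I02 `&` [set t | t%:E < a]) = a.
Proof.
case: a => // x; rewrite !lee_fin => x0 x2.
rewrite (_ : _ `&` _ = `]0%R, x[%classic); last first.
  apply/seteqP; split => t /=; rewrite /I02/= !in_itv/= lte_fin.
    by move=> [/andP[-> _] ->].
  by move=> /andP[-> tx]; rewrite (lt_le_trans tx).
rewrite (_ : mu _ = leb `]0%R, x[%classic)//.
rewrite lebesgue_measure_itv/= lte_fin; case: ltP => [_|x00].
  by rewrite -EFinB subr0.
by congr EFin; apply/eqP; rewrite eq_le x0 x00.
Qed.

Lemma rearr_level g l : measurable_fun I11 g -> (0 <= l)%R ->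
  mu (I02 `&` [set t | l%:E < rearr g t]) = distr g l.
Proof.
move=> mg l0; under eq_set do rewrite rearr_gtP//.
by rewrite measure_I02_ray// ?distr_ge0// distr_le2.
Qed.

(** Both sides are the integral of [distr g] over [c, +oo[, by equimeasurability. *)
Lemma integral_excess_rearr g c : measurable_fun I11 g -> (0 <= c)%R ->
  \int[mu]_(t in I02) excess c (rearr g t) =
  \int[mu]_(x in I11) excess c (g x)%:E.
Proof.
move=> mg c0.
rewrite (@layer_cake _ _ _ mu I02 measurable_I02 _ (measurable_rearr mg)).
rewrite (@layer_cake _ _ _ mu I11 measurable_I11 (fun x => (g x)%:E)); last first.
  exact/measurable_EFinP.
apply: eq_integral => l; rewrite inE/= in_itv/= andbT => cl.
by rewrite rearr_level// (le_trans c0).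
Qed.

Section weighted.
Variable w : R -> R.
Hypothesis mw : measurable_fun I02 w.
Hypothesis w0 : forall t, I02 t -> (0 <= w t)%R.

Definition wnrm g : \bar R := \int[mu]_(t in I02) (rearr g t * (w t)%:E).

Definition wmass (a : \bar R) : \bar R :=
  \int[mu]_(t in I02 `&` [set t | t%:E < a]) (w t)%:E.

(** On ]0, 2[ the set where [rearr g] exceeds l is an interval of length [distr g l] starting at 0.
    The norm thus becomes an integral over levels, to be compared with a sum over level sets. *)
Lemma wnrm_layer g : measurable_fun I11 g ->
  wnrm g = \int[leb]_(l in `[0%R, +oo[) wmass (distr g l).
Proof.
move=> mg; transitivity (\int[mu]_(t in I02) (excess 0 (rearr g t) * (w t)%:E)).
  by apply: eq_integral => t _; rewrite excess0// rearr_ge0.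
rewrite (@layer_cake_weighted _ _ _ mu I02 measurable_I02 _ (measurable_rearr mg)).
- apply: eq_integral => l; rewrite inE/= in_itv/= andbT => l0.
  by rewrite /wmass; under eq_set do rewrite rearr_gtP//.
- exact/measurable_EFinP.
- by move=> t It; rewrite lee_fin w0.
Qed.

Lemma wmass_ge0 (a : \bar R) : 0 <= wmass a.
Proof. by apply: integral_ge0 => t [It _]; rewrite lee_fin w0. Qed.

Lemma le_wmass (a a' : \bar R) : a <= a' -> wmass a <= wmass a'.
Proof.
move=> aa'; have mwE : measurable_fun I02 (fun t => (w t)%:E) by exact/measurable_EFinP.
have mS (c : \bar R) : measurable (I02 `&` [set t | t%:E < c]).
  by apply: measurableI; [exact: measurable_I02|exact: measurable_ray].
apply: (@ge0_subset_integral _ _ _ mu _ _ (mS a) (mS a')).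
- by apply: measurable_funS mwE; [exact: measurable_I02|exact: subIsetl].
- by move=> t [It _]; rewrite lee_fin w0.
- by move=> t [It ta]; split => //=; exact: lt_le_trans aa'.
Qed.

Lemma measurable_wmass_distr g : measurable_fun I11 g ->
  measurable_fun (`[0%R, +oo[%classic : set (measurableTypeR R))
    (fun l : R => wmass (distr g l)).
Proof.
move=> mg.
have mwE : measurable_fun I02 (fun t => (w t)%:E) by exact/measurable_EFinP.
have wE0 t : I02 t -> 0 <= (w t)%:E by move=> It; rewrite lee_fin w0.
have := @measurable_layer _ _ _ mu I02 measurable_I02 _ (measurable_rearr mg)
  0%R _ mwE wE0.
apply: eq_measurable_fun => l; rewrite inE/= in_itv/= andbT => l0.
by rewrite /wmass; under eq_set do rewrite rearr_gtP//.
Qed.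

Lemma le_wnrm g h : measurable_fun I11 g -> measurable_fun I11 h ->
  (forall x, I11 x -> (h x <= g x)%R) -> wnrm h <= wnrm g.
Proof.
move=> mg mh hg; have I2 := measurable_I02.
have mh' := measurable_rearr mh; have mg' := measurable_rearr mg.
have mwE : measurable_fun I02 (fun t => (w t)%:E) by exact/measurable_EFinP.
apply: ge0_le_integral; first exact: I2.
- by move=> t It; rewrite mule_ge0 ?rearr_ge0// lee_fin w0.
- exact: emeasurable_funM mh' mwE.
- exact: emeasurable_funM mg' mwE.
- by move=> t It; rewrite lee_wpmul2r ?lee_fin ?w0// le_rearr.
Qed.

End weighted.
End Rearrangement.

Arguments I02 {R}.

(** * Fatou's lemma for rearrangements *)

Section FatouRearrangement.
Variable R : realType.
Local Notation mu := (@completed_lebesgue_measure R).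
Implicit Types (g h : lebesgueR R -> R) (l t : R).
Local Open Scope ereal_scope.

Lemma lee_lt_fin (a b : \bar R) :
  (forall x : R, x%:E < a -> x%:E <= b) -> a <= b.
Proof.
case: a => [r| |] h; last by rewrite leNye.
- apply/lee_subgt0Pr => e e0; rewrite -EFinB; apply: h.
  by rewrite lte_fin ltrBlDr ltrDl.
- rewrite (_ : b = +oo) ?lexx//; apply/eqyP => x _; apply: h; exact: ltry.
Qed.

Lemma limn_einf_ge (u : (\bar R)^nat) (a : \bar R) :
  (forall x : R, x%:E < a -> \forall n \near \oo, x%:E <= u n) ->
  a <= limn_einf u.
Proof.
move=> h; apply: lee_lt_fin => x /h[N _ xu].
rewrite limn_einf_lim (cvg_lim _ (@cvg_einfs_sup _ u))//.
apply: le_trans (ereal_sup_ubound (ex_intro2 _ _ N I erefl)).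
by apply: le_ereal_inf_tmp => _ [k Nk <-]; exact: xu.
Qed.

Lemma limn_einf_le_bound (u : (\bar R)^nat) (b : \bar R) :
  (forall n, u n <= b) -> limn_einf u <= b.
Proof.
move=> ub; rewrite limn_einf_lim (cvg_lim _ (@cvg_einfs_sup _ u))//.
apply: ge_ereal_sup => _ [n _ <-].
by apply: le_trans (ub n); apply: ereal_inf_lbound; exists n => /=.
Qed.

Lemma measurable_fun_limn_einf d (T : measurableType d) (D : set T)
    (f : (T -> \bar R)^nat) :
  (forall n, measurable_fun D (f n)) ->
  measurable_fun D (fun x => limn_einf (f ^~ x)).
Proof.
move=> mf; have mNf n : measurable_fun D (fun x => - f n x).
  by apply: measurableT_comp (mf n).
have mN := measurable_fun_limn_esup mNf.
exact: measurableT_comp mN.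
Qed.

(** Lower semicontinuity of the distribution function: the sets where all terms from index n on
    exceed l increase to a set containing {g > l}. *)
Lemma distr_near_lt (gn : nat -> lebesgueR R -> R) g l (a : \bar R) :
  (forall n, measurable_fun I11 (gn n)) -> measurable_fun I11 g ->
  (forall x, I11 x -> (l < g x)%R -> \forall n \near \oo, (l < gn n x)%R) ->
  a < distr g l -> \forall n \near \oo, a < distr (gn n) l.
Proof.
move=> mgn mg near_gn.
pose A n : set (lebesgueR R) := I11 `&` [set x | (l < gn n x)%R].
pose F n := \bigcap_(k in [set k | (n <= k)%N]) A k.
have mA n : measurable (A n) by exact: measurable_level.
have mF n : measurable (F n) by apply: bigcap_measurable => //; exists n => /=.
have ndF : nondecreasing_seq F.
  move=> n m nm; apply/subsetPset => x Fx k mk; apply: Fx => /=.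
  exact: leq_trans mk.
move=> ag; have aF : a < mu (\bigcup_n F n).
  apply: lt_le_trans ag _; apply: le_measure; rewrite ?inE.
  - exact: measurable_level.
  - exact: bigcupT_measurable.
  - move=> x [Ix lx]; have [N _ h] := near_gn x Ix lx.
    by exists N => // k Nk; split => //; exact: h.
have [N aN] := lt_measure_bigcup mF ndF aF.
exists N => // n Nn; apply: lt_le_trans aN _.
apply: le_measure; rewrite ?inE; [exact: mF|exact: mA|].
by move=> x /(_ n); apply.
Qed.

(** The condition on [gn] says that its lower limit is at least [g] wherever [g] is positive. It is
    vacuous where [g] is 0, so nothing has to be known about [gn] there. *)
Lemma wnrm_fatou (w : R -> R) (gn : nat -> lebesgueR R -> R) g (b : \bar R) :
  measurable_fun I02 w -> (forall t, I02 t -> (0 <= w t)%R) ->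
  (forall n, measurable_fun I11 (gn n)) -> measurable_fun I11 g ->
  (forall x l, I11 x -> (0 <= l)%R -> (l < g x)%R ->
     \forall n \near \oo, (l < gn n x)%R) ->
  (forall n, wnrm w (gn n) <= b) -> wnrm w g <= b.
Proof.
move=> mw w0 mgn mg near_gn nb.
have mwE : measurable_fun I02 (fun t => (w t)%:E) by exact/measurable_EFinP.
have mr n : measurable_fun I02 (fun t => rearr (gn n) t * (w t)%:E).
  by apply: emeasurable_funM => //; exact: measurable_rearr.
have r0 n t : I02 t -> 0 <= rearr (gn n) t * (w t)%:E.
  by move=> It; rewrite mule_ge0 ?rearr_ge0// lee_fin w0.
have I2 := @measurable_I02 R.
apply: le_trans (limn_einf_le_bound nb).
apply: le_trans (fatou mu I2 mr r0).
apply: ge0_le_integral; first exact: I2.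
- by move=> t It; rewrite mule_ge0 ?rearr_ge0// lee_fin w0.
- by apply: emeasurable_funM => //; exact: measurable_rearr.
- exact: measurable_fun_limn_einf mr.
move=> t It; apply: limn_einf_ge => x xr.
(* A negative [x] is trivially below; a nonnegative one, being below the product, forces [w t] to be
   positive, so that one can divide by it. *)
have [x0|x0] := ltP x 0%R.
  by apply: nearW => n; apply: le_trans (r0 n t It); rewrite lee_fin ltW.
have wt : (0 < w t)%R.
  rewrite lt_neqAle w0// andbT; apply/eqP => wt0.
  by move: xr; rewrite -wt0 mule0 lte_fin ltNge x0.
have xw : (x / w t)%:E < rearr g t.
  by rewrite -(@lte_pmul2r _ (w t)%:E) ?lte_fin// -EFinM divfK// gt_eqF.
have xw0 : (0 <= x / w t)%R by rewrite divr_ge0// ltW.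
have tn : \forall n \near \oo, t%:E < distr (gn n) (x / w t).
  apply: (@distr_near_lt _ g) => //; last by rewrite -rearr_gtP.
  by move=> y Iy; exact: near_gn.
near=> n.
have -> : x = (x / w t * w t)%R by rewrite divfK// gt_eqF.
rewrite EFinM lee_wpmul2r ?lee_fin ?(ltW wt)//.
apply: ltW; rewrite rearr_gtP//; near: n.
exact: tn.
Unshelve. all: by end_near. Qed.

End FatouRearrangement.

(** * Subadditivity of the weighted norms *)

Section TriangleRearrangement.
Variable R : realType.
Local Notation mu := (@completed_lebesgue_measure R).
Implicit Types (g h : lebesgueR R -> R) (l t : R).
Local Open Scope ereal_scope.

Definition initial_segment (J : set (lebesgueR R)) :=
  J `<=` I02 /\ forall s t, J t -> (0 < s)%R -> (s <= t)%R -> J s.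

(** Half of a variational formula: the integral of [rearr g] over an initial segment of length s is
    the minimum over c >= 0 of c s plus the integral of the positive part of g - c. *)
Lemma integral_rearr_le g (J : set (lebesgueR R)) c :
  measurable J -> J `<=` I02 -> measurable_fun I11 g -> (0 <= c)%R ->
  \int[mu]_(t in J) rearr g t <=
  c%:E * mu J + \int[mu]_(x in I11) excess c (g x)%:E.
Proof.
move=> mJ JI mg c0; have I2 := @measurable_I02 R.
have mr := measurable_rearr mg.
have mrJ : measurable_fun J (rearr g) by apply: measurable_funS mr.
have cE : 0 <= c%:E by rewrite lee_fin.
have me := measurable_excess mr c.
have meJ := measurable_excess mrJ c.
apply: (@le_trans _ _ (\int[mu]_(t in J) (cst c%:E t + excess c (rearr g t)))).
  apply: ge0_le_integral; first exact: mJ.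
  - by move=> t _; exact: rearr_ge0.
  - exact: mrJ.
  - by apply: emeasurable_funD meJ; exact: measurable_cst.
  - by move=> t _; exact: excess_le.
rewrite (@ge0_integralD _ _ _ mu J mJ (cst c%:E) (fun t => excess c (rearr g t))
  (fun t _ => cE) (measurable_cst _) (fun t _ => excess_ge0 _ _) meJ).
rewrite (integral_cst _ mJ) leeD2l// -(integral_excess_rearr mg c0).
exact: (@ge0_subset_integral _ _ _ mu _ _ mJ I2 _ me (fun t _ => excess_ge0 _ _) JI).
Qed.

(** The minimum is attained at c = [rearr g s], with s the right end of [J]: by monotonicity
    [rearr g] is at least c on [J] and at most c beyond it. Boundedness of [g] makes c finite. *)
Lemma integral_rearr_eq g (J : set (lebesgueR R)) :
  measurable J -> initial_segment J -> measurable_fun I11 g ->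
  (exists M : R, forall x, I11 x -> (g x <= M)%R) ->
  exists2 c, (0 <= c)%R & \int[mu]_(t in J) rearr g t =
  c%:E * mu J + \int[mu]_(x in I11) excess c (g x)%:E.
Proof.
move=> mJ [JI Jinit] mg [M gM]; have I2 := @measurable_I02 R.
have mr := measurable_rearr mg.
have mrJ : measurable_fun J (rearr g) by apply: measurable_funS mr.
have rfin t : (0 <= t)%R -> rearr g t <= `|M|%:E.
  move=> t0; apply: rearr_le => //; rewrite /distr (_ : _ `&` _ = set0).
    by rewrite measure0 lee_fin.
  apply/seteqP; split => // x [Ix]; have := gM x Ix; have := ler_norm M.
  by rewrite /= => h1 h2; rewrite ltNge (le_trans h2 h1).
suff [c [c0 cJ cJc]] : exists c, [/\ (0 <= c)%R, forall t, J t -> c%:E <= rearr g t &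
    forall t, I02 t -> ~ J t -> rearr g t <= c%:E].
  exists c => //; rewrite -(integral_excess_rearr mg c0).
  have me := measurable_excess mr c.
  have -> : \int[mu]_(t in I02) excess c (rearr g t) =
            \int[mu]_(t in J) excess c (rearr g t).
    rewrite [LHS]integral_mkcond [RHS]integral_mkcond; apply: eq_integral => t _.
    rewrite !patchE; case: ifPn => [/set_mem It|It]; case: ifPn => // Jt.
      by rewrite excess_eq0// cJc// => /mem_set; exact/negP.
    by move/negP: It; case; apply/mem_set/JI; exact: set_mem.
  transitivity (\int[mu]_(t in J) (cst c%:E t + excess c (rearr g t))).
    by apply: eq_integral => t /set_mem Jt; exact/excess_eq/cJ.
  have cE : 0 <= c%:E by rewrite lee_fin.
  rewrite (@ge0_integralD _ _ _ mu J mJ (cst c%:E) (fun t => excess c (rearr g t))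
    (fun t _ => cE) (measurable_cst _) (fun t _ => excess_ge0 _ _)
    (measurable_excess mrJ c)).
  by rewrite (integral_cst _ mJ).
(* For empty [J], a height above all values of [g] makes both sides 0. *)
have [J0|/set0P[t0 Jt0]] := eqVneq J set0.
  exists `|M|%R; split => //; first by move=> t; rewrite J0.
  by move=> t; rewrite /I02/= in_itv/= => /andP[/ltW/rfin].
pose s := sup J.
have Jub : has_ubound J.
  by exists 2%R => t /JI; rewrite /I02/= in_itv/= => /andP[_ /ltW].
have Jsup : has_sup J by split => //; exists t0.
have s0 : (0 <= s)%R.
  have := sup_upper_bound Jsup Jt0; rewrite -/s; apply: le_trans.
  by have := JI _ Jt0; rewrite /I02/= in_itv/= => /andP[/ltW].
have fs : rearr g s \is a fin_num.
  by rewrite ge0_fin_numE ?rearr_ge0// (le_lt_trans (rfin _ s0))// ltry.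
exists (fine (rearr g s)); rewrite fineK//; split.
- by rewrite fine_ge0// rearr_ge0.
- by move=> t Jt; apply: rearr_anti; exact: sup_upper_bound.
- move=> t It nJt; apply: rearr_anti; rewrite leNgt; apply/negP => ts.
  have st0 : (0 < s - t)%R by rewrite subr_gt0.
  have [t1 Jt1 tt1] := sup_adherent st0 Jsup.
  apply: nJt; apply: (Jinit _ _ Jt1).
    by move: It; rewrite /I02/= in_itv/= => /andP[].
  by move: tt1; rewrite -/s subKr => /ltW.
Qed.

Lemma excessD c1 c2 (x1 x2 : R) : excess (c1 + c2) (x1 + x2)%:E <=
  excess c1 x1%:E + excess c2 x2%:E.
Proof.
rewrite /excess -!EFinB -[0]/(0%:E) -!EFin_max -EFinD lee_fin.
rewrite ge_max; apply/andP; split; last by rewrite addr_ge0// le_max lexx orbT.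
by rewrite opprD addrACA lerD// le_max lexx.
Qed.

(** The sum of the heights that are optimal for [g] and for [h] is admissible, though perhaps not
    optimal, for their sum. *)
Lemma integral_rearrD g h (J : set (lebesgueR R)) :
  measurable J -> initial_segment J ->
  measurable_fun I11 g -> measurable_fun I11 h ->
  (exists M : R, forall x, I11 x -> (g x <= M)%R) ->
  (exists M : R, forall x, I11 x -> (h x <= M)%R) ->
  \int[mu]_(t in J) rearr (fun x => g x + h x)%R t <=
  \int[mu]_(t in J) rearr g t + \int[mu]_(t in J) rearr h t.
Proof.
move=> mJ iJ mg mh bg bh.
have [c1 c10 ->] := integral_rearr_eq mJ iJ mg bg.
have [c2 c20 ->] := integral_rearr_eq mJ iJ mh bh.
have mgh : measurable_fun I11 (fun x => g x + h x)%R by exact: measurable_funD.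
apply: (le_trans (integral_rearr_le mJ iJ.1 mgh (addr_ge0 c10 c20))).
rewrite addeACA leeD//.
  by rewrite EFinD ge0_muleDl.
have me (k : lebesgueR R -> R) c : measurable_fun I11 k ->
    measurable_fun I11 (fun x => excess c (k x)%:E).
  by move=> mk; apply: measurable_excess; exact/measurable_EFinP.
have I1 := @measurable_I11 R.
rewrite -(@ge0_integralD _ _ _ mu I11 I1 (fun x => excess c1 (g x)%:E)
  (fun x => excess c2 (h x)%:E) (fun t _ => excess_ge0 _ _) (me g c1 mg)
  (fun t _ => excess_ge0 _ _) (me h c2 mh)).
apply: ge0_le_integral; first exact: I1.
- by move=> x _; exact: excess_ge0.
- exact: me _ (c1 + c2)%R mgh.
- exact: emeasurable_funD (me g c1 mg) (me h c2 mh).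
- by move=> x _; exact: excessD.
Qed.

Section weight.
Variable w : R -> R.
Hypothesis mw : measurable_fun I02 w.
Hypothesis w0 : forall t, I02 t -> (0 <= w t)%R.
Hypothesis wanti : forall s t, I02 s -> I02 t -> (s <= t)%R -> (w t <= w s)%R.

Let J (tau : R) : set (lebesgueR R) := I02 `&` [set t | tau%:E < (w t)%:E].

Let mJ tau : measurable (J tau).
Proof.
apply: measurable_lte; first exact: measurable_I02.
  exact: measurable_cst.
exact/measurable_EFinP.
Qed.

Let iJ tau : initial_segment (J tau).
Proof.
split; first exact: subIsetl.
move=> s t [It /= tw] s0 st.
have Is : I02 s.
  move: It; rewrite /I02/= !in_itv/= => /andP[_ t2].
  by rewrite s0/= (le_lt_trans st).
by split => //=; apply: lt_le_trans tw _; rewrite lee_fin wanti.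
Qed.

(** As [w] is nonincreasing, its superlevel sets [J tau] are initial segments: the norm is a
    superposition of the functionals in [integral_rearrD] and inherits their subadditivity. *)
Lemma wnrm_weight_layer g : measurable_fun I11 g ->
  wnrm w g = \int[@lebesgue_measure R]_(tau in `[0%R, +oo[)
    \int[mu]_(t in J tau) rearr g t.
Proof.
move=> mg; rewrite -(@layer_cake_weighted _ _ _ mu I02 (@measurable_I02 R)
  (fun t => (w t)%:E)).
- apply: eq_integral => t /set_mem It.
  by rewrite excess0 1?muleC// lee_fin w0.
- exact/measurable_EFinP.
- exact: measurable_rearr.
- by move=> t _; exact: rearr_ge0.
Qed.

Lemma wnrmD g h : measurable_fun I11 g -> measurable_fun I11 h ->
  (exists M : R, forall x, I11 x -> (g x <= M)%R) ->
  (exists M : R, forall x, I11 x -> (h x <= M)%R) ->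
  wnrm w (fun x => g x + h x)%R <= wnrm w g + wnrm w h.
Proof.
move=> mg mh bg bh.
have mgh : measurable_fun I11 (fun x => g x + h x)%R by exact: measurable_funD.
rewrite !wnrm_weight_layer//.
have m0 k : measurable_fun I11 k -> measurable_fun
    (`[0%R, +oo[%classic : set (measurableTypeR R))
    (fun tau => \int[mu]_(t in J tau) rearr k t).
  move=> mk; apply: (@measurable_layer _ _ _ mu I02 (@measurable_I02 R)
    (fun t => (w t)%:E)).
  - exact/measurable_EFinP.
  - exact: measurable_rearr.
  - by move=> t _; exact: rearr_ge0.
have i0 k (tau : R) : 0 <= \int[mu]_(t in J tau) rearr k t.
  by apply: integral_ge0 => t _; exact: rearr_ge0.
have mI : measurable (`[0%R, +oo[%classic : set (measurableTypeR R)).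
  exact: measurable_itv.
rewrite -(@ge0_integralD _ _ _ (@lebesgue_measure R) _ mI
  (fun tau => \int[mu]_(t in J tau) rearr g t)
  (fun tau => \int[mu]_(t in J tau) rearr h t)
  (fun tau _ => i0 g tau) (m0 g mg) (fun tau _ => i0 h tau) (m0 h mh)).
apply: ge0_le_integral; first exact: mI.
- by move=> tau _; exact: i0.
- exact: m0.
- by apply: emeasurable_funD; exact: m0.
- by move=> tau _; exact: integral_rearrD.
Qed.

End weight.
End TriangleRearrangement.

(** * Logarithmic weights *)

Section LogWeight.
Variable R : realType.
Local Notation mu := (@completed_lebesgue_measure R).
Local Notation leb := (@lebesgue_measure R).
Implicit Types a b s t : R.

(** The identity from the completed to the Borel line pushes [mu] forward to Lebesgue measure. This
    gives access to the fundamental theorem of calculus for explicit integrands. *)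
Lemma integral_completed (D : set R) (f : R -> \bar R) :
  measurable (D : set (measurableTypeR R)) ->
  measurable_fun (D : set (measurableTypeR R)) f ->
  (forall x, D x -> 0 <= f x)%E ->
  (\int[mu]_(x in D) f x = \int[leb]_(x in D) f x)%E.
Proof.
move=> mD mf f0.
have f0' : {in D, forall y, 0 <= f y}%E by move=> y /set_mem; exact: f0.
rewrite -[LHS](@ge0_integral_pushforward _ _ _ _ _ _ (@measurable_id_lebesgueR R)
  mu D f mD mf f0').
apply: eq_measure_integral => [|mid A mA _]; first exact: measurable_id_lebesgueR.
reflexivity.
Qed.

Definition logw (a t : R) : R := ln (2 * expR 1 / t) `^ a.

Lemma LlogL_normE a (f : lebesgueR R -> R[i]) :
  LlogL_norm a f = wnrm (logw a) (fun x => Normc.normc (f x)).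
Proof. reflexivity. Qed.

Lemma ln_ge1 (t : R) : 0 < t -> t <= 2 -> 1 <= ln (2 * expR 1 / t).
Proof.
move=> t0 t2; have e0 : 0 < expR 1 :> R by exact: expR_gt0.
rewrite -[leLHS](expRK 1) ler_ln ?posrE//; last by rewrite divr_gt0// mulr_gt0.
by rewrite ler_pdivlMr// mulrC ler_wpM2r// ltW.
Qed.

Lemma ln_anti (s t : R) : 0 < s -> s <= t -> ln (2 * expR 1 / t) <= ln (2 * expR 1 / s).
Proof.
move=> s0 st; have e0 : 0 < expR 1 :> R by exact: expR_gt0.
have t0 : 0 < t by lra.
rewrite ler_ln ?posrE ?divr_gt0 ?mulr_gt0//.
by rewrite ler_wpM2l ?lef_pV2 ?posrE// mulr_ge0// ltW.
Qed.

Lemma logw_ge0 a t : 0 <= logw a t.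
Proof. exact: powR_ge0. Qed.

Lemma logw_anti a (s t : R) : 0 <= a -> 0 < s -> s <= t -> t <= 2 ->
  logw a t <= logw a s.
Proof.
move=> a0 s0 st t2; have t0 : 0 < t by lra.
have h1 := ln_ge1 t0 t2; have h2 := ln_anti s0 st.
by apply: ge0_ler_powR => //; rewrite nnegrE; lra.
Qed.

Lemma logwS b t : 0 < t -> t <= 2 ->
  logw (1 + b) t = ln (2 * expR 1 / t) * logw b t.
Proof.
move=> t0 t2; have h1 := ln_ge1 t0 t2.
rewrite /logw powRD ?powRr1//; first lra.
by apply/implyP => _; rewrite gt_eqF//; lra.
Qed.

Lemma logw_ge1 a t : 0 <= a -> 0 < t -> t <= 2 -> 1 <= logw a t.
Proof.
move=> a0 t0 t2; rewrite -[leLHS]/((fun=> 1) a) -powR1; apply: ge0_ler_powR => //.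
- by rewrite nnegrE.
- by rewrite nnegrE (le_trans _ (ln_ge1 t0 t2)).
- exact: ln_ge1.
Qed.

Lemma measurable_logw a : measurable_fun
  (`]0, 2[%classic : set (measurableTypeR R)) (logw a).
Proof.
apply: (@eq_measurable_fun _ _ _ _ _
  (fun t => (ln (2 * expR 1) - ln t) `^ a)).
  move=> t; rewrite inE/= in_itv/= => /andP[t0 _].
  by rewrite /logw ln_div// posrE mulr_gt0// expR_gt0.
apply: measurable_funTS; apply: (measurableT_comp (measurable_powR a)).
by apply: measurable_funB => //; exact: measurable_ln.
Qed.

Lemma measurable_logw_I02 a : measurable_fun (@I02 R) (logw a).
Proof.
move=> mI Y mY; apply: measurable_lebesgueR; exact: (measurable_logw a).
Qed.

End LogWeight.

(** * From weak-type bounds to the logarithmic norm *)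

Section RestrictedBound.
Variable R : realType.
Local Notation mu := (@completed_lebesgue_measure R).
Local Notation leb := (@lebesgue_measure R).
Implicit Types a b c m s t K : R.

(** The fundamental theorem is applied only away from 0, where the integrand may blow up; monotone
    convergence does the rest. *)
Lemma integral_oo_le_segments (f : R -> \bar R) (m : R) (B : \bar R) : 0 < m ->
  measurable_fun (`]0, m[%classic : set (measurableTypeR R)) f ->
  (forall t, 0 < t -> (0 <= f t)%E) ->
  (forall a, 0 < a -> a < m -> (\int[leb]_(t in `[a, m[) f t <= B)%E) ->
  (\int[leb]_(t in `]0%R, m[) f t <= B)%E.
Proof.
move=> m0 mf f0 fB.
(* The shift by 2 keeps [a n] strictly below [m], already at n = 0. *)
pose a n : R := m * n.+2%:R^-1.
have a0 n : 0 < a n by rewrite mulr_gt0.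
have am n : a n < m by rewrite gtr_pMr// invf_lt1// ltr1n.
pose F n : set (measurableTypeR R) := `[a n, m[%classic.
have FU : \bigcup_n F n = `]0, m[%classic.
  apply/seteqP; split => [t [n _]|t]; rewrite /F/= !in_itv/= => /andP[h tm].
    by rewrite (lt_le_trans (a0 n) h) tm.
  have /ltr_add_invr[n] : 0 < t / m by rewrite divr_gt0.
  rewrite add0r => hn; exists n => //=; rewrite in_itv/= tm andbT.
  have -> : t = m * (t / m) by field; rewrite gt_eqF.
  rewrite ler_pM2l//; apply: le_trans (ltW hn).
  by rewrite lef_pV2 ?posrE// ler_nat.
have mF n : measurable (F n) by exact: measurable_itv.
have Fsub n : F n `<=` `]0, m[%classic by rewrite -FU; exact: bigcup_sup.
have ndF : nondecreasing_seq F.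
  move=> n k nk; apply/subsetPset => t; rewrite /F/= !in_itv/= => /andP[h ->].
  rewrite andbT; apply: le_trans h.
  by rewrite ler_pM2l// lef_pV2 ?posrE// ler_nat ltnS ltnS.
have mfF n : measurable_fun (F n) f by exact: measurable_funS mf.
have fF n t : F n t -> (0 <= f t)%E.
  by rewrite /F/= in_itv/= => /andP[/(lt_le_trans (a0 n))/f0].
have h := @ge0_nondecreasing_set_cvg_integral _ _ _ F f leb ndF mF mfF fF.
rewrite FU in h; rewrite -(cvg_lim _ h)//.
apply: lime_le; first by apply/cvg_ex; eexists; exact: h.
by apply: nearW => n; exact: fB.
Qed.

Lemma is_derive_root (t : R) : 0 < t ->
  is_derive t 1 (fun t => 4 * t `^ (1 / 4)) (t `^ (- (3 / 4))).
Proof.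
move=> t0; have h := @is_derive1_powR R (1 / 4) t t0.
apply: (is_derive_eq (@is_deriveZ _ _ _ (fun t => t `^ (1 / 4)) 4 t 1 _ h)).
have -> : 1 / 4 - 1 = - (3 / 4) :> R by field.
by rewrite /GRing.scale/=; field.
Qed.

Lemma integral_derive_le (f F : R -> R) (a c B : R) : 0 < a -> a < c ->
  (forall t, 0 < t -> is_derive t 1 F (f t)) ->
  (forall t, 0 < t -> {for t, continuous f}) -> F c - F a <= B ->
  (\int[leb]_(t in `[a, c[) (f t)%:E <= B%:E)%E.
Proof.
move=> a0 ac dF cf FB.
have cF t : 0 < t -> {for t, continuous F}.
  move=> t0; apply/differentiable_continuous/derivable1_diffP.
  exact: (@ex_derive _ _ _ _ _ _ _ (dF t t0)).
have cfw : {within `[a, c], continuous f}.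
  apply: continuous_in_subspaceT => t; rewrite inE/= in_itv/= => /andP[ta _].
  by apply: cf; lra.
have mf : measurable_fun (`[a, c[%classic : set (measurableTypeR R)) f.
  apply: (@measurable_funS _ _ _ _ (`[a, c]%classic : set (measurableTypeR R))).
  - exact: measurable_itv.
  - by apply: subset_itvl; rewrite bnd_simp.
  - by apply: subspace_continuous_measurable_fun => //; exact: measurable_itv.
rewrite integral_itv_bndo_bndc; last exact/measurable_EFinP.
rewrite (@continuous_FTC2 _ f F)//.
- split.
  + by move=> t; rewrite in_itv/= => /andP[ta _];
      apply: (@ex_derive _ _ _ _ _ _ _ (dF t _)); lra.
  + by apply: cvg_at_right_filter; exact: cF.
  + by apply: cvg_at_left_filter; apply: cF; lra.
- move=> t; rewrite in_itv/= => /andP[ta _].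
  have t0 : 0 < t by lra.
  by rewrite derive1E; have [_ ->] := dF t t0.
Qed.

Lemma continuous_inv_pos (t : R) : 0 < t -> {for t, continuous (@GRing.inv R)}.
Proof. by move=> t0; apply: inv_continuous; rewrite gt_eqF. Qed.

Lemma continuous_powR_pos (r t : R) : 0 < t -> {for t, continuous (fun t => t `^ r)}.
Proof.
move=> t0; apply/differentiable_continuous/derivable1_diffP.
exact: (@ex_derive _ _ _ _ _ _ _ (@is_derive1_powR R r t t0)).
Qed.

Lemma integral_root_le (m : R) : 0 < m ->
  (\int[leb]_(t in `]0%R, m[) (t `^ (- (3 / 4)))%:E <= (4 * m `^ (1 / 4))%:E)%E.
Proof.
move=> m0; apply: integral_oo_le_segments => //.
- apply/measurable_EFinP; apply: measurable_funTS; exact: measurable_powR.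
- by move=> t t0; rewrite lee_fin powR_ge0.
move=> a a0 am.
apply: (@integral_derive_le (fun t => t `^ (- (3 / 4)))
  (fun t => 4 * t `^ (1 / 4))); [by []|by []|..].
- exact: is_derive_root.
- exact: continuous_powR_pos.
- by rewrite gerBl// mulr_ge0// powR_ge0.
Qed.

Lemma integral_inv_le (m : R) : 0 < m -> m <= 2 ->
  (\int[leb]_(t in `[m, 2%R[) (t^-1)%:E <= (ln (2 / m))%:E)%E.
Proof.
move=> m0; rewrite le_eqVlt => /predU1P[->|m2].
  by rewrite set_itv_ge ?bnd_simp ?ltxx// integral_set0 lee_fin ln_ge0// divff.
apply: (@integral_derive_le (@GRing.inv R) (@ln R)); [by []|by []|..].
- exact: continuous_inv_pos.
- by rewrite ln_div ?posrE.
Qed.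

(** exp (p ln u) >= 1 + p ln u >= p (1 + ln u). *)
Lemma ln_le_powR (p u : R) : 0 < p -> p <= 1 -> 1 <= u -> 1 + ln u <= u `^ p / p.
Proof.
move=> p0 p1 u1; have u0 : 0 < u by lra.
rewrite ler_pdivlMr// /powR gt_eqF//.
have := expR_ge1Dx (p * ln u); lra.
Qed.

(** Since the logarithm at [m] is at least 1, the one at [t] is at most that at [m] times 1 + ln (m
    / t). The power b of the second factor is absorbed by a quarter power of m / t, which stays
    integrable when multiplied by the square root coming from the quadratic weak bound. *)
Lemma logw_le_root b m t : 0 <= b -> 0 < t -> t <= m -> m <= 2 ->
  logw b t <= (4 * (b + 1)) `^ (b + 1) * (m / t) `^ (1 / 4) * logw b m.
Proof.
move=> b0 t0 tm m2; have m0 : 0 < m by lra.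
(* Chosen so that the exponent p (b + 1) of m / t is 1 / 4; using b + 1 in place of b keeps the
   denominator positive at b = 0. *)
pose p : R := (4 * (b + 1))^-1.
have b1 : 0 < 4 * (b + 1) by lra.
have p0 : 0 < p by rewrite invr_gt0.
have p1 : p <= 1 by rewrite invf_le1//; lra.
have u1 : 1 <= m / t by rewrite ler_pdivlMr// mul1r.
have u0 : 0 < m / t by lra.
have Lm := ln_ge1 m0 m2.
have e0 : 0 < expR 1 :> R by exact: expR_gt0.
have -> : logw b t = (ln (2 * expR 1 / m) + ln (m / t)) `^ b.
  rewrite /logw -lnM ?posrE ?divr_gt0 ?mulr_gt0//; congr (ln _ `^ b).
  by field; rewrite !gt_eqF.
have lnu0 : 0 <= ln (m / t) by exact: ln_ge0.
have le1 : ln (2 * expR 1 / m) + ln (m / t) <=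
    ln (2 * expR 1 / m) * (1 + ln (m / t)).
  by rewrite mulrDr mulr1 lerD2l ler_peMl.
apply: (@le_trans _ _ ((ln (2 * expR 1 / m) * (1 + ln (m / t))) `^ b)).
  by apply: ge0_ler_powR => //; rewrite nnegrE; [lra|rewrite mulr_ge0//; lra].
rewrite powRM ?addr_ge0//; last lra.
rewrite [leLHS]mulrC ler_wpM2r// ?powR_ge0//.
apply: (@le_trans _ _ ((1 + ln (m / t)) `^ (b + 1))).
  by apply: ler_powR; lra.
apply: (@le_trans _ _ (((m / t) `^ p / p) `^ (b + 1))).
  apply: ge0_ler_powR; rewrite ?nnegrE; [lra|lra| |exact: ln_le_powR].
  by rewrite divr_ge0 ?powR_ge0// ltW.
have pV0 : 0 <= p^-1 by rewrite invr_ge0 ltW.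
rewrite (@powRM _ ((m / t) `^ p) p^-1 (b + 1) (powR_ge0 _ _) pV0).
rewrite -powRrM /p invrK.
have -> : (4 * (b + 1))^-1 * (b + 1) = 1 / 4 by field; rewrite gt_eqF//; lra.
by rewrite mulrC.
Qed.

Lemma wmass_ge a m : 0 <= a -> 0 < m -> m <= 2 ->
  ((m * logw a m)%:E <= wmass (logw a) m%:E)%E.
Proof.
move=> a0 m0 m2; rewrite /wmass; set D := (_ `&` _).
have mD : measurable D by apply: measurableI; [exact: measurable_I02|exact: measurable_ray].
have mw : measurable_fun D (fun t => (logw a t)%:E).
  apply/measurable_EFinP; apply: measurable_funS (measurable_logw_I02 a).
    exact: measurable_I02.
  exact: subIsetl.
have muD : mu D = m%:E by rewrite measure_I02_ray// lee_fin// ltW.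
have -> : (m * logw a m)%:E = (\int[mu]_(t in D) (cst (logw a m)%:E t))%E.
  by rewrite (integral_cst _ mD) EFinM muleC; congr (_ * _)%E; rewrite -muD.
apply: ge0_le_integral; first exact: mD.
- by move=> t _; rewrite lee_fin logw_ge0.
- exact: measurable_cst.
- exact: mw.
- move=> t [It /= tm]; rewrite lee_fin; move: It tm.
  rewrite /I02/= in_itv/= lte_fin => /andP[t0 _] tm.
  by apply: logw_anti => //; exact: ltW.
Qed.

Lemma rearr_le_inv K m (g : lebesgueR R -> R) t : 0 < K -> 0 <= m -> 0 < t ->
  (forall l, 0 < l -> (distr g l <= (K * m / l)%:E)%E) ->
  (rearr g t <= (K * m / t)%:E)%E.
Proof.
(* The hypothesis speaks of positive levels only, and K m / t is 0 when m is: hence the margin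
   [e]. *)
move=> K0 m0 t0 gK; apply/lee_addgt0Pr => e e0; rewrite -EFinD.
have Kmt : 0 <= K * m / t by rewrite divr_ge0 ?mulr_ge0// ltW.
apply: rearr_le; first lra.
apply: (le_trans (gK _ _)); first lra.
rewrite lee_fin ler_pdivrMr; last lra.
have -> : t * (K * m / t + e) = K * m + t * e by field; rewrite gt_eqF.
by rewrite lerDl mulr_ge0// ltW.
Qed.

(** For t <= m the level K (m / t)^(1/2) is at least [K], the range where the quadratic bound is
    available. *)
Lemma rearr_le_root K m (g : lebesgueR R -> R) t : 0 < K -> 0 < t -> t <= m ->
  (forall l, K <= l -> (distr g l <= (K ^+ 2 * m / l ^+ 2)%:E)%E) ->
  (rearr g t <= (K * (m / t) `^ (1 / 2))%:E)%E.
Proof.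
move=> K0 t0 tm gK; have u1 : 1 <= m / t by rewrite ler_pdivlMr// mul1r.
have r1 : 1 <= (m / t) `^ (1 / 2) by rewrite -[leLHS](powRr0 (m / t)) ler_powR.
have r2 : ((m / t) `^ (1 / 2)) ^+ 2 = m / t.
  by rewrite -powR_mulrn ?powR_ge0// -powRrM divfK// powRr1//; lra.
have m0 : 0 < m by lra.
apply: rearr_le; first by rewrite mulr_ge0 ?powR_ge0// ltW.
apply: (le_trans (gK _ _)); first by rewrite ler_pMr.
rewrite lee_fin exprMn r2.
have -> : K ^+ 2 * m / (K ^+ 2 * (m / t)) = t by field; rewrite !gt_eqF.
by [].
Qed.

(** Split at t = m. Below m, the square root bound and the quarter power from the weight combine to
    (m / t)^(3/4), of integral 4 m. Above m, K m / t with the weight frozen at its value at m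
    integrates to a logarithm: this is what raises the exponent from b to 1 + b. *)
Lemma wnrm_restricted b K m (g : lebesgueR R -> R) : 0 <= b -> 0 < K ->
  0 <= m -> m <= 2 -> measurable_fun I11 g ->
  (forall l, 0 < l -> (distr g l <= (K * m / l)%:E)%E) ->
  (forall l, K <= l -> (distr g l <= (K ^+ 2 * m / l ^+ 2)%:E)%E) ->
  (wnrm (logw b) g <=
    (K * (1 + 4 * (4 * (b + 1)) `^ (b + 1)))%:E * wmass (logw (1 + b)) m%:E)%E.
Proof.
move=> b0 K0 + m2 mg g1 g2; rewrite le_eqVlt => /predU1P[m0|m0].
  (* For m = 0 the first weak bound makes [rearr g] vanish on ]0, 2[. *)
  rewrite /wnrm integral0_eq.
    apply: mule_ge0; last by apply: integral_ge0 => t _; rewrite lee_fin logw_ge0.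
    by rewrite lee_fin mulr_ge0 ?(ltW K0)// addr_ge0// mulr_ge0// powR_ge0.
  move=> t; rewrite /I02/= in_itv/= => /andP[t0 _].
  have mm : 0 <= m by rewrite -m0.
  have := rearr_le_inv K0 mm t0 g1; rewrite -m0 mulr0 mul0r => r0.
  have -> : (rearr g t = 0)%E by apply/eqP; rewrite eq_le r0 rearr_ge0.
  by rewrite mul0e.
have b1 : 0 <= 1 + b by lra.
apply: (@le_trans _ _ ((K * (1 + 4 * (4 * (b + 1)) `^ (b + 1)))%:E *
  (m * logw (1 + b) m)%:E)%E); last first.
  rewrite lee_wpmul2l ?wmass_ge// lee_fin mulr_ge0 ?(ltW K0)// addr_ge0//.
  by rewrite mulr_ge0// powR_ge0.
pose kap : R := (4 * (b + 1)) `^ (b + 1).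
have kap0 : 0 <= kap by exact: powR_ge0.
have w0 : 0 <= logw b m by exact: logw_ge0.
pose A : set (lebesgueR R) := `]0, m[%classic.
pose B : set (lebesgueR R) := `[m, 2[%classic.
have mA : measurable A by apply: measurable_lebesgueR; exact: measurable_itv.
have mB : measurable B by apply: measurable_lebesgueR; exact: measurable_itv.
have bA : measurable (A : set (measurableTypeR R)) by exact: measurable_itv.
have bB : measurable (B : set (measurableTypeR R)) by exact: measurable_itv.
have IAB : @I02 R = A `|` B.
  apply/seteqP; split => t; rewrite /I02 /A /B/= !in_itv/=.
    by move=> /andP[-> t2]; case: (ltP t m) => mt; [left|right].
  by move=> [/andP[-> /lt_le_trans]|/andP[/(lt_le_trans m0) ->]//]; apply.
pose phi (t : lebesgueR R) := (rearr g t * (logw b t)%:E)%E.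
have mphi : measurable_fun (@I02 R) phi.
  apply: emeasurable_funM; first exact: measurable_rearr.
  by apply/measurable_EFinP; exact: measurable_logw_I02.
have phi0 t : (0 <= phi t)%E by rewrite mule_ge0 ?rearr_ge0// lee_fin logw_ge0.
have mphiA : measurable_fun A phi.
  by apply: measurable_funS mphi; [exact: measurable_I02|rewrite IAB; exact: subsetUl].
have mphiB : measurable_fun B phi.
  by apply: measurable_funS mphi; [exact: measurable_I02|rewrite IAB; exact: subsetUr].
have -> : wnrm (logw b) g = (\int[mu]_(t in A) phi t + \int[mu]_(t in B) phi t)%E.
  have dAB : [disjoint A & B].
    apply/disj_setPLR => t; rewrite /A /B /= !in_itv/= => /andP[_ tm].
    by apply/negP; rewrite negb_and -ltNge tm.
  have mphiU : measurable_fun (A `|` B) phi by rewrite -IAB.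
  rewrite /wnrm IAB; exact: (@ge0_integral_setU _ _ _ mu A B mA mB phi mphiU
    (fun t _ => phi0 t) dAB).
have h1 : (\int[mu]_(t in A) phi t <= (K * kap * 4 * m * logw b m)%:E)%E.
  pose c := K * kap * m `^ (3 / 4) * logw b m.
  have c0 : 0 <= c by rewrite !mulr_ge0 ?powR_ge0// ltW.
  have mroot D : measurable_fun (D : set (measurableTypeR R))
      (fun t => (c * t `^ (- (3 / 4)))%:E).
    apply/measurable_EFinP; apply: measurable_funTS.
    by apply: measurable_funM => //; exact: measurable_powR.
  apply: (@le_trans _ _ (\int[mu]_(t in A) (c * t `^ (- (3 / 4)))%:E)%E).
    apply: ge0_le_integral; first exact: mA.
    - by move=> t _; exact: phi0.
    - exact: mphiA.
    - move=> _ Y mY; apply: measurable_lebesgueR.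
      by apply: mroot => //; exact: measurable_itv.
    move=> t; rewrite /A/= in_itv/= => /andP[t0 tm].
    have tm' := ltW tm.
    have h := rearr_le_root K0 t0 tm' g2.
    have w1 : (0 <= (logw b t)%:E)%E by rewrite lee_fin logw_ge0.
    have w2 := logw_le_root b0 t0 tm' m2; rewrite -lee_fin in w2.
    apply: (le_trans (lee_pmul (rearr_ge0 _ _) w1 h w2)).
    rewrite -EFinM lee_fin /c -/kap.
    have u0 : 0 < m / t by rewrite divr_gt0.
    have -> : K * (m / t) `^ (1 / 2) * (kap * (m / t) `^ (1 / 4) * logw b m) =
      K * kap * logw b m * ((m / t) `^ (1 / 2) * (m / t) `^ (1 / 4)) by ring.
    rewrite -powRD; last by apply/implyP => _; rewrite gt_eqF.
    have -> : 1 / 2 + 1 / 4 = 3 / 4 :> R by field.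
    rewrite powRM ?invr_ge0 ?(ltW m0) ?(ltW t0)//.
    rewrite -(powR_inv1 (ltW t0)) -powRrM mulN1r.
    by rewrite le_eqVlt; apply/orP; left; apply/eqP; ring.
  rewrite integral_completed; first last.
  - by move=> t _; rewrite lee_fin mulr_ge0// powR_ge0.
  - exact: mroot.
  - exact: measurable_itv.
  under eq_integral do rewrite EFinM.
  rewrite ge0_integralZl//; first last.
  - by move=> t _; rewrite lee_fin powR_ge0.
  - apply/measurable_EFinP; apply: measurable_funTS; exact: measurable_powR.
  apply: (le_trans (lee_wpmul2l _ (integral_root_le m0))); first by rewrite lee_fin.
  rewrite -EFinM lee_fin /c.
  have e : m `^ (3 / 4) * m `^ (1 / 4) = m.
    rewrite -powRD; last by apply/implyP => _; rewrite gt_eqF.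
    have -> : 3 / 4 + 1 / 4 = 1 :> R by field.
    by rewrite powRr1// ltW.
  have -> : K * kap * m `^ (3 / 4) * logw b m * (4 * m `^ (1 / 4)) =
    K * kap * 4 * (m `^ (3 / 4) * m `^ (1 / 4)) * logw b m by ring.
  by rewrite e.
have h2 : (\int[mu]_(t in B) phi t <= (K * m * logw (1 + b) m)%:E)%E.
  pose c := K * m * logw b m.
  have c0 : 0 <= c by rewrite !mulr_ge0// ltW.
  have minv : measurable_fun (`[m, 2[%classic : set (measurableTypeR R))
      (fun t => (t^-1)%:E).
    apply/measurable_EFinP.
    apply: (@measurable_funS _ _ _ _ (`]0, +oo[%classic : set (measurableTypeR R))).
    - exact: measurable_itv.
    - by move=> t /=; rewrite !in_itv/= andbT => /andP[/(lt_le_trans m0)].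
    - apply: open_continuous_measurable_fun; first exact: interval_open.
      by move=> t; rewrite inE/= in_itv/= andbT; exact: continuous_inv_pos.
  have mcinv : measurable_fun (`[m, 2[%classic : set (measurableTypeR R))
      (fun t => (c * t^-1)%:E).
    apply/measurable_EFinP; apply: measurable_funM => //.
    exact/measurable_EFinP.
  apply: (@le_trans _ _ (\int[mu]_(t in B) (c * t^-1)%:E)%E).
    apply: ge0_le_integral; first exact: mB.
    - by move=> t _; exact: phi0.
    - exact: mphiB.
    - move=> _ Y mY; apply: measurable_lebesgueR.
      by apply: mcinv => //; exact: measurable_itv.
    move=> t; rewrite /B/= in_itv/= => /andP[mt t2].
    have t0 : 0 < t by exact: lt_le_trans mt.
    have w1 : (0 <= (logw b t)%:E)%E by rewrite lee_fin logw_ge0.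
    have w2 : ((logw b t)%:E <= (logw b m)%:E)%E by rewrite lee_fin logw_anti// ltW.
    apply: (le_trans (lee_pmul (rearr_ge0 _ _) w1 (rearr_le_inv K0 (ltW m0) t0 g1) w2)).
    rewrite -EFinM lee_fin /c.
    by rewrite le_eqVlt; apply/orP; left; apply/eqP; ring.
  rewrite integral_completed; first last.
  - move=> t; rewrite /B/= in_itv/= => /andP[mt _].
    by rewrite lee_fin mulr_ge0// invr_ge0 (le_trans (ltW m0)).
  - exact: mcinv.
  - exact: measurable_itv.
  under eq_integral do rewrite EFinM.
  have nn t : B t -> (0 <= (t^-1)%:E)%E.
    rewrite /B/= in_itv/= => /andP[mt _].
    by rewrite lee_fin invr_ge0 (le_trans (ltW m0)).
  have cE : (0 <= c%:E)%E by rewrite lee_fin.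
  rewrite (@ge0_integralZl _ _ _ leb _ bB _ minv _ nn cE).
  apply: (le_trans (lee_wpmul2l _ (integral_inv_le m0 m2))); first by rewrite lee_fin.
  rewrite -EFinM lee_fin /c logwS//.
  rewrite [ln _ * logw b m]mulrC mulrA ler_wpM2l//.
  rewrite ler_ln ?posrE ?divr_gt0 ?mulr_gt0 ?expR_gt0//.
  rewrite ler_wpM2r ?invr_ge0 ?(ltW m0)// ler_peMr//.
  by rewrite -expR0 ler_expR.
apply: (le_trans (leeD h1 h2)); rewrite -EFinD -EFinM lee_fin -/kap.
(* The part below m carries only the exponent b; one more logarithm, at least 1, is inserted. *)
rewrite logwS//.
have L1 := ln_ge1 m0 m2.
have : 0 <= K * kap * 4 * m * logw b m * (ln (2 * expR 1 / m) - 1).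
  by rewrite !mulr_ge0//; lra.
lra.
Qed.

End RestrictedBound.

Section ConjLogNorm.
Variable R : realType.
Local Notation mu := (@completed_lebesgue_measure R).
Local Notation leb := (@lebesgue_measure R).
Implicit Types (g h : lebesgueR R -> R) (E : set (lebesgueR R)).

Lemma wnrmZ (w : R -> R) (a : R) g : 0 < a ->
  measurable_fun I02 w -> (forall t, I02 t -> 0 <= w t) ->
  measurable_fun I11 g ->
  (wnrm w (fun x => a * g x)%R <= a%:E * wnrm w g)%E.
Proof.
move=> a0 mw w0 mg; have I2 := @measurable_I02 R.
have mag : measurable_fun I11 (fun x => a * g x) by exact: measurable_funM.
have mwE : measurable_fun I02 (fun t => (w t)%:E) by exact/measurable_EFinP.
have mr : measurable_fun I02 (fun t => (rearr g t * (w t)%:E)%E).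
  by apply: emeasurable_funM => //; exact: measurable_rearr.
have r0 t : I02 t -> (0 <= rearr g t * (w t)%:E)%E.
  by move=> It; rewrite mule_ge0 ?rearr_ge0// lee_fin w0.
have aE : (0 <= a%:E)%E by rewrite lee_fin ltW.
rewrite /wnrm -(@ge0_integralZl _ _ _ mu _ I2 _ mr _ r0 aE).
apply: ge0_le_integral; first exact: I2.
- by move=> t It; rewrite mule_ge0 ?rearr_ge0// lee_fin w0.
- exact: emeasurable_funM (measurable_rearr mag) mwE.
- by apply: emeasurable_funM mr; exact: measurable_cst.
move=> t It; rewrite muleA lee_wpmul2r ?lee_fin ?w0//.
rewrite -lee_pdivrMl//; apply: le_ereal_inf_tmp => _ [l [l0 lt] <-].
rewrite lee_pdivrMl// -EFinM; apply: rearr_le; first by rewrite mulr_ge0// ltW.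
by apply: le_trans lt; apply: le_distr => // x _; rewrite ltr_pM2l.
Qed.

Section fixed_set.
Variables (E : set (lebesgueR R)) (mE : measurable E) (EI : E `<=` I11).

Lemma measure_le2 : (mu E <= 2%:E)%E.
Proof.
rewrite -measure_I11; apply: le_measure; rewrite ?inE//; exact: measurable_I11.
Qed.

Lemma measure_sub_lty : (mu E < +oo)%E.
Proof. by rewrite (le_lt_trans measure_le2)// ltry. Qed.

Lemma measurable_id_on : measurable_fun E (fun x : lebesgueR R => x : R).
Proof. by apply: measurable_funTS; exact: measurable_id_lebesgueR. Qed.

Lemma sub_I11_norm x : E x -> `|(x : R)| <= 1.
Proof.
by move=> /EI; rewrite /I11/= in_itv/= => /andP[? ?]; rewrite ler_norml !ltW.
Qed.

(** [pker] is even, so integrating over the points x of E instead of over t still costs at most the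
    mass pi. Here it matters that E is measured by Lebesgue measure on the line. *)
Lemma poisson_le_pi (y t : R) : 0 < y -> poisson mu E (fun x => x : R) y t <= pi.
Proof.
move=> y0; rewrite -lee_fin.
rewrite (poissonE mE measure_sub_lty measurable_id_on t y0).
have ck : continuous (fun x => pker y (x - t)).
  move=> x; apply: (continuous_comp (f := fun x => x - t) (g := pker y)).
    by apply: cvgB; [exact: cvg_id|exact: cvg_cst].
  exact: continuous_pker.
have mk (D : set (measurableTypeR R)) : measurable_fun D (fun x => (pker y (x - t))%:E).
  apply/measurable_EFinP; apply: measurable_funTS.
  exact: continuous_measurable_fun.
have mkI : measurable_fun (@I11 R) (fun x => (pker y (x - t))%:E).
  move=> _ Y mY; apply: measurable_lebesgueR; apply: mk => //; exact: measurable_itv.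
have k0 x : (0 <= (pker y (x - t))%:E)%E by rewrite lee_fin pker_ge0.
apply: (@le_trans _ _ (\int[mu]_(x in I11) (pker y (x - t))%:E)%E).
  exact: (@ge0_subset_integral _ _ _ mu _ _ mE (@measurable_I11 R) _ mkI
    (fun x _ => k0 x) EI).
rewrite (@integral_completed _ `]-1, 1[%classic _ (measurable_itv _) (mk _)
  (fun x _ => k0 x)).
apply: (@le_trans _ _ (\int[leb]_(x in `[(-1)%R, 1%R]) (pker y (t - x))%:E)%E).
  under eq_integral do rewrite -(opprB t) /pker sqrrN -/(pker y _).
  apply: (@ge0_subset_integral _ _ _ leb).
  - exact: measurable_itv.
  - exact: measurable_itv.
  - apply/measurable_EFinP; apply: measurable_funTS.
    apply: continuous_measurable_fun => x.
    apply: (continuous_comp (f := fun x => t - x) (g := pker y)).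
      by apply: cvgB; [exact: cvg_cst|exact: cvg_id].
    exact: continuous_pker.
  - by move=> x _; rewrite lee_fin pker_ge0.
  - exact: subset_itv_oo_cc.
by apply: integral_pker_le => //; lra.
Qed.

Local Notation Q := (conjp mu E (fun x => x : R)).

Lemma measurable_normr_conjp y : 0 < y -> measurable_fun I11 (fun t => `|Q y t|).
Proof.
move=> y0; have cQ := continuous_conjp mE measure_sub_lty measurable_id_on y0.
have mQ : measurable_fun setT (fun t : measurableTypeR R => `|Q y t|).
  by apply: measurableT_comp => //; exact: continuous_measurable_fun.
move=> _ Y mY; apply: measurable_lebesgueR; apply: measurableI.
  exact: measurable_itv.
by rewrite -[X in measurable X]setTI; exact: mQ.
Qed.

Lemma conjp_bounded y : 0 < y ->
  exists M : R, forall t, I11 t -> `|Q y t| <= M.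
Proof.
move=> y0; exists (y^-1 * fine (mu E)) => t _.
exact: conjp_le_y mE measure_sub_lty _ measurable_id_on _ _ y0.
Qed.

Lemma conj_wnrm (b y : R) : 0 <= b -> 0 < y ->
  (wnrm (logw b) (fun t => `|Q y t|%R) <=
    (4 * pi * (1 + 4 * (4 * (b + 1)) `^ (b + 1)))%:E * wmass (logw (1 + b)) (mu E))%E.
Proof.
move=> b0 y0; have p0 : 0 < (pi : R) := pi_gt0 R.
have Ef : mu E = (fine (mu E))%:E by rewrite fineK// ge0_fin_numE// measure_sub_lty.
have m0 : 0 <= fine (mu E) by exact: fine_ge0.
have m2 : fine (mu E) <= 2 by rewrite -lee_fin -Ef measure_le2.
have u1 : forall x, E x -> `|(x : R)| <= 1 by exact: sub_I11_norm.
(* K = 4 pi makes K^2 the constant 16 pi^2 of the quadratic weak bound, valid on l >= K since K >= 2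
   pi; for the same reason K also covers the constant 2 pi of the linear one. *)
have K0 : 0 < 4 * pi :> R by rewrite mulr_gt0.
rewrite [X in wmass _ X]Ef.
apply: (@wnrm_restricted R b (4 * pi) _ _ b0 K0 m0 m2 (measurable_normr_conjp y0)).
- move=> l l0.
  apply: (le_trans (conj_weak11 mE measure_sub_lty measurable_id_on u1 y0 l0)).
  rewrite lee_fin ler_wpM2r ?invr_ge0 ?(ltW l0)// ler_wpM2r// ler_wpM2r ?(ltW p0)//.
  by rewrite ler_nat.
- move=> l pil.
  have pil2 : 2 * pi <= l by lra.
  apply: (le_trans (conj_weak22 mE measure_sub_lty measurable_id_on u1 y0 pil2
    (fun t => poisson_le_pi t y0))).
  rewrite lee_fin exprMn.
  have -> : 4 ^+ 2 = 16 :> R by ring.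
  by [].
Qed.

End fixed_set.
End ConjLogNorm.

(** * The smooth Hilbert transform *)

Lemma Rintegral_dominated_cvg d (X : measurableType d) (R : realType)
    (nu : {measure set X -> \bar R}) (D : set X) (f_ : nat -> X -> R) (f g : X -> R) :
  measurable D -> (forall n, measurable_fun D (f_ n)) ->
  (forall x, D x -> f_ n x @[n --> \oo] --> f x) ->
  nu.-integrable D (EFin \o g) ->
  (forall n x, D x -> `|f_ n x| <= g x) ->
  \int[nu]_(x in D) f_ n x @[n --> \oo] --> \int[nu]_(x in D) f x.
Proof.
move=> mD mf_ f_f ig fg.
have mfE n : measurable_fun D (EFin \o f_ n) by exact/measurable_EFinP.
have fE x : D x -> (EFin \o f_ n) x @[n --> \oo] --> (EFin \o f) x.
  by move=> Dx; apply: cvg_EFin; [exact: nearW|exact: f_f].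
have fgE n x : D x -> (`|(EFin \o f_ n) x| <= (EFin \o g) x)%E.
  by move=> Dx; rewrite lee_fin fg.
have mf : measurable_fun D f by exact: measurable_fun_cvg mf_ f_f.
have if_ : nu.-integrable D (EFin \o f).
  apply: (le_integrable mD _ _ ig); first exact/measurable_EFinP.
  move=> x Dx; rewrite lee_fin (le_trans _ (ler_norm _))//.
  have h : `|f_ n x| @[n --> \oo] --> `|f x| by apply: cvg_norm; exact: f_f.
  rewrite -(cvg_lim _ h)//; apply: limr_le; first by apply/cvg_ex; eexists; exact: h.
  by apply: nearW => n; exact: fg.
rewrite /Rintegral; apply: fine_cvg.
rewrite fineK; last exact: (integrable_fin_num mD if_).
exact: (@dominated_cvg _ _ _ nu D mD (fun n => EFin \o f_ n) (EFin \o f) (EFin \o g)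
  mfE fE (fun _ _ => erefl) ig fgE).
Qed.

(** * Decomposition into level sets *)

Section LayerSum.
Variable R : realType.
Local Notation leb := (@lebesgue_measure R).

Lemma layer_count (d x : R) (M : nat) : 0 < d -> 0 <= x ->
  let S := \sum_(k < M) (d * (k.+1%:R * d < x)%R%:R) in
  [/\ 0 <= S, S <= x & x <= M%:R * d -> x <= S + d].
Proof.
move=> d0 x0 /=.
(* For the induction, the last clause does not assume x <= M d: either all steps are full, or the
   sum is already within [d] of [x]. *)
suff [h1 h2 h3] : [/\ 0 <= \sum_(k < M) (d * (k.+1%:R * d < x)%R%:R),
    \sum_(k < M) (d * (k.+1%:R * d < x)%R%:R) <= x &
    \sum_(k < M) (d * (k.+1%:R * d < x)%R%:R) = M%:R * d \/
    x <= \sum_(k < M) (d * (k.+1%:R * d < x)%R%:R) + d].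
  by split => // xM; case: h3 => [->|//]; lra.
elim: M => [|M [h1 h2 h3]].
  by rewrite !big_ord0; split => //; left; rewrite mul0r.
rewrite !big_ord_recr/=.
have [lt|le] := ltP (M.+1%:R * d) x; last first.
  rewrite mulr0 addr0; split => //; right; case: h3 => // ->.
  by rewrite -natr1 mulrDl mul1r in le.
rewrite mulr1; have S_M : \sum_(k < M) (d * (k.+1%:R * d < x)%R%:R) = M%:R * d.
  rewrite (eq_bigr (fun=> d)); first by rewrite sumr_const card_ord mulr_natl.
  move=> k _; rewrite (_ : (_ < x) = true) ?mulr1//.
  by apply: le_lt_trans lt; rewrite ler_wpM2r ?(ltW d0)// ler_nat ltnS ltnW.
rewrite S_M; have -> : M%:R * d + d = M.+1%:R * d by rewrite -natr1 mulrDl mul1r.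
split; last by left.
- by rewrite mulr_ge0// ltW.
- exact: ltW.
Qed.

(** Right-endpoint Riemann sums of a nonincreasing function lie below its integral. *)
Lemma sum_le_integral_anti (phi : R -> \bar R) (d : R) (M : nat) : 0 < d ->
  measurable_fun (`[0, +oo[%classic : set (measurableTypeR R)) phi ->
  (forall s t, 0 <= s -> s <= t -> (phi t <= phi s)%E) ->
  (forall t, (0 <= phi t)%E) ->
  (\sum_(k < M) (d%:E * phi (k.+1%:R * d)%R) <=
    \int[leb]_(t in `[0%R, +oo[) phi t)%E.
Proof.
move=> d0 mphi aphi phi0.
have sub (c : R) : `[0, c[%classic `<=` (`[0, +oo[%classic : set (measurableTypeR R)).
  by move=> t /=; rewrite !in_itv/= andbT => /andP[].
have mc (c : R) : measurable_fun (`[0, c[%classic : set (measurableTypeR R)) phi.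
  by apply: measurable_funS mphi; [exact: measurable_itv|exact: sub].
apply: (@le_trans _ _ (\int[leb]_(t in `[0%R, (M%:R * d)%R[) phi t)%E); last first.
  by apply: (@ge0_subset_integral _ _ _ leb) => //; exact: measurable_itv.
elim: M => [|M IH]; first by rewrite big_ord0 integral_ge0.
rewrite big_ord_recr/=.
have MM : M%:R * d <= M.+1%:R * d by rewrite ler_wpM2r ?(ltW d0)// ler_nat.
have M0 : 0 <= M%:R * d by rewrite mulr_ge0// ltW.
pose A : set (measurableTypeR R) := `[0, M%:R * d[%classic.
pose B : set (measurableTypeR R) := `[M%:R * d, M.+1%:R * d[%classic.
have -> : `[0, M.+1%:R * d[%classic = A `|` B.
  apply/seteqP; split => t; rewrite /A /B/= !in_itv/=.
    by move=> /andP[-> tM]; case: (ltP t (M%:R * d)) => mt; [left|right].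
  by move=> [/andP[-> /lt_le_trans]|/andP[/(le_trans M0) ->]//]; apply.
have dAB : [disjoint A & B].
  apply/disj_setPLR => t; rewrite /A /B /= !in_itv/= => /andP[_ tm].
  by apply/negP; rewrite negb_and -ltNge tm.
have mA : measurable A by exact: measurable_itv.
have mB : measurable B by exact: measurable_itv.
have mU : measurable_fun (A `|` B) phi.
  apply: measurable_funS mphi; first exact: measurable_itv.
  move=> t; rewrite /A /B/= !in_itv/= andbT.
  by move=> [/andP[]//|/andP[/(le_trans M0)]].
rewrite (@ge0_integral_setU _ _ _ leb A B mA mB phi mU (fun t _ => phi0 t) dAB).
apply: leeD => //.
have -> : (d%:E * phi (M.+1%:R * d)%R = \int[leb]_(t in B) cst (phi (M.+1%:R * d)%R) t)%E.
  have lB : leb B = d%:E.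
    rewrite /B lebesgue_measure_itv/= lte_fin ltr_pM2r//.
    by rewrite ltr_nat ltnS leqnn -EFinB -mulrBl -natrB// subSnn mul1r.
  by rewrite (integral_cst _ mB) muleC; congr (_ * _)%E; rewrite -lB.
apply: (@ge0_le_integral _ _ _ leb _ mB).
- by move=> t _; exact: phi0.
- exact: measurable_cst.
- by apply: measurable_funS mU; [exact: measurableU|exact: subsetUr].
- move=> t; rewrite /B/= in_itv/= => /andP[Mt tM].
  by apply: aphi; [exact: le_trans Mt|exact: ltW].
Qed.

End LayerSum.

Section SmoothHilbert.
Variable R : realType.
Local Notation mu := (@completed_lebesgue_measure R).
Implicit Types (f g h u : lebesgueR R -> R) (E : set (lebesgueR R)).

Definition smooth_hilbert (y : R) u (t : R) : R :=
  \int[mu]_(x in I11) (u x * qker y (x - t)).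

Lemma I11_lty : (mu (@I11 R) < +oo)%E.
Proof. by rewrite measure_I11 ltry. Qed.

Lemma measurable_qker_shift (y t : R) : 0 < y ->
  measurable_fun (@I11 R) (fun x => qker y (x - t)).
Proof.
move=> y0; apply: measurable_conv_ker; last exact: continuous_qker.
by apply: measurable_funTS; exact: measurable_id_lebesgueR.
Qed.

Lemma integrable_smooth (y t : R) u : 0 < y -> mu.-integrable I11 (EFin \o u) ->
  mu.-integrable I11 (EFin \o (fun x => u x * qker y (x - t))).
Proof.
move=> y0 iu; have mI := @measurable_I11 R.
have mu_ : measurable_fun I11 u by have /measurable_int/measurable_EFinP := iu.
have iyu : mu.-integrable I11 (fun x => (y^-1)%:E * (EFin \o u) x)%E.
  exact: integrableZl.
apply: (@le_integrable _ _ _ mu I11 mI _ _ _ _ iyu).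
- by apply/measurable_EFinP; exact: measurable_funM mu_ (measurable_qker_shift t y0).
- move=> x Ix /=; rewrite lee_fin normrM mulrC [leRHS]normrM.
  rewrite (ger0_norm (_ : 0 <= y^-1)) ?invr_ge0 ?(ltW y0)//.
  by rewrite ler_wpM2r// qker_le.
Qed.

Lemma smooth_indic (y t : R) E : measurable E -> E `<=` I11 ->
  conjp mu E (fun x => x : R) y t = smooth_hilbert y \1_E t.
Proof.
move=> mE EI; rewrite /conjp /conv /smooth_hilbert.
transitivity (\int[mu]_(x in I11 `&` E) qker y ((x : R) - t)).
  by rewrite (setIidr EI).
rewrite Rintegral_mkcondr; apply: eq_Rintegral => x _.
by rewrite patchE indicE; case: ifPn => xE; rewrite ?mul1r ?mul0r.
Qed.

Section nonneg.
Variable f : lebesgueR R -> R.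
Hypothesis fint : mu.-integrable I11 (EFin \o f).
Hypothesis f0 : forall x, I11 x -> 0 <= f x.

Let mf : measurable_fun I11 f.
Proof. by have /measurable_int/measurable_EFinP := fint. Qed.

Let E (d : R) (k : nat) : set (lebesgueR R) :=
  I11 `&` [set x | k.+1%:R * d < f x].

Let mE d k : measurable (E d k). Proof. exact: measurable_level. Qed.
Let EI d k : E d k `<=` I11. Proof. exact: subIsetl. Qed.

(** A staircase below [f], written as a combination of indicators of level sets so that [conj_wnrm]
    applies to each term. *)
Let F (d : R) (M : nat) (x : lebesgueR R) : R := \sum_(k < M) (d * \1_(E d k) x).

Let FE d M x : I11 x -> F d M x = \sum_(k < M) (d * (k.+1%:R * d < f x)%R%:R).
Proof.
move=> Ix; apply: eq_bigr => k _; rewrite indicE; congr (_ * (nat_of_bool _)%:R).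
by apply/idP/idP => [/set_mem[]//|h]; apply/mem_set; split.
Qed.

Let iF d M : mu.-integrable I11 (EFin \o F d M).
Proof.
rewrite /F; elim: M => [|M IH].
  apply: (@eq_integrable _ _ _ mu _ (@measurable_I11 R) (cst 0%E)).
    by move=> x _; rewrite /= big_ord0.
  exact: integrable0.
apply: (@eq_integrable _ _ _ mu _ (@measurable_I11 R) (fun x =>
   ((EFin \o F d M) x + d%:E * (\1_(E d M) x)%:E)%E)).
  by move=> x _; rewrite /= /F big_ord_recr/= EFinD EFinM.
apply: integrableD => //; first exact: measurable_I11.
apply: integrableZl; first exact: measurable_I11.
apply: (@integrable_le_cst _ _ _ mu _ (@measurable_I11 R) I11_lty _ 1).
  by apply: measurable_indic; exact: mE.
by move=> x _; rewrite indicE; case: (_ \in _); rewrite ?normr1 ?normr0.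
Qed.

Let smooth_F d M (y t : R) : 0 < y ->
  smooth_hilbert y (F d M) t =
  \sum_(k < M) (d * conjp mu (E d k) (fun x => x : R) y t).
Proof.
move=> y0; elim: M => [|M IH].
  rewrite big_ord0 /smooth_hilbert /Rintegral integral0_eq// => x _.
  by rewrite /F big_ord0 mul0r.
have iI : mu.-integrable I11 (EFin \o (\1_(E d M) : lebesgueR R -> R)).
  apply: (@integrable_le_cst _ _ _ mu _ (@measurable_I11 R) I11_lty _ 1).
    by apply: measurable_indic; exact: mE.
  by move=> x _; rewrite indicE; case: (_ \in _); rewrite ?normr1 ?normr0.
rewrite big_ord_recr/= -IH smooth_indic; [|exact: mE|exact: EI].
rewrite /smooth_hilbert -RintegralZl; first last.
- exact: integrable_smooth.
- exact: measurable_I11.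
rewrite -RintegralD; first last.
- have /= := @integrableZl _ _ _ mu _ (@measurable_I11 R) d _ (integrable_smooth t y0 iI).
  by move=> h; exact: h.
- exact: integrable_smooth.
- exact: measurable_I11.
apply: eq_Rintegral => x _.
by rewrite /F big_ord_recr/= mulrDl mulrA.
Qed.

Let F_bound d M x : 0 < d -> I11 x -> `|F d M x| <= f x.
Proof.
move=> d0 Ix; have [h1 h2 _] := layer_count M d0 (f0 Ix).
by rewrite FE// ger0_norm.
Qed.

(** The mesh tends to 0 while the height [Mn n] times [dn n], that is n + 1, tends to infinity. *)
Let dn (n : nat) : R := n.+1%:R^-1.
Let Mn (n : nat) : nat := (n.+1 * n.+1)%N.

Let dn_gt0 n : 0 < dn n. Proof. by rewrite invr_gt0. Qed.

Let F_cvg x : I11 x -> F (dn n) (Mn n) x @[n --> \oo] --> f x.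
Proof.
move=> Ix; apply/cvgrPdist_le => e e0.
have [N hN] : exists N : nat, dn N < e.
  by have /ltr_add_invr[N] : 0 < e := e0; rewrite add0r; exists N.
near=> n.
have [h1 h2 h3] := layer_count (Mn n) (dn_gt0 n) (f0 Ix).
rewrite FE// ler_norml.
have : f x <= (Mn n)%:R * dn n.
  rewrite /Mn /dn natrM mulfK ?pnatr_eq0//.
  near: n; exists (Num.truncn (f x)) => // n /= fn.
  apply: (le_trans (ltW (truncnS_gt (f x)))).
  by rewrite ler_nat ltnS.
move=> /h3 h.
have : dn n <= e.
  apply: le_trans (ltW hN); rewrite lef_pV2 ?posrE// ler_nat ltnS.
  by near: n; exists N.
by move=> ?; apply/andP; split; lra.
Unshelve. all: by end_near. Qed.

Lemma smooth_layer_cvg (y t : R) : 0 < y ->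
  smooth_hilbert y (F (dn n) (Mn n)) t @[n --> \oo] --> smooth_hilbert y f t.
Proof.
move=> y0; have mI := @measurable_I11 R.
have iFq n := integrable_smooth t y0 (iF (dn n) (Mn n)).
have ifq := integrable_smooth t y0 fint.
have mFq n : measurable_fun I11 (fun x => F (dn n) (Mn n) x * qker y (x - t)).
  exact/measurable_EFinP/(measurable_int mu (iFq n)).
have igq : mu.-integrable I11 (EFin \o (fun x => `|f x * qker y (x - t)|)).
  exact: integrable_norm.
apply: (Rintegral_dominated_cvg mI mFq _ igq).
- by move=> x Ix; apply: cvgM; [exact: F_cvg|exact: cvg_cst].
- move=> n x Ix; rewrite !normrM ler_wpM2r//.
  by rewrite [leRHS]ger0_norm ?f0// F_bound.
Qed.

Variables (b : R) (b0 : 0 <= b).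

Let C : R := 4 * pi * (1 + 4 * (4 * (b + 1)) `^ (b + 1)).

Let mw a : measurable_fun (@I02 R) (logw a) := measurable_logw_I02 a.
Let w0 (a : R) (t : lebesgueR R) : I02 t -> 0 <= logw a t :=
  fun _ => logw_ge0 a t.
Let wanti (a : R) : 0 <= a -> forall s t : lebesgueR R,
  I02 s -> I02 t -> s <= t -> logw a t <= logw a s.
Proof.
move=> a0 s t; rewrite /I02/= !in_itv/= => /andP[s0 _] /andP[_ t2] st.
by apply: logw_anti => //; exact: ltW.
Qed.

Let G d M (y t : R) : R := \sum_(k < M) (d * `|conjp mu (E d k) (fun x => x : R) y t|).

(** Boundedness is part of the induction because [wnrmD] asks for it. The right-hand side is [C]
    times a Riemann sum of the layer formula for the norm of [f] with exponent 1 + b. *)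
Let G_wnrm d M (y : R) : 0 < d -> 0 < y ->
  [/\ measurable_fun I11 (G d M y), exists B : R, forall t, I11 t -> G d M y t <= B &
    (wnrm (logw b) (G d M y) <=
      \sum_(k < M) (d%:E * (C%:E * wmass (logw (1 + b)) (distr f (k.+1%:R * d)%R))))%E].
Proof.
move=> d0 y0; elim: M => [|M [m1 [B hB] h]].
  have -> : G d 0 y = cst 0 by apply/funext => t; rewrite /G big_ord0.
  split; [exact: measurable_cst|by exists 0|].
  rewrite big_ord0 /wnrm integral0_eq// => t It.
  have -> : rearr (cst 0) t = 0%E; last by rewrite mul0e.
  apply/eqP; rewrite eq_le rearr_ge0 andbT.
  apply: rearr_le => //; rewrite /distr (_ : _ `&` _ = set0).
    by rewrite measure0 lee_fin; move: It; rewrite /I02/= in_itv/= => /andP[/ltW].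
  by apply/seteqP; split => // x [_ /=]; rewrite ltxx.
pose g t := `|conjp mu (E d M) (fun x => x : R) y t|.
have mg : measurable_fun I11 g := measurable_normr_conjp (@mE d M) (@EI d M) y0.
have [B' hB'] := conjp_bounded (@mE d M) (@EI d M) y0.
have mdg : measurable_fun I11 (fun t => d * g t) by exact: measurable_funM (measurable_cst d) mg.
have -> : G d M.+1 y = (fun t => G d M y t + d * g t).
  by apply/funext => t; rewrite /G big_ord_recr.
have bdg : exists B : R, forall t, I11 t -> d * g t <= B.
  by exists (d * B') => t It; rewrite ler_pM2l// hB'.
split.
- exact: measurable_funD m1 mdg.
- by have [B2 hB2] := bdg; exists (B + B2) => t It; rewrite lerD ?hB ?hB2.
rewrite big_ord_recr/=.
apply: (le_trans (wnrmD (mw b) (@w0 b) (wanti b0) m1 mdg (ex_intro _ B hB) bdg)).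
apply: (leeD h); apply: (le_trans (wnrmZ d0 (mw b) (@w0 b) mg)).
by rewrite lee_wpmul2l ?lee_fin ?(ltW d0)//; exact: (conj_wnrm (@mE d M) (@EI d M) b0 y0).
Qed.

(** The staircases satisfy the bound uniformly in n, as their Riemann sums lie below the layer
    integral of [f]; Fatou's lemma for rearrangements then reaches [f] itself. *)
Lemma wnrm_smooth_ge0 (y : R) : 0 < y ->
  measurable_fun I11 (smooth_hilbert y f) /\
  (wnrm (logw b) (fun t => `|smooth_hilbert y f t|%R) <=
    C%:E * wnrm (logw (1 + b)) f)%E.
Proof.
move=> y0; have b1 : 0 <= 1 + b by rewrite addr_ge0.
have p0 : 0 < (pi : R) := pi_gt0 R.
have C0 : 0 <= C.
  apply: mulr_ge0; first by rewrite mulr_ge0// ltW.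
  by rewrite addr_ge0// mulr_ge0// powR_ge0.
pose gn n t := `|smooth_hilbert y (F (dn n) (Mn n)) t|.
have gn_cvg t : gn n t @[n --> \oo] --> `|smooth_hilbert y f t|.
  by apply: cvg_norm; exact: smooth_layer_cvg.
have mgn0 n : measurable_fun I11 (smooth_hilbert y (F (dn n) (Mn n))).
  have mQ k : measurable_fun I11 (fun t =>
      dn n * conjp mu (E (dn n) k) (fun x => x : R) y t).
    have cQ := continuous_conjp (@mE (dn n) k)
      (measure_sub_lty (@mE (dn n) k) (@EI (dn n) k)) (@measurable_id_on R (E (dn n) k)) y0.
    have mQ : measurable_fun I11 (conjp mu (E (dn n) k) (fun x => x : R) y).
      move=> _ Y mY; apply: measurable_lebesgueR; apply: measurableI.
        exact: measurable_itv.
      rewrite -[X in measurable X]setTI.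
      by apply: (continuous_measurable_fun cQ).
    exact: measurable_funM (measurable_cst (dn n)) mQ.
  have mS := @measurable_sum _ _ _ I11 _ (index_enum 'I_(Mn n)) _ mQ.
  by apply: eq_measurable_fun mS => t _; rewrite smooth_F.
have mgn n : measurable_fun I11 (gn n).
  exact: measurableT_comp (@normr_measurable R setT) (mgn0 n).
have mg0 : measurable_fun I11 (smooth_hilbert y f).
  have cv (t : lebesgueR R) : I11 t -> (fun n => smooth_hilbert y (F (dn n) (Mn n))) ^~ t @ \oo -->
      smooth_hilbert y f t.
    by move=> _; exact: smooth_layer_cvg.
  exact: measurable_fun_cvg mgn0 cv.
have mg : measurable_fun I11 (fun t => `|smooth_hilbert y f t|).
  exact: measurableT_comp (@normr_measurable R setT) mg0.
split; first exact: mg0.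
apply: (wnrm_fatou (mw b) (@w0 b) mgn mg).
  by move=> t l It l0 lt; apply: (cvgr_gt _ (gn_cvg t)).
move=> n; have [mG _ hG] := G_wnrm (Mn n) (dn_gt0 n) y0.
apply: (@le_trans _ _ (wnrm (logw b) (G (dn n) (Mn n) y))).
  apply: (le_wnrm (mw b) (@w0 b) mG (mgn n)) => t It; rewrite /gn smooth_F//.
  apply: (le_trans (ler_norm_sum _ _ _)); apply: ler_sum => k _.
  by rewrite normrM (gtr0_norm (dn_gt0 n)).
apply: (le_trans hG).
have -> : (\sum_(k < Mn n) ((dn n)%:E *
    (C%:E * wmass (logw (1 + b)) (distr f (k.+1%:R * dn n)%R))) =
  C%:E * \sum_(k < Mn n) ((dn n)%:E *
    wmass (logw (1 + b)) (distr f (k.+1%:R * dn n)%R)))%E.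
  rewrite ge0_sume_distrr.
    by apply: eq_bigr => k _; rewrite muleCA.
  move=> k _; rewrite mule_ge0 ?lee_fin ?(ltW (dn_gt0 n))//.
  by apply: integral_ge0 => t _; rewrite lee_fin logw_ge0.
rewrite lee_wpmul2l ?lee_fin// (wnrm_layer (mw (1 + b)) (@w0 (1 + b)) mf).
apply: (@sum_le_integral_anti R (fun l => wmass (logw (1 + b)) (distr f l)) _ _
  (dn_gt0 n)).
- exact: (measurable_wmass_distr (mw (1 + b)) (@w0 (1 + b)) mf).
- move=> s t s0 st; apply: (le_wmass (mw (1 + b)) (@w0 (1 + b))).
  by apply: (le_distr mf mf) => x _; exact: le_lt_trans.
- by move=> l; exact: wmass_ge0 (@w0 (1 + b)) _.
Qed.

End nonneg.
End SmoothHilbert.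

(** * The smooth transform of real and complex functions *)

Section ComplexSmoothHilbert.
Variable R : realType.
Local Notation mu := (@completed_lebesgue_measure R).
Implicit Types (f : lebesgueR R -> R[i]) (u v : lebesgueR R -> R).

Lemma Re_le_normc (z : R[i]) : `|complex.Re z| <= Normc.normc z.
Proof.
case: z => x y /=; rewrite -sqrtr_sqr ler_sqrt ?addr_ge0 ?sqr_ge0//.
by rewrite lerDl sqr_ge0.
Qed.

Lemma Im_le_normc (z : R[i]) : `|complex.Im z| <= Normc.normc z.
Proof.
case: z => x y /=; rewrite -sqrtr_sqr ler_sqrt ?addr_ge0 ?sqr_ge0//.
by rewrite lerDr sqr_ge0.
Qed.

Lemma normc_le (z : R[i]) : Normc.normc z <= `|complex.Re z| + `|complex.Im z|.
Proof.
case: z => x y /=.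
have h : 0 <= `|x| + `|y| by rewrite addr_ge0.
rewrite -[leRHS]ger0_norm// -sqrtr_sqr ler_sqrt ?sqr_ge0//.
rewrite sqrrD !real_normK ?num_real//.
by rewrite lerD2r lerDl mulrn_wge0// mulr_ge0.
Qed.

Lemma measurable_normc f : cmeasurable_fun I11 f ->
  measurable_fun I11 (fun x => Normc.normc (f x)).
Proof.
move=> [mr mi].
apply: (@eq_measurable_fun _ _ _ _ _ (fun x : lebesgueR R =>
  Num.sqrt (complex.Re (f x) ^+ 2 + complex.Im (f x) ^+ 2))).
  by move=> x _; case: (f x).
have ms : measurable_fun I11 (fun x : lebesgueR R =>
    complex.Re (f x) ^+ 2 + complex.Im (f x) ^+ 2).
  by apply: measurable_funD; apply: measurable_funX.
have msq : measurable_fun setT (@Num.sqrt R).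
  by apply: continuous_measurable_fun; exact: sqrt_continuous.
exact: measurableT_comp msq ms.
Qed.

(** The weight is at least 1 on ]0, 2[ and rearrangement preserves the integral: this gives the
    inclusion in L^1. *)
Lemma logw_rearr_ge a u : 0 <= a -> measurable_fun I11 u ->
  (forall x, I11 x -> 0 <= u x) ->
  (\int[mu]_(x in I11) (u x)%:E <= wnrm (logw a) u)%E.
Proof.
move=> a0 mu_ u0; have I2 := @measurable_I02 R.
have -> : (\int[mu]_(x in I11) (u x)%:E = \int[mu]_(t in I02) rearr u t)%E.
  transitivity (\int[mu]_(t in I02) excess 0 (rearr u t))%E.
    rewrite (integral_excess_rearr mu_ (lexx 0)); apply: eq_integral => x /set_mem Ix.
    by rewrite excess0// lee_fin u0.
  by apply: eq_integral => t _; rewrite excess0// rearr_ge0.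
have mr := measurable_rearr mu_.
have mwE : measurable_fun I02 (fun t => (logw a t)%:E).
  by apply/measurable_EFinP; exact: measurable_logw_I02.
apply: ge0_le_integral; first exact: I2.
- by move=> t _; exact: rearr_ge0.
- exact: mr.
- exact: emeasurable_funM mr mwE.
move=> t; rewrite /I02/= in_itv/= => /andP[t0 t2].
by rewrite lee_pemulr ?rearr_ge0// lee_fin logw_ge1// ltW.
Qed.

Lemma LlogL_integrable a f : 0 <= a -> LlogL a f ->
  mu.-integrable I11 (fun x => (Normc.normc (f x))%:E).
Proof.
move=> a0 [mf]; rewrite LlogL_normE => flty.
have mn := measurable_normc mf.
apply/integrableP; split; first exact/measurable_EFinP.
apply: le_lt_trans flty; apply: le_trans (logw_rearr_ge a0 mn _); last first.
  by move=> x _; case: (f x) => ? ?; exact: sqrtr_ge0.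
rewrite le_eqVlt; apply/orP; left; apply/eqP; apply: eq_integral => x _.
by rewrite gee0_abs// lee_fin; case: (f x) => ? ?; exact: sqrtr_ge0.
Qed.

Lemma integrable_dominated u v : mu.-integrable I11 (EFin \o v) ->
  measurable_fun I11 u -> (forall x, I11 x -> `|u x| <= v x) ->
  mu.-integrable I11 (EFin \o u).
Proof.
move=> iv mu_ uv; apply: (le_integrable (@measurable_I11 R) _ _ iv).
  exact/measurable_EFinP.
by move=> x Ix; rewrite lee_fin (le_trans (uv x Ix))// ler_norm.
Qed.

Lemma smooth_hilbertB (y t : R) u v : 0 < y ->
  mu.-integrable I11 (EFin \o u) -> mu.-integrable I11 (EFin \o v) ->
  smooth_hilbert y (fun x => u x - v x) t = smooth_hilbert y u t - smooth_hilbert y v t.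
Proof.
move=> y0 iu iv; rewrite /smooth_hilbert -RintegralB; first last.
- exact: integrable_smooth.
- exact: integrable_smooth.
- exact: measurable_I11.
by apply: eq_Rintegral => x _; rewrite mulrBl.
Qed.

(** Supplies the boundedness that [wnrmD] asks for. *)
Lemma smooth_bounded (y : R) u : 0 < y -> mu.-integrable I11 (EFin \o u) ->
  exists B : R, forall t, `|smooth_hilbert y u t| <= B.
Proof.
move=> y0 iu; exists (y^-1 * \int[mu]_(x in I11) `|u x|) => t.
have mI := @measurable_I11 R.
have iq := integrable_smooth t y0 iu.
apply: (le_trans (le_normr_Rintegral mI iq)).
have inu : mu.-integrable I11 (EFin \o (fun x => `|u x|)) by exact: integrable_norm.
rewrite -(RintegralZl _ mI inu); apply: (le_Rintegral mI).
- exact: integrable_norm.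
- exact: (@integrableZl _ _ _ mu _ mI _ _ inu).
- by move=> x _; rewrite normrM mulrC ler_wpM2r// qker_le.
Qed.

Variables (b : R) (b0 : 0 <= b).
Let C : R := 4 * pi * (1 + 4 * (4 * (b + 1)) `^ (b + 1)).

Let mw a : measurable_fun (@I02 R) (logw a) := measurable_logw_I02 a.
Let w0 (a : R) (t : lebesgueR R) : I02 t -> 0 <= logw a t :=
  fun _ => logw_ge0 a t.
Let wanti (a : R) : 0 <= a -> forall s t : lebesgueR R,
  I02 s -> I02 t -> s <= t -> logw a t <= logw a s.
Proof.
move=> a0 s t; rewrite /I02/= !in_itv/= => /andP[s0 _] /andP[_ t2] st.
by apply: logw_anti => //; exact: ltW.
Qed.

(** The positive and negative parts are both dominated by [v], which doubles the constant. In the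
    complex case [v] is the modulus of [f], for the real and the imaginary part alike, and the
    constant doubles again. *)
Lemma wnrm_smooth_real (y : R) u v : 0 < y ->
  mu.-integrable I11 (EFin \o v) -> measurable_fun I11 u ->
  (forall x, I11 x -> `|u x| <= v x) ->
  [/\ measurable_fun I11 (smooth_hilbert y u),
    exists B : R, forall t, `|smooth_hilbert y u t| <= B &
    (wnrm (logw b) (fun t => `|smooth_hilbert y u t|%R) <=
      (2 * C)%:E * wnrm (logw (1 + b)) v)%E].
Proof.
move=> y0 iv mu_ uv.
pose p x := Num.max (u x) 0; pose n x := Num.max (- u x) 0.
have mp : measurable_fun I11 p by exact: measurable_maxr mu_ (measurable_cst _).
have mn : measurable_fun I11 n.
  exact: measurable_maxr (measurable_funN mu_) (measurable_cst _).
have p0 x : I11 x -> 0 <= p x by move=> _; rewrite le_max lexx orbT.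
have n0 x : I11 x -> 0 <= n x by move=> _; rewrite le_max lexx orbT.
have v0 x : I11 x -> 0 <= v x by move=> Ix; apply: le_trans (uv x Ix).
have pv x : I11 x -> p x <= v x.
  by move=> Ix; rewrite ge_max v0// andbT; apply: le_trans (uv x Ix); exact: ler_norm.
have nv x : I11 x -> n x <= v x.
  move=> Ix; rewrite ge_max v0// andbT; apply: le_trans (uv x Ix).
  by rewrite -normrN ler_norm.
have mv : measurable_fun I11 v by exact/measurable_EFinP/(measurable_int mu iv).
have ip : mu.-integrable I11 (EFin \o p).
  by apply: (integrable_dominated iv mp) => x Ix; rewrite ger0_norm ?p0 ?pv.
have in_ : mu.-integrable I11 (EFin \o n).
  by apply: (integrable_dominated iv mn) => x Ix; rewrite ger0_norm ?n0 ?nv.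
have [mQp hp] := wnrm_smooth_ge0 ip p0 b0 y0.
have [mQn hn] := wnrm_smooth_ge0 in_ n0 b0 y0.
have [Bp hBp] := smooth_bounded y0 ip.
have [Bn hBn] := smooth_bounded y0 in_.
have uE t : smooth_hilbert y u t = smooth_hilbert y p t - smooth_hilbert y n t.
  rewrite -smooth_hilbertB//; apply: eq_Rintegral => x _; congr (_ * _).
  rewrite /p /n; case: (leP 0 (u x)) => u0.
    by rewrite max_r ?subr0// oppr_le0.
  by rewrite max_l ?sub0r ?opprK// oppr_ge0 ltW.
have mQu : measurable_fun I11 (smooth_hilbert y u).
  by apply: eq_measurable_fun (measurable_funB mQp mQn) => t _; rewrite uE.
have mnp := measurableT_comp (@normr_measurable R setT) mQp.
have mnn := measurableT_comp (@normr_measurable R setT) mQn.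
have mnu := measurableT_comp (@normr_measurable R setT) mQu.
have b1 : 0 <= 1 + b by rewrite addr_ge0.
have C0 : (0 <= C%:E)%E.
  have pi0 : 0 <= (pi : R) := pi_ge0 R.
  rewrite lee_fin; apply: mulr_ge0; first by rewrite mulr_ge0.
  by rewrite addr_ge0// mulr_ge0// powR_ge0.
split; first exact: mQu.
  by exists (Bp + Bn) => t; rewrite uE (le_trans (ler_normB _ _))// lerD.
apply: (@le_trans _ _ (wnrm (logw b) (fun t =>
    `|smooth_hilbert y p t|%R + `|smooth_hilbert y n t|%R)%R)).
  apply: (le_wnrm (mw b) (@w0 b) (measurable_funD mnp mnn) mnu) => t _.
  by rewrite /= uE ler_normB.
have bp : exists M : R, forall t, I11 t -> `|smooth_hilbert y p t| <= M by exists Bp.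
have bn : exists M : R, forall t, I11 t -> `|smooth_hilbert y n t| <= M by exists Bn.
apply: (le_trans (wnrmD (mw b) (@w0 b) (wanti b0) mnp mnn bp bn)).
have -> : ((2 * C)%:E = C%:E + C%:E)%E by rewrite -EFinD; congr EFin; ring.
rewrite ge0_muleDl//; apply: leeD.
  apply: (le_trans hp); apply: (lee_wpmul2l C0).
  exact: (le_wnrm (mw _) (@w0 _) mv mp).
apply: (le_trans hn); apply: (lee_wpmul2l C0).
exact: (le_wnrm (mw _) (@w0 _) mv mn).
Qed.

Lemma wnrm_smooth_complex (y : R) f : 0 < y ->
  cmeasurable_fun I11 f -> mu.-integrable I11 (fun x => (Normc.normc (f x))%:E) ->
  let q t := Normc.normc (smooth_hilbert y (fun x => complex.Re (f x)) t +i*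
                          smooth_hilbert y (fun x => complex.Im (f x)) t)%C in
  measurable_fun I11 q /\
  (wnrm (logw b) q <=
    (4 * C)%:E * wnrm (logw (1 + b)) (fun x => Normc.normc (f x)))%E.
Proof.
move=> y0 [mr mi] iN q.
have [mQr [Br hBr] hr] := wnrm_smooth_real y0 iN mr (fun x _ => Re_le_normc (f x)).
have [mQi [Bi hBi] hi] := wnrm_smooth_real y0 iN mi (fun x _ => Im_le_normc (f x)).
have mq : measurable_fun I11 q.
  exact: (@measurable_normc (fun t => smooth_hilbert y (fun x => complex.Re (f x)) t
    +i* smooth_hilbert y (fun x => complex.Im (f x)) t)%C (conj mQr mQi)).
split; first exact: mq.
have mnr := measurableT_comp (@normr_measurable R setT) mQr.
have mni := measurableT_comp (@normr_measurable R setT) mQi.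
have C0 : (0 <= (2 * C)%:E)%E.
  have pi0 : 0 <= (pi : R) := pi_ge0 R.
  rewrite lee_fin mulr_ge0//; apply: mulr_ge0; first by rewrite mulr_ge0.
  by rewrite addr_ge0// mulr_ge0// powR_ge0.
apply: (@le_trans _ _ (wnrm (logw b) (fun t =>
    `|smooth_hilbert y (fun x => complex.Re (f x)) t|%R +
    `|smooth_hilbert y (fun x => complex.Im (f x)) t|%R)%R)).
  apply: (le_wnrm (mw b) (@w0 b) (measurable_funD mnr mni) mq) => t _.
  exact: normc_le.
have bR : exists M : R, forall t, I11 t ->
  `|smooth_hilbert y (fun x => complex.Re (f x)) t| <= M by exists Br.
have bI : exists M : R, forall t, I11 t ->
  `|smooth_hilbert y (fun x => complex.Im (f x)) t| <= M by exists Bi.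
apply: (le_trans (wnrmD (mw b) (@w0 b) (wanti b0) mnr mni bR bI)).
have -> : ((4 * C)%:E = (2 * C)%:E + (2 * C)%:E)%E.
  by rewrite -EFinD; congr EFin; ring.
rewrite (ge0_muleDl _ C0 C0); apply: leeD; [exact: hr|exact: hi].
Qed.

End ComplexSmoothHilbert.

(** * Truncations and their Abel means *)

Section TruncatedKernel.
Variable R : realType.
Implicit Types (e w a s : R).

(** The inverse is the pointwise limit of [qker y] as y tends to 0, even at 0, where both vanish by
    the convention on the inverse of 0. *)
Lemma measurable_invr : measurable_fun setT (@GRing.inv R).
Proof.
apply: (@measurable_fun_cvg _ _ _ setT (fun n => qker (n.+1%:R^-1 : R))).
  move=> n; apply: continuous_measurable_fun; apply: continuous_qker.
  by rewrite invr_gt0.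
move=> w _; have [->|w0] := eqVneq w 0.
  rewrite invr0 (_ : (fun n => _) = cst 0); first exact: cvg_cst.
  by apply/funext => n; rewrite /qker mul0r.
have -> : w^-1 = w * (0 ^+ 2 + w ^+ 2)^-1.
  by rewrite expr0n/= add0r; field.
rewrite /qker; apply: cvgM; first exact: cvg_cst.
apply: cvgV; first by rewrite expr0n/= add0r sqrf_eq0.
apply: cvgD; last exact: cvg_cst.
have h := @cvg_harmonic R.
by under eq_fun do rewrite expr2; rewrite expr2; exact: cvgM.
Qed.

(** The strict inequality matches the open intervals of [truncated_hilbert] and makes this
    right-continuous in [e]. *)
Definition tker e w : R := if e < `|w| then w^-1 else 0.

Lemma tker_le e w : 0 < e -> `|tker e w| <= e^-1.
Proof.
move=> e0; rewrite /tker; case: ifPn => ew.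
  by rewrite normfV lef_pV2 ?posrE ?(lt_trans e0 ew)// ltW.
by rewrite normr0 invr_ge0 ltW.
Qed.

Lemma measurable_tker d (T : measurableType d) (D : set T) (e w : T -> R) :
  measurable_fun D e -> measurable_fun D w ->
  measurable_fun D (fun z => tker (e z) (w z)).
Proof.
move=> me mw mD.
have mlt : measurable_fun D (fun z => e z < `|w z|).
  by apply: measurable_fun_ltr => //; exact: measurableT_comp.
apply: measurable_fun_if => //.
by apply: measurable_funS (measurableT_comp measurable_invr mw).
Qed.

(** The density whose mass on [0, a[ is a^2 / (1 + a^2). For a = |w| / y that mass is w times
    [qker y w], the ratio of the smooth kernel to 1 / w. *)
Definition abel_weight s : R := 2 * s / (1 + s ^+ 2) ^+ 2.

Lemma abel_weight0 : abel_weight 0 = 0.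
Proof. by rewrite /abel_weight mulr0 mul0r. Qed.

Local Notation leb := (@lebesgue_measure R).

Lemma abel_den_gt0 s : 0 < 1 + s ^+ 2.
Proof. by rewrite ltr_pwDl// sqr_ge0. Qed.

Lemma is_derive_abel s :
  is_derive s 1 (fun s => - (1 + s ^+ 2)^-1) (abel_weight s).
Proof.
have D0 : 1 + s ^+ 2 != 0 by rewrite gt_eqF ?abel_den_gt0.
have h : is_derive s 1 (fun s => 1 + s ^+ 2) (2 * s).
  by apply: is_derive_eq; rewrite /GRing.scale/=; ring.
have h2 : is_derive s 1 (fun s => (1 + s ^+ 2)^-1) (- (1 + s ^+ 2) ^- 2 *: (2 * s)).
  exact: is_deriveV.
apply: (is_derive_eq (is_deriveN h2)).
by rewrite /abel_weight /GRing.scale/=; field.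
Qed.

Lemma continuous_abel_weight : continuous abel_weight.
Proof.
move=> s; rewrite /abel_weight; apply: cvgM.
  by apply: cvgM; [exact: cvg_cst|exact: cvg_id].
apply: cvgV; first by rewrite sqrf_eq0 gt_eqF ?abel_den_gt0.
apply: (continuous_comp (f := fun s => 1 + s ^+ 2) (g := fun z => z ^+ 2)).
  by apply: cvgD; [exact: cvg_cst|exact: exprn_continuous].
exact: exprn_continuous.
Qed.

Lemma abel_weight_ge0 s : 0 <= s -> 0 <= abel_weight s.
Proof. by move=> s0; rewrite divr_ge0 ?sqr_ge0// mulr_ge0. Qed.

Let cont_prim s : {for s, continuous (fun s => - (1 + s ^+ 2)^-1)}.
Proof.
apply/differentiable_continuous/derivable1_diffP.
exact: (@ex_derive _ _ _ _ _ _ _ (is_derive_abel s)).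
Qed.

Lemma integral_abel_weight a : 0 < a ->
  (\int[leb]_(s in `[0%R, a[) (abel_weight s)%:E = (a ^+ 2 / (1 + a ^+ 2))%:E)%E.
Proof.
move=> a0; rewrite integral_itv_bndo_bndc; last first.
  apply/measurable_EFinP; apply: measurable_funTS.
  exact: continuous_measurable_fun continuous_abel_weight.
rewrite (@continuous_FTC2 _ abel_weight (fun s => - (1 + s ^+ 2)^-1))//.
- rewrite -EFinB expr0n addr0 invr1 opprK; congr EFin.
  by field; rewrite gt_eqF ?abel_den_gt0.
- by apply: continuous_subspaceT; exact: continuous_abel_weight.
- split.
  + by move=> s _; exact: (@ex_derive _ _ _ _ _ _ _ (is_derive_abel s)).
  + by apply: cvg_at_right_filter; exact: cont_prim.
  + by apply: cvg_at_left_filter; exact: cont_prim.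
- by move=> s _; rewrite derive1E; have [_ ->] := is_derive_abel s.
Qed.

Lemma integral_abel_weight_total :
  (\int[leb]_(s in `[0%R, +oo[) (abel_weight s)%:E = 1)%E.
Proof.
rewrite (@ge0_continuous_FTC2y _ abel_weight (fun s => - (1 + s ^+ 2)^-1) 0 0).
- by rewrite expr0n addr0 invr1 -EFinB opprK add0r.
- exact: abel_weight_ge0.
- by apply: continuous_subspaceT; exact: continuous_abel_weight.
- apply/cvgrPdist_le => e e0; near=> s.
  rewrite sub0r opprK ger0_norm ?invr_ge0 ?(ltW (abel_den_gt0 _))//.
  rewrite -[leRHS]invrK lef_pV2 ?posrE ?abel_den_gt0 ?invr_gt0//.
  have s1 : 1 <= s by near: s; exact: nbhs_pinfty_ge.
  have se : e^-1 <= s by near: s; apply: nbhs_pinfty_ge; rewrite num_real.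
  by apply: (le_trans se); nra.
- by move=> s _; exact: (@ex_derive _ _ _ _ _ _ _ (is_derive_abel s)).
- by apply: cvg_at_right_filter; exact: cont_prim.
- by move=> s _; rewrite derive1E; have [_ ->] := is_derive_abel s.
Unshelve. all: by end_near. Qed.

(* The conjugate Poisson kernel is an average of sharply truncated kernels, so
   that no maximal function is needed to compare the two regularizations. *)
Lemma integral_abel_tker (y w c : R) : 0 < y ->
  (\int[leb]_(s in `[0%R, +oo[) (c * (abel_weight s * tker (y * s) w))%:E =
    (c * qker y w)%:E)%E /\
  (\int[leb]_(s in `[0%R, +oo[) `|(c * (abel_weight s * tker (y * s) w))%:E| =
    `|c * qker y w|%:E)%E.
Proof.
move=> y0; have [->|w0] := eqVneq w 0.
  have t0 s : tker (y * s) 0 = 0 by rewrite /tker invr0; case: ifP.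
  by split; rewrite integral0_eq ?/qker ?mul0r ?mulr0 ?normr0// => s _;
    rewrite t0 !mulr0 ?abse0.
pose a := `|w| / y; have a0 : 0 < a by rewrite divr_gt0// normr_gt0.
pose g s : R := if s < a then abel_weight s else 0.
have tg s : abel_weight s * tker (y * s) w = w^-1 * g s.
  rewrite /tker /g /a ltr_pdivlMr// (mulrC s); case: ifP => _.
    by rewrite mulrC.
  by rewrite !mulr0.
have mI : measurable (`[0, +oo[%classic : set (measurableTypeR R)).
  exact: measurable_itv.
have g0 s : `[0, +oo[%classic s -> (0 <= (g s)%:E)%E.
  rewrite /= in_itv/= andbT => s0; rewrite lee_fin /g; case: ifP => // _.
  exact: abel_weight_ge0.
have Ig : (\int[leb]_(s in `[0%R, +oo[) (g s)%:E = (a ^+ 2 / (1 + a ^+ 2))%:E)%E.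
  rewrite -integral_abel_weight// [LHS]integral_mkcond [RHS]integral_mkcond.
  apply: eq_integral => s _; rewrite !patchE /g.
  have [|] := boolP (s \in `[0, a[%classic); rewrite ?inE/= ?in_itv/=.
    move=> /[dup] sa /andP[s0 ->].
    by rewrite mem_set//= in_itv/= s0.
  move=> nsa; case: ifPn => //; rewrite inE/= in_itv/= andbT => s0.
  by move/negP: nsa; rewrite inE/= in_itv/= s0/= => /negP/negbTE ->.
have mg : measurable_fun (`[0, +oo[%classic : set (measurableTypeR R)) (EFin \o g).
  apply/measurable_EFinP; apply: measurable_funTS.
  apply: measurable_fun_if => //.
  - exact: measurable_fun_ltr.
  - apply: measurable_funTS; apply: continuous_measurable_fun.
    exact: continuous_abel_weight.
have ig : leb.-integrable (`[0, +oo[%classic : set (measurableTypeR R)) (EFin \o g).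
  apply/integrableP; split => //.
  under eq_integral => s /set_mem Is do rewrite gee0_abs ?g0//.
  by rewrite Ig ltry.
have qE : w^-1 * (a ^+ 2 / (1 + a ^+ 2)) = qker y w.
  rewrite /qker /a expr_div_n real_normK ?num_real//; field.
  by rewrite w0/= !gt_eqF// ltr_pwDl ?exprn_gt0 ?sqr_ge0.
split.
  under eq_integral do rewrite tg mulrA EFinM.
  by rewrite (integralZl mI ig) Ig -EFinM -mulrA qE.
transitivity (\int[leb]_(s in `[0%R, +oo[) (`|c * w^-1|%:E * (g s)%:E))%E.
  apply: eq_integral => s /set_mem Is.
  rewrite tg mulrA EFinM abseM; congr (_ * _)%E.
  by rewrite gee0_abs// g0.
have a20 : 0 <= a ^+ 2 / (1 + a ^+ 2).
  by rewrite divr_ge0 ?sqr_ge0// ltW// abel_den_gt0.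
by rewrite (integralZl mI ig) Ig -EFinM -qE [c * (_ * _)]mulrA (normrM (c * _)) (ger0_norm a20).
Qed.

End TruncatedKernel.

(** * Truncated transforms as functions of the scale *)

Section TruncatedHilbert.
Variable R : realType.
Local Notation mu := (@completed_lebesgue_measure R).
Local Notation leb := (@lebesgue_measure R).
Variable u : lebesgueR R -> R.
Hypothesis iu : mu.-integrable I11 (EFin \o u).
Implicit Types e t y : R.

(* Without the factor 1 / pi, as is smooth_hilbert. *)
Definition trunc t e : R := \int[mu]_(x in I11) (u x * tker e (x - t)).

Let mI := @measurable_I11 R.
Let mu_ : measurable_fun I11 u.
Proof. exact/measurable_EFinP/(measurable_int mu iu). Qed.

Let inu : mu.-integrable I11 (EFin \o (fun x => `|u x|)).
Proof. exact: integrable_norm. Qed.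

Let norm_u : R := \int[mu]_(x in I11) `|u x|.

Let norm_u_ge0 : 0 <= norm_u.
Proof. by apply: Rintegral_ge0 => x _. Qed.

Lemma measurable_trunc_integrand e t :
  measurable_fun I11 (fun x => u x * tker e (x - t)).
Proof.
have msub : measurable_fun I11 (fun x : lebesgueR R => x - t).
  apply: measurable_funB; last exact: measurable_cst.
  by apply: measurable_funTS; exact: measurable_id_lebesgueR.
exact: measurable_funM mu_ (measurable_tker (measurable_cst e) msub).
Qed.

Let trunc_le_norm e t x : 0 < e -> `|u x * tker e (x - t)| <= e^-1 * `|u x|.
Proof. by move=> e0; rewrite normrM mulrC ler_wpM2r// tker_le. Qed.

Let inue e : mu.-integrable I11 (EFin \o (fun x => e^-1 * `|u x|)).
Proof. exact: (@integrableZl _ _ _ mu _ mI _ _ inu). Qed.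

Lemma integrable_trunc e t : 0 < e ->
  mu.-integrable I11 (EFin \o (fun x => u x * tker e (x - t))).
Proof.
move=> e0; apply: (le_integrable mI _ _ (inue e)).
  by apply/measurable_EFinP; exact: measurable_trunc_integrand.
move=> x _; rewrite lee_fin (ger0_norm (_ : 0 <= e^-1 * `|u x|)) ?trunc_le_norm//.
by rewrite mulr_ge0// invr_ge0 ltW.
Qed.

Lemma trunc_le e t : 0 < e -> `|trunc t e| <= e^-1 * norm_u.
Proof.
move=> e0; have it := integrable_trunc t e0.
apply: (le_trans (le_normr_Rintegral mI it)).
rewrite /norm_u -(RintegralZl _ mI inu); apply: (le_Rintegral mI).
- exact: integrable_norm.
- exact: inue.
- by move=> x _; exact: trunc_le_norm.
Qed.

(** As the scale decreases to [e], the truncated kernel is eventually constant at each point, and it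
    stays bounded by 1 / e. Right-continuity is what later reduces the existence of the limit to
    rational scales. *)
Lemma trunc_right_continuous e t : 0 < e -> trunc t a @[a --> e^'+] --> trunc t e.
Proof.
move=> e0; apply/cvg_at_rightP => a [ea ae].
have a0 n : 0 < a n by exact: lt_trans (ea n).
apply: (Rintegral_dominated_cvg mI _ _ (inue e)).
- by move=> n; exact: measurable_trunc_integrand.
- move=> x _; apply: cvgM; first exact: cvg_cst.
  rewrite /tker; case: ifPn => [ex|].
    apply: cvg_near_cst.
    have : \forall n \near \oo, a n < `|x - t| by apply: (cvgr_lt _ ae).
    by apply: filterS => n ->.
  rewrite -leNgt => xe; apply: cvg_near_cst; apply: nearW => n.
  by rewrite ltNge (le_trans xe (ltW (ea n))).
- move=> n x _; apply: (le_trans (trunc_le_norm _ _ (a0 n))).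
  by rewrite ler_wpM2r// lef_pV2 ?posrE// ltW.
Qed.

Lemma measurable_trunc e : measurable_fun I11 (fun t => trunc t e).
Proof.
pose f (z : lebesgueR R * lebesgueR R) : \bar R := (u z.1 * tker e (z.1 - z.2))%:E.
have m1 : measurable_fun (@I11 R `*` @I11 R) (fun z : lebesgueR R * lebesgueR R => u z.1).
  apply: (measurable_comp mI _ mu_); first by move=> _ [z [? _] <-].
  by apply: measurable_funTS; exact: measurable_fst.
have mf : measurable_fun (@I11 R `*` @I11 R) f.
  apply/measurable_EFinP; apply: (measurable_funM m1).
  apply: (measurable_tker (measurable_cst e)); apply: measurable_funB.
    apply: measurable_funTS; apply: (measurableT_comp (@measurable_id_lebesgueR R)).
    exact: measurable_fst.
  apply: measurable_funTS; apply: (measurableT_comp (@measurable_id_lebesgueR R)).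
  exact: measurable_snd.
have := @measurable_integral_r _ _ _ _ _ mu _ _ mI mI f mf.
by move=> h; apply: (measurableT_comp (@fine_measurable R setT measurableT) h).
Qed.

Lemma measurable_trunc_dilation (D : set (measurableTypeR R)) y t : measurable D ->
  measurable_fun D (fun s => trunc t (y * s)).
Proof.
move=> mD.
pose f (z : lebesgueR R * measurableTypeR R) : \bar R :=
  (u z.1 * tker (y * z.2) (z.1 - t))%:E.
have m1 : measurable_fun (@I11 R `*` D) (fun z : lebesgueR R * measurableTypeR R => u z.1).
  apply: (measurable_comp mI _ mu_); first by move=> _ [z [? _] <-].
  by apply: measurable_funTS; exact: measurable_fst.
have m2 : measurable_fun setT (fun z : lebesgueR R * measurableTypeR R => z.2).
  exact: measurable_snd.
have mf : measurable_fun (@I11 R `*` D) f.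
  apply/measurable_EFinP; apply: (measurable_funM m1).
  apply: measurable_funTS; apply: measurable_tker.
    exact: measurable_funM (measurable_cst y) m2.
  apply: measurable_funB; last exact: measurable_cst.
  apply: (measurableT_comp (@measurable_id_lebesgueR R)).
  exact: measurable_fst.
have h := @measurable_integral_r _ _ _ _ _ mu _ _ mI mD f mf.
exact: (measurableT_comp (@fine_measurable R setT measurableT) h).
Qed.

(** Fubini applied to the representation of [qker] by truncated kernels. Absolute convergence holds
    because averaging absolute values gives exactly that of the smooth integrand. *)
Lemma smooth_hilbert_abel y t : 0 < y ->
  smooth_hilbert y u t =
  \int[leb]_(s in `[0, +oo[) (abel_weight s * trunc t (y * s)).
Proof.
move=> y0.
have mS : measurable (`[0%R, +oo[%classic : set (measurableTypeR R)).
  exact: measurable_itv.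
pose f (z : lebesgueR R * measurableTypeR R) : \bar R :=
  (u z.1 * (abel_weight z.2 * tker (y * z.2) (z.1 - t)))%:E.
have m1 : measurable_fun (@I11 R `*` (`[0%R, +oo[%classic : set (measurableTypeR R)))
    (fun z : lebesgueR R * measurableTypeR R => u z.1).
  apply: (measurable_comp mI _ mu_); first by move=> _ [z [? _] <-].
  by apply: measurable_funTS; exact: measurable_fst.
have m2 : measurable_fun setT (fun z : lebesgueR R * measurableTypeR R => z.2).
  exact: measurable_snd.
have mf : measurable_fun (@I11 R `*` (`[0%R, +oo[%classic : set (measurableTypeR R))) f.
  apply/measurable_EFinP; apply: (measurable_funM m1); apply: measurable_funM.
    apply: measurable_funTS; apply: measurableT_comp m2.
    by apply: continuous_measurable_fun; exact: continuous_abel_weight.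
  apply: measurable_funTS; apply: measurable_tker.
    exact: measurable_funM (measurable_cst y) m2.
  apply: measurable_funB; last exact: measurable_cst.
  apply: (measurableT_comp (@measurable_id_lebesgueR R)).
  exact: measurable_fst.
have iq := integrable_smooth t y0 iu.
have fint : (\int[mu]_(x in I11) \int[leb]_(s in `[0%R, +oo[) `|f (x, s)| < +oo)%E.
  have [_] := integrableP _ _ _ iq; apply: le_lt_trans.
  rewrite le_eqVlt; apply/orP; left; apply/eqP; apply: eq_integral => x _.
  by have [_ ->] := integral_abel_tker (x - t) (u x) y0.
rewrite /smooth_hilbert /Rintegral; congr fine.
transitivity (\int[mu]_(x in I11) \int[leb]_(s in `[0%R, +oo[) f (x, s))%E.
  apply: eq_integral => x _.
  by have [<- _] := integral_abel_tker (x - t) (u x) y0.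
rewrite (fubini_on mI mS mf fint); apply: eq_integral => s /set_mem.
(* At s = 0 nothing is truncated and the inner integral is out of control, but [abel_weight]
   vanishes there. *)
rewrite /= in_itv/= andbT le_eqVlt => /predU1P[<-|s0].
  rewrite abel_weight0 mul0r integral0_eq// => x _.
  by rewrite /f/= abel_weight0 mul0r mulr0.
have ys0 : 0 < y * s by rewrite mulr_gt0.
have it := integrable_trunc t ys0.
rewrite EFinM /trunc /Rintegral fineK; last exact: (integrable_fin_num mI it).
rewrite -(integralZl mI it); apply: eq_integral => x _.
by rewrite /f/= -EFinM; congr EFin; rewrite mulrCA.
Qed.

(** Dominated convergence in the averaging variable: for fixed s > 0 the scale s / (n + 1) tends to
    0. *)
Lemma smooth_hilbert_cvg t (l : R) : trunc t e @[e --> (0 : R)^'+] --> l ->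
  smooth_hilbert n.+1%:R^-1 u t @[n --> \oo] --> l.
Proof.
move=> tl.
have mS : measurable (`[0%R, +oo[%classic : set (measurableTypeR R)).
  exact: measurable_itv.
have [d d0 hd] : exists2 d : R, 0 < d & forall e, 0 < e -> e < d -> `|trunc t e| <= `|l| + 1.
  have : \forall e \near (0 : R)^'+, `|trunc t e| <= `|l| + 1.
    have /cvgrPdist_le/(_ 1 ltr01) := tl.
    apply: filterS => e he; rewrite -[trunc t e](subKr l).
    by apply: (le_trans (ler_normB _ _)); rewrite lerD2l.
  move=> [d /= d0 hd]; exists d => // e e0 ed; apply: hd => //=.
  by rewrite sub0r normrN gtr0_norm.
(* A bound at all scales: near 0 from the convergence, beyond [d] from the L^1 norm divided by
   [d]. *)
pose B := Num.max (`|l| + 1) (d^-1 * norm_u).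
have hB e : 0 < e -> `|trunc t e| <= B.
  move=> e0; rewrite /B le_max; have [ed|de] := ltP e d; first by rewrite hd.
  apply/orP; right; apply: (le_trans (trunc_le t e0)).
  by rewrite ler_wpM2r// lef_pV2 ?posrE.
have iw : leb.-integrable (`[0%R, +oo[%classic : set (measurableTypeR R))
    (EFin \o @abel_weight R).
  apply/integrableP; split.
    apply/measurable_EFinP; apply: measurable_funTS.
    by apply: continuous_measurable_fun; exact: continuous_abel_weight.
  rewrite [ltLHS](_ : _ = 1%E) ?ltry// -[RHS](@integral_abel_weight_total R).
  apply: eq_integral => s /set_mem; rewrite /= in_itv/= andbT => s0.
  by rewrite ger0_norm ?abel_weight_ge0.
have iBw : leb.-integrable (`[0%R, +oo[%classic : set (measurableTypeR R))
    (EFin \o (fun s => B * abel_weight s)).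
  exact: (@integrableZl _ _ _ leb _ mS _ _ iw).
have -> : l = \int[leb]_(s in `[0, +oo[) (abel_weight s * l).
  rewrite (RintegralZr l mS iw) /Rintegral.
  by rewrite integral_abel_weight_total/= mul1r.
rewrite (_ : (fun n => smooth_hilbert _ _ _) =
    (fun n => \int[leb]_(s in `[0, +oo[) (abel_weight s * trunc t (n.+1%:R^-1 * s)))); last first.
  by apply/funext => n; rewrite smooth_hilbert_abel// invr_gt0.
apply: (Rintegral_dominated_cvg mS _ _ iBw).
- move=> n; apply: measurable_funM; last exact: measurable_trunc_dilation.
  apply: measurable_funTS.
  by apply: continuous_measurable_fun; exact: continuous_abel_weight.
- move=> s; rewrite /= in_itv/= andbT le_eqVlt => /predU1P[<-|s0].
    rewrite abel_weight0 mul0r; under eq_fun do rewrite mul0r.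
    exact: cvg_cst.
  apply: cvgM; first exact: cvg_cst.
  have /cvg_at_rightP := tl; apply; split; first by move=> n; rewrite mulr_gt0// invr_gt0.
  rewrite -[X in _ --> X](mul0r s); apply: cvgM; last exact: cvg_cst.
  exact: cvg_harmonic.
- move=> n s; rewrite /= in_itv/= andbT le_eqVlt => /predU1P[<-|s0].
    by rewrite abel_weight0 mul0r normr0 mulr0.
  rewrite normrM mulrC (ger0_norm (abel_weight_ge0 (ltW s0))).
  by rewrite ler_wpM2r ?abel_weight_ge0 ?(ltW s0)// hB// mulr_gt0// invr_gt0.
Qed.

End TruncatedHilbert.

(** Cauchy's criterion at the right of 0, anchored at the points 1 / (n + 1) and tested on rational
    scales only, so that it is expressed by countable operations. *)
Lemma cvg_at_right0P (R : realType) (h : R -> R) :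
  (forall e, 0 < e -> h a @[a --> e^'+] --> h e) ->
  cvg (h e @[e --> (0 : R)^'+]) <->
  forall m : nat, exists n : nat, forall q : rat,
    0 < (ratr q : R) < n.+1%:R^-1 -> `|h (ratr q) - h n.+1%:R^-1| <= m.+1%:R^-1.
Proof.
move=> hr; split => [/cvg_ex[/= l hl] m|H].
  have e0 : 0 < m.+1%:R^-1 / 2 :> R by rewrite divr_gt0// invr_gt0.
  have [d /= d0 hd] : \forall e \near (0 : R)^'+, `|l - h e| <= m.+1%:R^-1 / 2.
    by move/cvgrPdist_le : hl => /(_ _ e0).
  have {}hd e : 0 < e -> e < d -> `|l - h e| <= m.+1%:R^-1 / 2.
    by move=> ? ?; apply: hd => //=; rewrite sub0r normrN gtr0_norm.
  have [n hn] : exists n : nat, n.+1%:R^-1 < d.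
    by have /ltr_add_invr[n] : 0 < d := d0; rewrite add0r; exists n.
  exists n => q /andP[q0 qn].
  have h1 := hd _ q0 (lt_trans qn hn).
  have h2 : `|l - h n.+1%:R^-1| <= m.+1%:R^-1 / 2 by apply: hd => //; rewrite invr_gt0.
  rewrite (_ : h (ratr q) - _ = (l - h n.+1%:R^-1) - (l - h (ratr q))); last by ring.
  by rewrite (splitr m.+1%:R^-1); apply: (le_trans (ler_normB _ _)); exact: lerD.
apply: cauchy_cvg; apply: cauchy_exP => e e0.
have [m hm] : exists m : nat, m.+1%:R^-1 < e.
  by have /ltr_add_invr[m] : 0 < e := e0; rewrite add0r; exists m.
have [n hn] := H m; exists (h n.+1%:R^-1).
change (\forall a \near (0 : R)^'+, ball (h n.+1%:R^-1) e (h a)).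
near=> a; rewrite -ball_normE /ball_/= distrC (le_lt_trans _ hm)//.
have a0 : 0 < a by near: a; exact: nbhs_right_gt.
have an : a < n.+1%:R^-1 by near: a; apply: nbhs_right_lt; rewrite invr_gt0.
(* By right-continuity a violation at [a] would persist at rationals just to the right of [a]. *)
rewrite leNgt; apply/negP => ha.
have : \forall b \near a^'+, m.+1%:R^-1 < `|h b - h n.+1%:R^-1| /\ b < n.+1%:R^-1.
  apply: filterI; last exact: nbhs_right_lt.
  have hc : `|h b - h n.+1%:R^-1| @[b --> a^'+] --> `|h a - h n.+1%:R^-1|.
    by apply: cvg_norm; apply: cvgB; [exact: hr|exact: cvg_cst].
  exact: (cvgr_gt _ hc).
move=> [d /= d0 hd].
have [q] : exists q, ratr q \in `]a, a + d[ by apply: rat_in_itvoo; rewrite ltrDl.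
rewrite in_itv/= => /andP[aq qd].
have [] := hd (ratr q) _ aq.
  by rewrite /= distrC gtr0_norm ?subr_gt0// ltrBlDl.
move=> h1 qn; have := hn q; rewrite qn (lt_trans a0 aq) => /(_ isT).
by rewrite leNgt h1.
Unshelve. all: by end_near. Qed.

Lemma measurable_cvg_at_right0 d (T : measurableType d) (R : realType) (D : set T)
    (h : T -> R -> R) : measurable D ->
  (forall e, 0 < e -> measurable_fun D (h^~ e)) ->
  (forall t e, D t -> 0 < e -> h t a @[a --> e^'+] --> h t e) ->
  measurable (D `&` [set t | cvg (h t e @[e --> (0 : R)^'+])]).
Proof.
move=> mD mh hr.
(* A rational out of range imposes no condition, hence [D] in the other branch. *)
pose A m n q : set T := if 0 < (ratr q : R) < n.+1%:R^-1
  then D `&` [set t | `|h t (ratr q) - h t n.+1%:R^-1| <= m.+1%:R^-1] else D.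
have mA m n q : measurable (A m n q).
  rewrite /A; case: ifPn => // /andP[q0 _]; apply: measurable_fun_le; first exact: mD.
    apply: measurableT_comp => //; apply: measurable_funB; apply: mh => //.
  exact: measurable_cst.
rewrite (_ : _ `&` _ = \bigcap_m \bigcup_n (D `\` \bigcup_q (D `\` A m n q))).
  apply: bigcapT_measurable => m; apply: bigcupT_measurable => n.
  apply: measurableD => //; apply: bigcupT_measurable_rat => q; exact: measurableD.
apply/seteqP; split => t.
  move=> [Dt /(cvg_at_right0P (fun e => hr t e Dt)) H] m _.
  have [n hn] := H m; exists n => //; split => // -[q _ [_]]; apply.
  by rewrite /A; case: ifPn => // qn; split => //; exact: hn.
move=> H; have Dt : D t by have [n _ []] := H 0%N I.
split => //; apply/(cvg_at_right0P (fun e => hr t e Dt)) => m.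
have [n _ [_ hn]] := H m I; exists n => q qn.
apply: contrapT => nh; apply: hn; exists q => //; split => //.
by rewrite /A qn => -[].
Qed.

(** * The principal value and its comparison with the smooth transform *)

Section PrincipalValue.
Variable R : realType.
Local Notation mu := (@completed_lebesgue_measure R).

Lemma truncE (u : lebesgueR R -> R) (t e : R) :
  mu.-integrable I11 (EFin \o u) -> 0 < e -> I11 t ->
  \int[mu]_(x in (`]-1, t - e[%classic : set (lebesgueR R))) (u x * (x - t)^-1) +
  \int[mu]_(x in (`]t + e, 1[%classic : set (lebesgueR R))) (u x * (x - t)^-1) =
  trunc u t e.
Proof.
move=> iu e0; rewrite /I11/= in_itv/= => /andP[t1 t2].
set A : set (lebesgueR R) := `]-1, t - e[%classic.
set B : set (lebesgueR R) := `]t + e, 1[%classic.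
have mA : measurable A by apply: measurable_lebesgueR; exact: measurable_itv.
have mB : measurable B by apply: measurable_lebesgueR; exact: measurable_itv.
(* As t lies in ]-1, 1[, one has t - e < 1 and t + e > -1, so neither interval leaves [I11]. *)
have ABE : A `|` B = I11 `&` [set x : lebesgueR R | e < `|(x : R) - t|].
  apply/seteqP; split => x; rewrite /A /B /I11/= !in_itv/= ltr_normr.
    move=> [/andP[x1 xt]|/andP[tx x1]]; split.
    - by apply/andP; split; lra.
    - by apply/orP; right; lra.
    - by apply/andP; split; lra.
    - by apply/orP; left; lra.
  move=> [/andP[x1 x2] /orP[h|h]]; [right|left]; apply/andP; split; lra.
have AB0 : [disjoint A & B].
  apply/disj_setPLR => x; rewrite /A /B /= !in_itv/= => /andP[_ xt].
  by move=> /andP[tx _]; lra.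
have tE x : (fun x => u x * tker e (x - t)) x =
    ((fun x : lebesgueR R => u x * ((x : R) - t)^-1) \_ [set x : lebesgueR R | e < `|(x : R) - t|]) x.
  rewrite patchE /tker; case: ifPn => h.
    by rewrite ifT//; apply/mem_set.
  by rewrite mulr0 ifF//; apply/negP => /set_mem /=; exact/negP.
have iAB : mu.-integrable (A `|` B) (EFin \o (fun x => u x * ((x : R) - t)^-1)).
  have mAB : measurable (A `|` B) by exact: measurableU.
  have : mu.-integrable (A `|` B) (EFin \o (fun x => u x * tker e (x - t))).
    apply: (@integrableS _ _ _ mu I11); [exact: measurable_I11|exact: mAB| |].
      by rewrite ABE; exact: subIsetl.
    exact: integrable_trunc.
  apply: eq_integrable; first exact: mAB.
  move=> x /set_mem; rewrite ABE => -[_ /= xt].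
  by rewrite /tker xt.
rewrite -(Rintegral_setU mA mB iAB AB0) ABE Rintegral_mkcondr.
by apply: eq_Rintegral => x _; rewrite -tE.
Qed.

Variable f : lebesgueR R -> R[i].
Hypothesis mf : cmeasurable_fun I11 f.
Hypothesis nf : mu.-integrable I11 (fun x => (Normc.normc (f x))%:E).

Let fr x := complex.Re (f x).
Let fi x := complex.Im (f x).

Let ifr : mu.-integrable I11 (EFin \o fr).
Proof. exact: (integrable_dominated nf mf.1 (fun x _ => Re_le_normc (f x))). Qed.

Let ifi : mu.-integrable I11 (EFin \o fi).
Proof. exact: (integrable_dominated nf mf.2 (fun x _ => Im_le_normc (f x))). Qed.

Lemma truncated_hilbertE (t e : R) : 0 < e -> I11 t ->
  truncated_hilbert f t e = ((pi^-1 * trunc fr t e) +i* (pi^-1 * trunc fi t e))%C.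
Proof.
move=> e0 It; rewrite /truncated_hilbert /cintegral.
rewrite -(truncE ifr e0 It) -(truncE ifi e0 It).
have rE x : complex.Re (f x / ((x : R) - t)%:C)%C = fr x * ((x : R) - t)^-1.
  by rewrite -fmorphV /fr; case: (f x) => a b /=; rewrite mulr0 subr0.
have iE x : complex.Im (f x / ((x : R) - t)%:C)%C = fi x * ((x : R) - t)^-1.
  by rewrite -fmorphV /fi; case: (f x) => a b /=; rewrite mulr0 add0r.
have rI D : \int[mu]_(x in D) complex.Re (f x / ((x : R) - t)%:C)%C =
    \int[mu]_(x in D) (fr x * ((x : R) - t)^-1).
  by apply: eq_Rintegral => x _; exact: rE.
have iI D : \int[mu]_(x in D) complex.Im (f x / ((x : R) - t)%:C)%C =
    \int[mu]_(x in D) (fi x * ((x : R) - t)^-1).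
  by apply: eq_Rintegral => x _; exact: iE.
rewrite !rI !iI /=.
by congr (_ +i* _)%C; rewrite mul0r ?subr0 ?addr0.
Qed.

Lemma finite_hilbert_limit (t a b : R) : I11 t ->
  trunc fr t e @[e --> (0 : R)^'+] --> a -> trunc fi t e @[e --> (0 : R)^'+] --> b ->
  finite_hilbert f t = ((pi^-1 * a) +i* (pi^-1 * b))%C.
Proof.
move=> It ha hb; apply: (@cvg_lim R[i]^o); first exact: norm_hausdorff.
have {}ha : pi^-1 * trunc fr t e @[e --> (0 : R)^'+] --> pi^-1 * a.
  by apply: cvgM => //; exact: cvg_cst.
have {}hb : pi^-1 * trunc fi t e @[e --> (0 : R)^'+] --> pi^-1 * b.
  by apply: cvgM => //; exact: cvg_cst.
apply/cvgrPdist_le => -[c d] /=; rewrite ltcE/= => /andP[/eqP-> c0].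
have c20 : 0 < c / 2 by rewrite divr_gt0.
near=> e; have e0 : 0 < e by near: e; exact: nbhs_right_gt.
rewrite truncated_hilbertE//.
rewrite normc_def lecE/= eqxx/=.
apply: (le_trans (@normc_le _ ((_ - _) +i* (_ - _))%C)) => /=.
rewrite (splitr c); apply: lerD.
  by near: e; move/cvgrPdist_le : ha; apply.
by near: e; move/cvgrPdist_le : hb; apply.
Unshelve. all: by end_near. Qed.

(** A limit of the complex truncations would make both components converge; hence there is none and
    [lim] takes its default value 0. *)
Lemma finite_hilbert_no_limit (t : R) : I11 t ->
  ~ (cvg (trunc fr t e @[e --> (0 : R)^'+]) /\ cvg (trunc fi t e @[e --> (0 : R)^'+])) ->
  finite_hilbert f t = 0.
Proof.
move=> It H; rewrite /finite_hilbert dvgP// => /cvg_ex[/= l hl]; apply: H.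
have near_l (c : R) : 0 < c -> \forall e \near (0 : R)^'+,
    Normc.normc (l - truncated_hilbert f t e) <= c.
  move=> c0; move/cvgrPdist_le : hl => /(_ c%:C%C).
  rewrite ltcE/= eqxx => /(_ c0); apply: filterS => e.
  by rewrite normc_def lecE/= eqxx/=; case: (l - _).
have piK (g : R -> R) (z : R) :
    (forall c : R, 0 < c -> \forall e \near (0 : R)^'+, `|z - pi^-1 * g e| <= c) ->
    cvg (g e @[e --> (0 : R)^'+]).
  move=> hg; apply/cvg_ex; exists (pi * z).
  have -> : g = (fun e => pi * (pi^-1 * g e)).
    by apply/funext => e; rewrite mulVKf// gt_eqF// pi_gt0.
  by apply: cvgM; [exact: cvg_cst|apply/cvgrPdist_le => c; exact: hg].
split.
  apply: (piK _ (complex.Re l)) => c c0; near=> e.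
  have e0 : 0 < e by near: e; exact: nbhs_right_gt.
  have : Normc.normc (l - truncated_hilbert f t e) <= c by near: e; exact: near_l.
  apply: le_trans; apply: le_trans (Re_le_normc _).
  by rewrite truncated_hilbertE//; case: (l) => p q.
apply: (piK _ (complex.Im l)) => c c0; near=> e.
have e0 : 0 < e by near: e; exact: nbhs_right_gt.
have : Normc.normc (l - truncated_hilbert f t e) <= c by near: e; exact: near_l.
apply: le_trans; apply: le_trans (Im_le_normc _).
by rewrite truncated_hilbertE//; case: (l) => p q.
Unshelve. all: by end_near. Qed.

Let G u : set (lebesgueR R) := I11 `&` [set t | cvg (trunc u t e @[e --> (0 : R)^'+])].

Let mG u : mu.-integrable I11 (EFin \o u) -> measurable (G u).
Proof.
move=> iu; apply: measurable_cvg_at_right0; first exact: measurable_I11.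
- by move=> e e0; exact: measurable_trunc.
- by move=> t e _ e0; exact: trunc_right_continuous.
Qed.

Let H := G fr `&` G fi.

(** On the measurable set [H] of convergence the transform is a limit of smooth transforms, and it
    is 0 elsewhere. Multiplying by the indicator of [H] gives measurable functions converging at
    every point of [I11]. *)
Lemma cmeasurable_finite_hilbert : cmeasurable_fun I11 (finite_hilbert f).
Proof.
have mH : measurable H by apply: measurableI; exact: mG.
pose g u n (t : lebesgueR R) : R := \1_H t * (pi^-1 * smooth_hilbert n.+1%:R^-1 u t).
have n0 n : 0 < n.+1%:R^-1 :> R by rewrite invr_gt0.
have mg u : (forall y, 0 < y -> measurable_fun I11 (smooth_hilbert y u)) ->
    forall n, measurable_fun I11 (g u n).
  move=> mu_ n; apply: measurable_funM.
    by apply: measurable_funTS; exact: measurable_indic.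
  by apply: measurable_funM; [exact: measurable_cst|exact: mu_].
have mr : forall n, measurable_fun I11 (g fr n).
  apply: mg => y y0.
  (* Only measurability is extracted here, so the exponent 0 will do. *)
  by have [] := wnrm_smooth_real (lexx 0) y0 nf mf.1 (fun x _ => Re_le_normc (f x)).
have mi : forall n, measurable_fun I11 (g fi n).
  apply: mg => y y0.
  by have [] := wnrm_smooth_real (lexx 0) y0 nf mf.2 (fun x _ => Im_le_normc (f x)).
have limE (t : R) : I11 t -> g fr n t @[n --> \oo] --> complex.Re (finite_hilbert f t) /\
    g fi n t @[n --> \oo] --> complex.Im (finite_hilbert f t).
  move=> It; have [Ht|nHt] := pselect (H t).
    have [[_ /cvg_ex[a ha]] [_ /cvg_ex[b hb]]] := Ht.
    rewrite (finite_hilbert_limit It ha hb)/= /g indicE mem_set//.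
    by split; under eq_fun do rewrite mul1r; apply: cvgM; (try exact: cvg_cst);
      exact: smooth_hilbert_cvg.
  have -> : finite_hilbert f t = 0.
    apply: (finite_hilbert_no_limit It) => -[ha hb].
    exact: (nHt (conj (conj It ha) (conj It hb))).
  rewrite /g indicE (memNset nHt) /=.
  by split; under eq_fun do rewrite mul0r; exact: cvg_cst.
split.
- by apply: (measurable_fun_cvg mr) => t /limE[].
- by apply: (measurable_fun_cvg mi) => t /limE[].
Qed.

(** The pointwise condition of [wnrm_fatou]. Where there is no principal value the transform is 0
    and no l >= 0 lies strictly below it. *)
Lemma finite_hilbert_near_smooth (t l : R) : I11 t -> 0 <= l ->
  l < Normc.normc (finite_hilbert f t) ->
  \forall n \near \oo, l < pi^-1 *
    Normc.normc (smooth_hilbert n.+1%:R^-1 fr t +i* smooth_hilbert n.+1%:R^-1 fi t)%C.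
Proof.
move=> It l0; have [[ha hb]|nH] :=
    pselect (cvg (trunc fr t e @[e --> (0 : R)^'+]) /\ cvg (trunc fi t e @[e --> (0 : R)^'+])); last first.
  by rewrite (finite_hilbert_no_limit It nH) /Normc.normc/= expr0n addr0 sqrtr0 ltNge l0.
move: ha hb => /cvg_ex[/= a ha] /cvg_ex[/= b hb].
rewrite (finite_hilbert_limit It ha hb) => llt.
have p0 : 0 <= (pi : R)^-1 by rewrite invr_ge0 pi_ge0.
have sE n : pi^-1 * Normc.normc
    (smooth_hilbert n.+1%:R^-1 fr t +i* smooth_hilbert n.+1%:R^-1 fi t)%C =
    Num.sqrt ((pi^-1 * smooth_hilbert n.+1%:R^-1 fr t) ^+ 2 +
     (pi^-1 * smooth_hilbert n.+1%:R^-1 fi t) ^+ 2).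
  by rewrite /= !exprMn -mulrDr sqrtrM ?sqr_ge0// sqrtr_sqr ger0_norm.
have hr := smooth_hilbert_cvg ifr ha.
have hi := smooth_hilbert_cvg ifi hb.
have sq (x : nat -> R) (z : R) : x n @[n --> \oo] --> z ->
    (pi^-1 * x n) ^+ 2 @[n --> \oo] --> (pi^-1 * z) ^+ 2.
  move=> xz; rewrite expr2; under eq_fun do rewrite expr2.
  by apply: cvgM; apply: cvgM => //; exact: cvg_cst.
have h : Num.sqrt ((pi^-1 * smooth_hilbert n.+1%:R^-1 fr t) ^+ 2 +
     (pi^-1 * smooth_hilbert n.+1%:R^-1 fi t) ^+ 2) @[n --> \oo] -->
    Num.sqrt ((pi^-1 * a) ^+ 2 + (pi^-1 * b) ^+ 2).
  exact: (continuous_cvg _ (@sqrt_continuous R _) (cvgD (sq _ _ hr) (sq _ _ hi))).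
by apply: filterS (cvgr_gt _ h _ llt) => n; rewrite sE.
Qed.

End PrincipalValue.

Theorem proposition4p4 (R : realType) (beta : R) (beta_ge0 : 0 <= beta) :
  exists C : R, forall f : lebesgueR R -> R[i],
    LlogL (1 + beta) f ->
    LlogL beta (finite_hilbert f) /\
    (LlogL_norm beta (finite_hilbert f) <= C%:E * LlogL_norm (1 + beta) f)%E.
Proof.
(* The constant of [conj_wnrm], doubled for positive and negative parts and again for real and
   imaginary parts. The factor 1 / pi restores the normalization left out of the smooth
   transforms. *)
pose K : R := 4 * (4 * pi * (1 + 4 * (4 * (beta + 1)) `^ (beta + 1))).
exists (pi^-1 * K) => f fL; have [mf flty] := fL.
have nf := LlogL_integrable (addr_ge0 ler01 beta_ge0) fL.
have mT := cmeasurable_finite_hilbert mf nf.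
have mNT := measurable_normc mT.
have mw := @measurable_logw_I02 R beta.
have w0 (t : lebesgueR R) : I02 t -> 0 <= logw beta t by move=> _; exact: logw_ge0.
have pi0 : 0 < (pi : R)^-1 by rewrite invr_gt0 pi_gt0.
pose q (n : nat) (t : lebesgueR R) : R := Normc.normc
  (smooth_hilbert n.+1%:R^-1 (fun x => complex.Re (f x)) t +i*
   smooth_hilbert n.+1%:R^-1 (fun x => complex.Im (f x)) t)%C.
have hq n : measurable_fun I11 (q n) /\
    (wnrm (logw beta) (q n) <= K%:E * LlogL_norm (1 + beta) f)%E.
  have n0 : 0 < n.+1%:R^-1 :> R by rewrite invr_gt0.
  by rewrite LlogL_normE; exact: (wnrm_smooth_complex beta_ge0 n0 mf nf).
have mq n : measurable_fun I11 (fun t => pi^-1 * q n t).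
  exact: measurable_funM (measurable_cst _) (hq n).1.
have bound : (LlogL_norm beta (finite_hilbert f) <=
    (pi^-1 * K)%:E * LlogL_norm (1 + beta) f)%E.
  rewrite [leLHS]LlogL_normE; apply: (wnrm_fatou mw w0 mq mNT).
    by move=> t l It l0; exact: (finite_hilbert_near_smooth mf nf It l0).
  move=> n; apply: (le_trans (wnrmZ pi0 mw w0 (hq n).1)).
  rewrite EFinM -muleA; apply: lee_wpmul2l; last exact: (hq n).2.
  by rewrite lee_fin ltW.
split; last exact: bound.
split; first exact: mT.
apply: (le_lt_trans bound); apply: lte_mul_pinfty => //.
rewrite lee_fin mulr_ge0 ?(ltW pi0)// !mulr_ge0 ?pi_ge0//.
by rewrite addr_ge0// mulr_ge0// powR_ge0.
Qed.
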